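(* Let $\Gamma$ be a countable group and let $\Gamma\curvearrowright(X,\lambda)$ be an ergodic, essentially free, probability-measure-preserving action. Assume that $\mathcal{R}$ is an amenable p.m.p. equivalence relation over a probability space $(Y,\nu)$, and $\alpha:\mathcal{R}\to\Gamma$ is a class injective measurable cocycle such that the extended relation $\mathcal{R}^X$ on $(X\times Y,\lambda\times\nu)$ is ergodic. Then, for every bounded hyperfinite exhaustion $(\mathcal{R}_n)$ of $\mathcal{R}$ satisfying the growth condition $$\lim_{n\to\infty}\frac{\operatorname{ess\,inf}_{y}|\mathcal{R}_n(y)|}{\log n}=\infty,$$ and every finite measurable partition $\mathcal{P}$ of $X$, $$\lim_{n\to\infty}\frac{\mathcal{J}\big(\mathcal{P}^{\mathcal{R}_n(y)}(x)\big)}{|\mathcal{R}_n(y)|}=h^*_{\mathcal{P}}(\alpha)$$ for $(\lambda\times\nu)$-almost every $(x,y)\in X\times Y$, where $h^*_{\mathcal{P}}(\alpha)$ is the orbital entropy of the partition $\mathcal{P}$.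
   Context: All probability spaces are standard. An equivalence relation $\mathcal{R}\subset Y\times Y$ over $(Y,\nu)$ is Borel with countable classes $\mathcal{R}(y)$; p.m.p. means that $\nu$ is $\mathcal{R}$-invariant. Amenable is equivalent (Connes–Feldman–Weiss) to hyperfinite: modulo null sets $\mathcal{R}=\bigcup_n\mathcal{R}_n$ with $\mathcal{R}_n\subseteq\mathcal{R}_{n+1}$ Borel subequivalence relations with finite classes. Such a sequence is a hyperfinite exhaustion; it is bounded if for each $n$ the function $y\mapsto|\mathcal{R}_n(y)|$ is essentially bounded. A cocycle is a measurable map $\alpha:\mathcal{R}\to\Gamma$ such that for a.e. $y$ and all $w,u,z\in\mathcal{R}(y)$, $\alpha(z,u)=\alpha(z,w)\alpha(w,u)$. It is class injective if for $\nu$-a.e. $y$, $\alpha(y,z)\ne\alpha(y,w)$ whenever $z\neq w$ in $\mathcal{R}(y)$. The extended relation $\mathcal{R}^X$ over $(X\times Y,\lambda\times\nu)$ is: $((x,y),(x',y'))\in\mathcal{R}^X$ iff $(y,y')\in\mathcal{R}$ and $x=\alpha(y,y')x'$. A measure-preserving relation is ergodic if every measurable set which is invariant (a union of classes, up to null sets) has measure $0$ or $1$. For a measurable partition $\mathcal{P}$ of $X$, $H(\mathcal{P})=-\sum_{A\in\mathcal{P}}\lambda(A)\log\lambda(A)$; $g^{-1}\mathcal{P}=\{g^{-1}A:A\in\mathcal{P}\}$; $\bigvee$ is common refinement; and $$\mathcal{P}^{\mathcal{R}_n(y)}:=\bigvee_{z\in\mathcal{R}_n(y)}\alpha(z,y)^{-1}\mathcal{P}.$$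 For a partition $\mathcal{Q}$, $\mathcal{Q}(x)$ is the element of $\mathcal{Q}$ containing $x$, and $\mathcal{J}(\mathcal{Q}(x)):=-\log\lambda(\mathcal{Q}(x))$ is the information function. The logarithm in $H$ and $\mathcal{J}$ is to the same fixed base. The orbital entropy of $\mathcal{P}$ is $$h^*_{\mathcal{P}}(\alpha)=\lim_{n\to\infty}\int_Y\frac{H\big(\mathcal{P}^{\mathcal{R}_n(y)}\big)}{|\mathcal{R}_n(y)|}\,d\nu(y),$$ where the limit is known to exist and to be the same for every bounded hyperfinite exhaustion (Danilenko). *)

(* Defs.v *)
From HB Require Import structures.
From mathcomp Require Import all_boot all_order all_algebra.
From mathcomp Require Import finmap.
From mathcomp Require Import all_classical all_reals all_analysis ess_sup_inf.
Set Implicit Arguments.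
Unset Strict Implicit.
Unset Printing Implicit Defensive.
Import Order.TTheory GRing.Theory Num.Theory.
Import numFieldNormedType.Exports.
Local Open Scope classical_set_scope.
Local Open Scope ring_scope.

(* The sigma-algebra of T is the Borel sigma-algebra of a Polish topology:
   f identifies T with a separable complete metrizable space U. *)
Definition standard_borel (R : realType) d (T : measurableType d) : Prop :=
  exists (U : completePseudoMetricType R) (f : T -> U),
    [/\ hausdorff_space U, @second_countable U, bijective f &
        forall A : set T, measurable A <->
          exists2 B : set U, (<<s @open U >>) B & A = f @^-1` B].

Section actions.
Context (R : realType) (G : groupType) d (X : measurableType d).
Variables (lambda : probability X R) (act : G -> X -> X).

Definition pmp_action : Prop :=
  [/\ forall x, act 1%g x = x,
      forall g h x, act (g * h)%g x = act g (act h x),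
      forall g, measurable_fun [set: X] (act g) &
      forall g A, measurable A -> lambda (act g @^-1` A) = lambda A].

Definition ergodic_action : Prop := forall A : set X, measurable A ->
  (forall g, {ae lambda, forall x, A (act g x) <-> A x}) ->
  lambda A = 0%E \/ lambda A = 1%E.

Definition essentially_free : Prop :=
  {ae lambda, forall x, forall g, g <> 1%g -> act g x <> x}.

End actions.

Definition rel_class T (E : set (T * T)) (y : T) : set T := [set z | E (y, z)].

(* Only meaningful for finite classes. *)
Definition class_card (T : choiceType) (E : set (T * T)) (y : T) : nat :=
  #|` fset_set (rel_class E y)|.

Definition is_equivalence T (E : set (T * T)) : Prop :=
  [/\ forall y, E (y, y), forall y z, E (y, z) -> E (z, y) &
      forall x y z, E (x, y) -> E (y, z) -> E (x, z)].

Section relations.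
Context (R : realType) d (Y : measurableType d).
Variable nu : probability Y R.
Implicit Types E : set (Y * Y).

Definition countable_borel_rel E : Prop :=
  [/\ measurable E, is_equivalence E & forall y, countable (rel_class E y)].

(* f : A -> B is a Borel isomorphism with inverse g, and its graph is in E;
   A = B = setT gives the elements of the full group of E. *)
Definition partial_iso E (A B : set Y) (f g : Y -> Y) : Prop :=
  [/\ measurable A /\ measurable B,
      measurable_fun A f /\ measurable_fun B g,
      {homo f : y / A y >-> B y} /\ {homo g : y / B y >-> A y},
      (forall y, A y -> g (f y) = y) /\ (forall y, B y -> f (g y) = y) &
      forall y, A y -> E (y, f y)].

Definition invariant_measure E : Prop := forall A B f g,
  partial_iso E A B f g -> nu A = nu B.

Definition pmp_rel E : Prop := countable_borel_rel E /\ invariant_measure E.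

Definition bounded_measurable d' (T : measurableType d') (F : T -> R) : Prop :=
  measurable_fun [set: T] F /\ exists M, forall p, `|F p| <= M.

(* A left-invariant mean L^oo(E) -> L^oo(Y), in the sense of
   Connes-Feldman-Weiss: linear over L^oo(Y), positive, unital and equivariant
   under the full group.  It is given on representatives; positivity is asked
   for functions that are nonnegative on E off a null set of classes, so m only
   depends on the restriction of F to E modulo null sets, and it forces m F to
   be essentially bounded. *)
Definition left_invariant_mean E (m : (Y * Y -> R) -> Y -> R) : Prop :=
  [/\ forall F, bounded_measurable F -> measurable_fun [set: Y] (m F),
      forall u F F', bounded_measurable u ->
        bounded_measurable F -> bounded_measurable F' ->
        {ae nu, forall y,
          m (fun p => u p.1 * F p + F' p) y = u y * m F y + m F' y},
      forall F, bounded_measurable F ->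
        {ae nu, forall y, forall z, E (y, z) -> 0 <= F (y, z)} ->
        {ae nu, forall y, 0 <= m F y},
      {ae nu, forall y, m (fun=> 1) y = 1} &
      forall f g F, partial_iso E setT setT f g -> bounded_measurable F ->
        {ae nu, forall y, m (fun p => F (f p.1, p.2)) y = m F (f y)}].

Definition amenable_rel E : Prop := exists m, left_invariant_mean E m.

Definition hyperfinite_exhaustion E (En : nat -> set (Y * Y)) : Prop :=
  [/\ forall n, measurable (En n) /\ is_equivalence (En n),
      forall n y, finite_set (rel_class (En n) y),
      forall n, En n `<=` En n.+1,
      forall n, En n `<=` E &
      {ae nu, forall y, rel_class E y = \bigcup_n rel_class (En n) y}].

Definition bounded_exhaustion E (En : nat -> set (Y * Y)) : Prop :=
  hyperfinite_exhaustion E En /\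
  forall n, exists M : nat, {ae nu, forall y, (class_card (En n) y <= M)%N}.

Definition growth_condition (En : nat -> set (Y * Y)) : Prop :=
  (ess_inf nu (fun y => ((class_card (En n) y)%:R)%:E)
     * ((ln n%:R)^-1)%:E)%E @[n --> \oo] --> +oo%E.

End relations.

Section cocycles.
Context (R : realType) (G : groupType) d (Y : measurableType d).
Variable nu : probability Y R.
Variable E : set (Y * Y).

(* The cocycle lives on E: the values alpha y z for (y, z) outside of E are
   irrelevant.  G carries the discrete sigma-algebra. *)
Definition measurable_cocycle (alpha : Y -> Y -> G) : Prop :=
  (forall g, measurable (E `&` [set p | alpha p.1 p.2 = g])) /\
  {ae nu, forall y, forall w u z,
     rel_class E y w -> rel_class E y u -> rel_class E y z ->
     alpha z u = (alpha z w * alpha w u)%g}.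

Definition class_injective (alpha : Y -> Y -> G) : Prop :=
  {ae nu, forall y, forall z w,
     rel_class E y z -> rel_class E y w -> z <> w -> alpha y z <> alpha y w}.

Definition extended_rel X (act : G -> X -> X) (alpha : Y -> Y -> G) :
    set ((X * Y) * (X * Y)) :=
  [set q | E (q.1.2, q.2.2) /\ q.1.1 = act (alpha q.1.2 q.2.2) q.2.1].

End cocycles.

Definition ergodic_rel (R : realType) d (T : measurableType d)
    (mu : {measure set T -> \bar R}) (E : set (T * T)) : Prop :=
  forall A : set T, measurable A ->
    {ae mu, forall p, forall q, E (p, q) -> (A p <-> A q)} ->
    mu A = 0%E \/ mu A = 1%E.

Section partitions.
Context (R : realType) d (X : measurableType d).
Variables (b : R) (lambda : probability X R).

Definition finite_measurable_partition (P : set (set X)) : Prop :=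
  [/\ classical_sets.partition P id [set: X], finite_set P &
      forall A, P A -> measurable A].

Definition common_refinement I (F : set I) (Q : I -> set (set X)) :
    set (set X) :=
  [set B | B !=set0 /\
     exists2 A : I -> set X, (forall i, F i -> Q i (A i)) &
       B = \bigcap_(i in F) A i].

(* ln 0 = 0 gives the usual convention 0 log 0 = 0. *)
Definition partition_entropy (P : set (set X)) : R :=
  - \sum_(A \in P) (fine (lambda A) * (ln (fine (lambda A)) / ln b)).

(* Equal to +oo on null sets. *)
Definition information (A : set X) : \bar R :=
  (- (lne (lambda A) * ((ln b)^-1)%:E))%E.

End partitions.

Section orbital_entropy.
Context (R : realType) (G : groupType).
Context d1 (X : measurableType d1) d2 (Y : measurableType d2).
Variables (b : R) (lambda : probability X R) (nu : probability Y R).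
Variables (act : G -> X -> X) (alpha : Y -> Y -> G) (P : set (set X)).

Definition orbit_partition (E : set (Y * Y)) (y : Y) : set (set X) :=
  common_refinement (rel_class E y)
    (fun z => [set act (alpha z y) @^-1` A | A in P]).

Definition mean_orbit_entropy (E : set (Y * Y)) : \bar R :=
  (\int[nu]_y (partition_entropy b lambda (orbit_partition E y)
                 / (class_card E y)%:R)%:E)%E.

(* The common value of the limits along all bounded exhaustions of E. *)
Definition orbital_entropy (E : set (Y * Y)) : R :=
  [get h : R | forall En, bounded_exhaustion nu E En ->
     mean_orbit_entropy (En n) @[n --> \oo] --> h%:E].

End orbital_entropy.

(* Main.v *)
Require Import Defs.
From HB Require Import structures.
From mathcomp Require Import finmap.
From mathcomp Require Import all_boot all_order all_algebra.
From mathcomp Require Import all_classical all_reals all_analysis ess_sup_inf.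
From mathcomp Require Import measurable_realfun lra.
Set Implicit Arguments.
Unset Strict Implicit.
Unset Printing Implicit Defensive.
Import Order.TTheory GRing.Theory Num.Theory.
Import numFieldNormedType.Exports.
Local Open Scope classical_set_scope.
Local Open Scope ring_scope.
Import HBSimple HBNNSimple.

(** The theorem is proved along the lines of Breiman's proof of the
    Shannon-McMillan theorem.

    Y is given a measurable linear order, and for a point (x, y) the conditional
    information I_n(x, y) (cond_info) of the block of x is taken given the blocks
    at the points that precede y in its E_n-class (past).  Telescoping along the
    order (chain_rule) shows that the information of the name of x along the class
    of y is the sum of I_n over the extended class of (x, y).  Divided by the
    class size it is therefore an average (avg) of I_n, and the problem becomes an
    ergodic theorem for a sequence of functions.

    For fixed y the pasts increase with n and generate a filtration of finite
    partitions of X.  Along it the I_n converge almost everywhere, since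
    conditional probabilities cannot cross an interval infinitely often
    (crossing_negligible), and their supremum has an integral bounded in terms of
    the number of blocks (integral_sup_information).  Squeezing I_n between the
    infimum and the supremum of its later terms reduces the claim to a fixed
    integrable function, for which the averages over extended classes obey a
    maximal inequality and hence, by ergodicity of the extended relation, an
    ergodic theorem (ergodic_upper, ergodic_lower).  The averages of I_n thus tend
    to h, the integral of the limit of the I_n (ae_cvg_avg_info), and so do the
    integrals of the I_n, which are the mean entropies (cvg_integral_orbit_info).

    Two exhaustions have cofinal filtrations of pasts over almost every y, so the
    limits of the I_n agree and h is the same for both (integral_info_limit_eq).  Hence h, up to the base of the logarithm, is the
    orbital entropy (orbital_entropyE).

    All of this needs measurable sets obtained by projecting sets with finite
    sections.  They come from the separation theorem for Souslin sets
    (souslin_separation, measurable_proj1_nonmax), in a setting stable under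
    products (complete_sieve).  The invariance of nu, stated for partial
    isomorphisms, is turned into the mass transport principle (mass_transport) by
    peeling off the largest points of the sections.  That principle makes the
    averages preserve integrals, and it shows that the points whose class meets a
    null set form a null set, so that conditions valid almost everywhere may be
    assumed to hold everywhere (exists_good_part, tame_restrict). *)

(** * Complete sieves *)

(** A family F of sets with countable covers C k that behaves like the closed
    sets of a Polish space with its covers by small closed sets; it replaces a
    complete metric so that products need no topology. *)
Record complete_sieve d (T : measurableType d) (F : set (set T))
    (C : nat -> nat -> set T) : Prop := CompleteSieve {
  sieve_measurable : F `<=` measurable ;
  sieve_ind : forall K : set (set T), F `<=` K ->
    (forall A : (set T)^nat, (forall n, K (A n)) -> K (\bigcup_n A n)) ->
    (forall A : (set T)^nat, (forall n, K (A n)) -> K (\bigcap_n A n)) ->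
    measurable `<=` K ;
  sieve_set0 : F set0 ;
  sieve_bigcap : forall (I : Type) (D : set I) (V : I -> set T),
    (forall i, D i -> F (V i)) -> F (\bigcap_(i in D) V i) ;
  sieve_cell : forall k j, F (C k j) ;
  sieve_cover : forall k t, exists j, C k j t ;
  sieve_compact : forall V : (set T)^nat, (forall n, F (V n)) ->
    (forall n, \bigcap_(i in [set i | (i < n)%N]) V i !=set0) ->
    (forall k, exists n j, V n `<=` C k j) -> \bigcap_n V n !=set0 ;
  sieve_separated : forall s t t',
    (forall k, C k (s k) t) -> (forall k, C k (s k) t') -> t = t' }.

Lemma sieve_setT d (T : measurableType d) F C :
  @complete_sieve d T F C -> F setT.
Proof.
by move=> h; rewrite -(@bigcap_set0 _ nat (fun=> setT)); apply: (sieve_bigcap h).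
Qed.

Lemma sieve_setI d (T : measurableType d) F C A B :
  @complete_sieve d T F C -> F A -> F B -> F (A `&` B).
Proof.
move=> h FA FB; rewrite -(bigcap2E A B); apply: (sieve_bigcap h) => -[|[|n]] _ //=.
exact: (sieve_setT h).
Qed.

Definition prod_family T Z (F : set (set T)) (F' : set (set Z)) : set (set (T * Z)) :=
  [set S | exists A B, [/\ F A, F' B & S = A `*` B]].

Definition prod_cell T Z (C : nat -> nat -> set T) (C' : nat -> nat -> set Z)
    (k j : nat) : set (T * Z) :=
  if unpickle j is Some (i, i') then C k i `*` C' k i' else set0 `*` set0.

Lemma sub_prod_family T Z (F : set (set T)) (F' : set (set Z))
    (V : nat -> set (T * Z)) :
  (forall n, prod_family F F' (V n)) -> exists AB : nat -> set T * set Z,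
  forall n, [/\ F (AB n).1, F' (AB n).2 & V n = (AB n).1 `*` (AB n).2].
Proof.
move=> h; have /choice[f hf] : forall n, exists AB : set T * set Z,
   [/\ F AB.1, F' AB.2 & V n = AB.1 `*` AB.2].
  by move=> n; have [A [B hAB]] := h n; exists (A, B).
by exists f.
Qed.

(** The complement of a rectangle is a union of two rectangles, so that
    complements come for free. *)
Lemma measurable_rectangles_ind d d' (T : measurableType d) (Z : measurableType d')
    (K : set (set (T * Z))) :
  (forall A B, measurable A -> measurable B -> K (A `*` B)) ->
  (forall A : (set (T * Z))^nat, (forall n, K (A n)) -> K (\bigcup_n A n)) ->
  (forall A : (set (T * Z))^nat, (forall n, K (A n)) -> K (\bigcap_n A n)) ->
  measurable `<=` K.
Proof.
move=> hR hU hI; suff : measurable `<=` [set A | K A /\ K (~` A)].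
  by move=> h A /h[].
rewrite measurable_prod_measurableType; apply: smallest_sub.
  split => [|A [KA KcA]|A hA].
  - split; first by have := hR _ _ (@measurableT _ T) (@measurable0 _ Z); rewrite setX0.
    by have := hR _ _ (@measurableT _ T) (@measurableT _ Z); rewrite setXTT setC0.
  - by split; rewrite setTD ?setCK.
  - split; first by apply: hU => n; have [] := hA n.
    by rewrite setC_bigcup; apply: hI => n; have [] := hA n.
move=> _ [A mA] [B mB] <-; split; first exact: hR.
have -> : ~` (A `*` B) = \bigcup_n (bigcup2 (~` A `*` setT) (setT `*` ~` B) n).
  rewrite bigcup2E; apply/seteqP; split => -[t z] /=.
    by move=> /not_andP[]; [left|right].
  by move=> [[h _]|[_ h]] [].
apply: hU => -[|[|n]] /=; [apply: hR => //|apply: hR => //|].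
- exact: measurableC.
- exact: measurableC.
- by have := hR _ _ (@measurableT _ T) (@measurable0 _ Z); rewrite setX0.
Qed.

(** A cell of the product is a product of cells of the same scale, and a
    decreasing sequence of nonempty rectangles is compact factor by factor. *)
Lemma prod_sieve d d' (T : measurableType d) (Z : measurableType d') F C F' C' :
  complete_sieve F C -> complete_sieve F' C' ->
  @complete_sieve _ (T * Z)%type (prod_family F F') (prod_cell C C').
Proof.
move=> h h'; split.
- move=> _ [A [B [FA FB ->]]].
  by apply: measurableX; [exact: (sieve_measurable h)|exact: (sieve_measurable h')].
- move=> K FK hU hI; apply: measurable_rectangles_ind => //.
  have h1 : measurable `<=` [set A | forall B, F' B -> K (A `*` B)].
    apply: (sieve_ind h).
    + by move=> A FA B FB; apply: FK; exists A, B.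
    + by move=> A hA B FB; rewrite setX_bigcupl; apply: hU => n; exact: hA.
    + move=> A hA B FB; rewrite (_ : _ `*` _ = \bigcap_n (A n `*` B)).
        by apply: hI => n; exact: hA.
      apply/seteqP; split=> -[t z] /=; first by move=> [ht hz] n _; split=> //; exact: ht.
      by move=> hn; split=> [n _|]; [case: (hn n)|case: (hn 0%N)].
  move=> A B mA; move: B; suff : measurable `<=` [set B | K (A `*` B)] by [].
  apply: (sieve_ind h').
  + by move=> B FB; exact: h1.
  + by move=> B hB; rewrite /= setX_bigcupr; apply: hU.
  + move=> B hB /=; rewrite (_ : _ `*` _ = \bigcap_n (A `*` B n)).
      by apply: hI => n; exact: hB.
    apply/seteqP; split=> -[t z] /=; first by move=> [ht hz] n _; split=> //; exact: hz.
    by move=> hn; split=> [|n _]; [case: (hn 0%N)|case: (hn n)].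
- by exists set0, set0; rewrite setX0; split=> //; [exact: (sieve_set0 h)|exact: (sieve_set0 h')].
- move=> I D V FV.
  have /choice[f hf] : forall i, exists f : set T * set Z, D i ->
      [/\ F f.1, F' f.2 & V i = f.1 `*` f.2].
    move=> i; have [Di|nDi] := pselect (D i); last by exists (set0, set0).
    by have [A [B hAB]] := FV i Di; exists (A, B).
  exists (\bigcap_(i in D) (f i).1), (\bigcap_(i in D) (f i).2); split.
  + by apply: (sieve_bigcap h) => i /hf[].
  + by apply: (sieve_bigcap h') => i /hf[].
  + apply/seteqP; split=> -[t z] /=.
      by move=> ht; split=> i Di; have := ht i Di; have [_ _ ->] := hf i Di; case.
    by move=> [ht hz] i Di; have [_ _ ->] := hf i Di; split; [exact: ht|exact: hz].
- move=> k j; rewrite /prod_cell; case: (unpickle j) => [[i i']|].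
    by exists (C k i), (C' k i'); split=> //; [exact: (sieve_cell h)|exact: (sieve_cell h')].
  by exists set0, set0; split=> //; [exact: (sieve_set0 h)|exact: (sieve_set0 h')].
- move=> k [t z]; have [i Ci] := sieve_cover h k t; have [j Cj] := sieve_cover h' k z.
  by exists (pickle (i, j)); rewrite /prod_cell pickleK.
- move=> V FV Vn0 VC; have [AB hAB] := sub_prod_family FV.
  have Vn n : V n !=set0.
    by have [p hp] := Vn0 n.+1; exists p; apply: hp => /=.
  have cellP k : exists n i j, (AB n).1 `<=` C k i /\ (AB n).2 `<=` C' k j.
    have [n [m]] := VC k; rewrite /prod_cell; have [_ _ Vnp] := hAB n.
    have [[t0 z0] Vtz] := Vn n; case: (unpickle m) => [[i j]|] sV; last first.
      by have := sV _ Vtz; case.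
    exists n, i, j; move: Vtz sV; rewrite Vnp => -[/= At Bz] sV; split=> [t Anp|z Bnp].
      by have [] := sV (t, z0) (conj Anp Bz).
    by have [] := sV (t0, z) (conj At Bnp).
  have [t ht] : \bigcap_n (AB n).1 !=set0.
    apply: (sieve_compact h) => [n|n|k]; first by have [] := hAB n.
      have [[t z] hp] := Vn0 n; exists t => i /hp; have [_ _ ->] := hAB i.
      by case.
    by have [n [i [j [hi hj]]]] := cellP k; exists n, i.
  have [z hz] : \bigcap_n (AB n).2 !=set0.
    apply: (sieve_compact h') => [n|n|k]; first by have [] := hAB n.
      have [[t' z] hp] := Vn0 n; exists z => i /hp; have [_ _ ->] := hAB i.
      by case.
    by have [n [i [j [hi hj]]]] := cellP k; exists n, j.
  exists (t, z) => n _; have [_ _ ->] := hAB n.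
  by split; [exact: ht|exact: hz].
- move=> s [t z] [t' z'] hs hs'.
  have us k : exists ij : nat * nat, unpickle (s k) = Some ij.
    by have := hs k; rewrite /prod_cell; case: unpickle => [ij|[]//]; exists ij.
  have [f hf] := choice us; congr (_, _).
    apply: (sieve_separated h (s := fun k => (f k).1)) => k.
      by have := hs k; rewrite /prod_cell hf; case: (f k) => ? ? [].
    by have := hs' k; rewrite /prod_cell hf; case: (f k) => ? ? [].
  apply: (sieve_separated h' (s := fun k => (f k).2)) => k.
    by have := hs k; rewrite /prod_cell hf; case: (f k) => ? ? [].
  by have := hs' k; rewrite /prod_cell hf; case: (f k) => ? ? [].
Qed.

(** Small closed sets are the closures of the sets of a countable base; their
    finite intersections being nonempty, points chosen in them form a Cauchy
    sequence. *)
Lemma standard_borel_sieve (R : realType) d (T : measurableType d) :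
  standard_borel R T -> exists F C, @complete_sieve d T F C.
Proof.
move=> [U [f [hU [B cB [Bo Bb]] [g fK gK] mT]]].
have [b bB] : exists b : nat -> set U, forall A, B A -> exists j, b j = A.
  have /countable_injP[e einj] := cB.
  exists (fun j => xget set0 [set A | B A /\ e A = j]) => A BA; exists (e A).
  case: xgetP => [A' _ [BA' eA']|/(_ A)]; last by case.
  by apply: einj; rewrite ?inE.
pose small k (A : set U) := exists c : U, A `<=` ball c (k.+1%:R^-1 : R).
pose C k j : set T :=
  [set t | small k (b j) /\ closure (b j) (f t)].
pose F : set (set T) := [set f @^-1` A | A in closed].
have small_ball (e : R) : 0 < e -> exists k, forall j, small k (b j) ->
    exists c, closure (b j) `<=` ball c e.
  move=> e0; have [k] : exists k, 0 + k.+1%:R^-1 < e / 2 by apply: ltr_add_invr; rewrite divr_gt0.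
  rewrite add0r => ke; exists k => j [c hc]; exists c => y.
  move=> /(_ (ball y (e / 2)))[|y' [by' yy']]; first by apply: nbhsx_ballx; rewrite divr_gt0.
  by apply: (ball_splitl (z := y')) => //; apply: (le_ball (ltW ke)); exact: hc.
exists F, C; split.
- move=> _ [A cA <-]; apply/mT; exists A => //.
  rewrite -(setCK A) -setTD; apply: sigma_algebraCD; apply: sub_sigma_algebra.
  exact: closed_openC.
- move=> K FK KU KI A /mT[A' + ->]; move: A'.
  suff h : <<s @open U >> `<=` [set A' | K (f @^-1` A') /\ K (f @^-1` (~` A'))].
    by move=> A' /h[].
  apply: smallest_sub => [|O oO].
    split => [|D [h1 h2]|D hD].
    + split; apply: FK; [by exists set0; [exact: closed0|]|].
      by exists setT; [exact: closedT|rewrite setC0].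
    + by split; rewrite setTD ?setCK.
    + rewrite /= preimage_bigcup setC_bigcup preimage_bigcap.
      by split; [apply: KU => n; have [] := hD n|apply: KI => n; have [] := hD n].
  split; last by apply: FK; exists (~` O) => //; exact: open_closedC.
  (* An open set is the union of the closed sets of points that are far from
     its complement. *)
  pose D (n : nat) := closure [set x | ball x (n.+1%:R^-1 : R) `<=` O].
  rewrite (_ : O = \bigcup_n D n).
    by rewrite preimage_bigcup; apply: KU => n; apply: FK; exists (D n) => //; exact: closed_closure.
  apply/seteqP; split => [x Ox|x [n _]].
    have /nbhs_ballP[e /= e0 he] : nbhs x O by exact: open_nbhs_nbhs.
    have [k] := ltr_add_invr e0; rewrite add0r => ke; exists k => //.
    by apply: subset_closure; apply: (subset_trans _ he); apply: le_ball; exact: ltW.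
  have e0 : 0 < n.+1%:R^-1 :> R by rewrite invr_gt0.
  move=> /(_ (ball x (n.+1%:R^-1 : R)))[|y [yO xy]]; first exact: nbhsx_ballx.
  by apply: yO; exact: ball_sym.
- by exists set0; [exact: closed0|].
- move=> I D V FV; exists (\bigcap_(i in D) closure (f @` V i)).
    by apply: closed_bigI => i _; exact: closed_closure.
  apply/seteqP; split=> t ht i Di; last by apply: subset_closure; exists t => //; exact: ht.
  have [A cA VA] := FV i Di; rewrite -VA; apply: cA.
  apply: closure_subset (ht i Di) => _ [t' + <-].
  by rewrite -VA.
- move=> k j; have [h|h] := pselect (small k (b j)).
    exists (closure (b j)); first exact: closed_closure.
    by apply/seteqP; split=> t //; case.
  by exists set0; [exact: closed0|apply/seteqP; split=> t // []].
- move=> k t; have e0 : 0 < k.+1%:R^-1 :> R by rewrite invr_gt0.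
  have [A [BA At] hA] := Bb (f t) _ (nbhsx_ballx (f t) _ e0).
  have [j bj] := bB A BA; exists j; rewrite /C /= bj; split; first by exists (f t).
  exact: subset_closure.
- move=> V FV V0 VC.
  have /choice[x hx] : forall n, exists x : T, forall i, (i <= n)%N -> V i x.
    by move=> n; have [t ht] := V0 n.+1; exists t => i /ht.
  pose u n := f (x n).
  have cu : cauchy (u @ \oo).
    apply: cauchy_exP => e e0; have [k hk] := small_ball e e0.
    have [n [j Vn]] := VC k.
    have [sj _] := Vn _ (hx n n (leqnn n)).
    have [c hc] := hk j sj; exists c; exists n => // m /= nm; apply: hc.
    by have [] := Vn _ (hx m n nm).
  have cvu : cvg (u @ \oo) by exact: (@cauchy_cvg _ _ _ cu).
  exists (g (lim (u @ \oo))) => n _.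
  have [A cA VA] := FV n; rewrite -VA /preimage /= gK.
  apply: (@closed_cvg _ _ _ _ u A cA _ _ cvu); exists n => // m /= nm.
  by have := hx m n nm; rewrite -VA.
- move=> s t t' ht ht'; apply: (can_inj fK); apply/eqP; apply: contrapT => /negP ne.
  move: hU; rewrite ball_hausdorff => /(_ _ _ ne)[r /eqP].
  have r0 : 0 < r.1%:num / 2 :> R by rewrite divr_gt0.
  have [k hk] := small_ball _ r0.
  have [sk h1] := ht k; have [_ h2] := ht' k; have [c hc] := hk _ sk.
  rewrite -subset0 => /(_ (f t')); apply; split; last exact: ballxx.
  apply: (ball_splitr (z := c)); exact: hc.
Qed.

(** * Souslin schemes *)

(** The Souslin operation: the union over infinite branches s of the
    intersections along s. *)
Definition scheme_set T (D : seq nat -> set T) : set T :=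
  [set t | exists s, forall n, D (mkseq s n) t].

(** Branches are required to shrink below cells of every scale, so that
    sieve_compact applies along them. *)
Definition souslin d (T : measurableType d) (F : set (set T))
    (C : nat -> nat -> set T) (A : set T) : Prop :=
  exists D, [/\ forall u, F (D u),
    forall s k, exists n j, D (mkseq s n) `<=` C k j & A = scheme_set D].

Lemma mkseq_cons T (f : nat -> T) n : mkseq f n.+1 = f 0%N :: mkseq (f \o S) n.
Proof. by rewrite /mkseq /= (iotaDl 1 0) -map_comp. Qed.

Section souslin_sets.
Context d (T : measurableType d) (F : set (set T)) (C : nat -> nat -> set T).
Hypothesis sieveFC : complete_sieve F C.

(** The n-th entry of a branch selects a cell of scale n, so that every branch
    meets arbitrarily small cells. *)
Lemma souslin_family A : F A -> souslin F C A.
Proof.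
move=> FA; pose D (u : seq nat) :=
  if u is _ :: _ then A `&` C (size u).-1 (last 0%N u) else A.
exists D; split.
- move=> [|a u] //=; apply: (sieve_setI sieveFC) => //; exact: (sieve_cell sieveFC).
- move=> s k; exists k.+1, (s k); rewrite mkseqS /D.
  by case E : (rcons _ _) => [|a u]; [case: (mkseq s k) E|rewrite -E last_rcons size_rcons size_mkseq /= => t []].
- apply/seteqP; split => [t At|t [s /(_ 0%N)]//].
  have /choice[s hs] := fun k => sieve_cover sieveFC k t.
  exists s => -[//|n]; rewrite mkseqS /D.
  by case E : (rcons _ _) => [|a u]; [|rewrite -E last_rcons size_rcons size_mkseq].
Qed.

Lemma souslin_bigcup (A : (set T)^nat) :
  (forall n, souslin F C (A n)) -> souslin F C (\bigcup_n A n).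
Proof.
move=> /choice[D hD].
exists (fun u => if u is i :: u' then D i u' else setT); split.
- by move=> [|i u]; [exact: (sieve_setT sieveFC)|have [+ _ _] := hD i; exact].
- move=> s k; have [_ + _] := hD (s 0%N).
  move=> /(_ (s \o S) k)[n [j h]]; exists n.+1, j.
  by rewrite mkseq_cons.
- apply/seteqP; split => t.
    move=> [i _]; have [_ _ ->] := hD i => -[s hs].
    exists (fun n => if n is n'.+1 then s n' else i) => -[//|n].
    by rewrite mkseq_cons /=; exact: hs.
  move=> [s hs]; exists (s 0%N) => //; have [_ _ ->] := hD (s 0%N).
  by exists (s \o S) => n; move: (mkseq_cons s n) (hs n.+1) => ->.
Qed.

(** Branches for the factors are interleaved through an enumeration of pairs; a
    prefix decides those levels of the factors all of whose entries it
    contains. *)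
Lemma souslin_bigcap (A : (set T)^nat) :
  (forall n, souslin F C (A n)) -> souslin F C (\bigcap_n A n).
Proof.
move=> /choice[D hD].
pose sub (s : nat -> nat) (i k : nat) := s (pickle (i, k)).
pose known (N : nat) (im : nat * nat) :=
  forall k, (k < im.2)%N -> (pickle (im.1, k) < N)%N.
pose E (u : seq nat) := \bigcap_(im in known (size u))
  D im.1 (mkseq (sub (nth 0%N u) im.1) im.2).
have EP s N im : known N im ->
    mkseq (sub (nth 0%N (mkseq s N)) im.1) im.2 = mkseq (sub s im.1) im.2.
  move=> kn; apply/eq_in_map => k; rewrite mem_iota add0n => /= klt.
  by rewrite /sub nth_mkseq//; exact: kn.
have knownP i m : exists N, known N (i, m).
  elim: m => [|m [N hN]]; first by exists 0%N.
  exists (maxn N (pickle (i, m)).+1) => k /=; rewrite ltnS leq_eqVlt => /predU1P[->|/hN kN].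
    by rewrite leq_max ltnSn orbT.
  by rewrite leq_max kN.
exists E; split.
- by move=> u; apply: (sieve_bigcap sieveFC) => im _; have [+ _ _] := hD im.1; exact.
- move=> s k; have [_ + _] := hD 0%N.
  move=> /(_ (sub s 0%N) k)[m [j h]]; have [N hN] := knownP 0%N m.
  exists N, j => t /(_ (0%N, m)); rewrite size_mkseq => /(_ hN) /=.
  by have /= -> := EP s N _ hN; exact: h.
- apply/seteqP; split => t.
    move=> At; have /choice[f hf] : forall i, exists s, forall n, D i (mkseq s n) t.
      by move=> i; have := At i I; have [_ _ ->] := hD i.
    pose s n := if choice.unpickle n is Some ik then f ik.1 ik.2 else 0%N.
    have sE i : sub s i = f i by apply/funext => k; rewrite /sub /s pickleK.
    exists s => N im; rewrite size_mkseq => /= kn.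
    by rewrite EP// sE; exact: hf.
  move=> [s hs] i _; have [_ _ ->] := hD i; exists (sub s i) => m.
  have [N hN] := knownP i m.
  by have := hs N (i, m); rewrite size_mkseq EP//; exact.
Qed.

Lemma measurable_souslin A : measurable A -> souslin F C A.
Proof.
apply: (sieve_ind sieveFC).
- exact: souslin_family.
- exact: souslin_bigcup.
- exact: souslin_bigcap.
Qed.

End souslin_sets.

(** * Projections of sets with finite sections *)

Definition proj1 T Z (A : set (T * Z)) : set T := [set t | exists z, A (t, z)].

Definition separated d (T : measurableType d) (P Q : set T) : Prop :=
  exists H, [/\ measurable H, P `<=` H & H `&` Q = set0].

Lemma separated_bigcup d (T : measurableType d) (P Q : (set T)^nat) :
  (forall i j, separated (P i) (Q j)) ->
  separated (\bigcup_i P i) (\bigcup_j Q j).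
Proof.
move=> h; have /choice[H hH] := fun ij => h ij.1 ij.2.
exists (\bigcup_i \bigcap_j H (i, j)); split.
- apply: bigcupT_measurable => i; apply: bigcapT_measurable => j.
  by have [] := hH (i, j).
- move=> t [i _ Pt]; exists i => // j _; have [_ + _] := hH (i, j); exact.
- rewrite -subset0 => t [[i _ Ht] [j _ Qt]]; have [_ _] := hH (i, j).
  by rewrite -subset0 => /(_ t); apply; split=> //; exact: Ht.
Qed.

Section separation.
Context d d' (T : measurableType d) (Z : measurableType d').
Variables (F : set (set T)) (C : nat -> nat -> set T).
Variables (F' : set (set Z)) (C' : nat -> nat -> set Z).
Hypotheses (sieveT : complete_sieve F C) (sieveZ : complete_sieve F' C').

Let below (D : seq nat -> set (T * Z)) u : set (T * Z) :=
  [set p | exists s, mkseq s (size u) = u /\ forall n, D (mkseq s n) p].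

Let below_bigcup D u : proj1 (below D u) = \bigcup_i proj1 (below D (rcons u i)).
Proof.
apply/seteqP; split=> t.
  move=> [z [s [su hs]]]; exists (s (size u)) => //; exists z, s; split=> //.
  by rewrite size_rcons mkseqS su.
move=> [i _ [z [s [su hs]]]]; exists z, s; split=> //.
by move: su; rewrite size_rcons mkseqS => /rcons_inj[].
Qed.

Let below_prefix D s n p : below D (mkseq s n) p ->
  forall i, (i <= n)%N -> D (mkseq s i) p.
Proof.
move=> [s' [+ hs']] i lein; rewrite size_mkseq => ss'.
suff -> : mkseq s i = mkseq s' i by exact: hs'.
apply/eq_in_map => k; rewrite mem_iota add0n => /= klt.
have kn : (k < n)%N by exact: leq_trans lein.
by rewrite -(nth_mkseq 0%N s kn) -ss' nth_mkseq.
Qed.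

(** If the projections were inseparable, one could descend along inseparable
    pairs of branches; the rectangles along both branches shrink, and their
    traces on T would have a common point. *)
Lemma souslin_separation (A B : set (T * Z)) :
  souslin (prod_family F F') (prod_cell C C') A ->
  souslin (prod_family F F') (prod_cell C C') B ->
  proj1 A `&` proj1 B = set0 -> separated (proj1 A) (proj1 B).
Proof.
move=> [D [FD CD AD]] [D' [FD' CD' BD']] AB0.
apply: contrapT => nsep.
have sepR u v : ~ separated (proj1 (below D u)) (proj1 (below D' v)) ->
    exists ij : nat * nat, ~ separated (proj1 (below D (rcons u ij.1)))
      (proj1 (below D' (rcons v ij.2))).
  move=> nuv; apply: contrapT => h; apply: nuv.
  rewrite (below_bigcup D u) (below_bigcup D' v).
  by apply: separated_bigcup => i j; apply: contrapT => nij; apply: h; exists (i, j).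
have /choice[next hnext] : forall uv : seq nat * seq nat, exists ij : nat * nat,
    ~ separated (proj1 (below D uv.1)) (proj1 (below D' uv.2)) ->
    ~ separated (proj1 (below D (rcons uv.1 ij.1))) (proj1 (below D' (rcons uv.2 ij.2))).
  move=> [u v]; have [/sepR[ij hij]|h] := pselect (~ separated (proj1 (below D u)) (proj1 (below D' v))).
    by exists ij.
  by exists (0%N, 0%N).
(* st n is the pair of prefixes of length n of two branches s and s' along which
   no separation exists. *)
pose st := fix st n := if n is n'.+1 then
  (rcons (st n').1 (next (st n')).1, rcons (st n').2 (next (st n')).2)
  else ([::], [::]).
pose s n := (next (st n)).1; pose s' n := (next (st n)).2.
have stE n : st n = (mkseq s n, mkseq s' n).
  by elim: n => [//|n IHn]; rewrite !mkseqS /s /s' [LHS]/= IHn.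
have nsepn n : ~ separated (proj1 (below D (mkseq s n))) (proj1 (below D' (mkseq s' n))).
  suff : ~ separated (proj1 (below D (st n).1)) (proj1 (below D' (st n).2)) by rewrite stE.
  elim: n => [|n IHn]; last exact: (hnext (st n)).
  have below0 E : below E [::] = scheme_set E.
    by apply/seteqP; split=> [p [r [_ hr]]|p [r hr]]; exists r.
  by rewrite /= !below0 -AD -BD'.
have [UV hUV] := sub_prod_family (fun n => FD (mkseq s n)).
have [UV' hUV'] := sub_prod_family (fun n => FD' (mkseq s' n)).
have ne n : exists p, forall i, (i <= n)%N -> D (mkseq s i) p.
  apply: contrapT => h; apply: (nsepn n); exists set0; split=> //; last by rewrite set0I.
  by move=> t [z hz]; apply: h; exists (t, z); exact: below_prefix.
have ne' n : exists p, forall i, (i <= n)%N -> D' (mkseq s' i) p.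
  apply: contrapT => h; apply: (nsepn n); exists setT; split=> //.
  by rewrite setTI -subset0 => t [z hz]; apply: h; exists (t, z); exact: below_prefix.
have cellP k : exists n i j, (UV n).1 `<=` C k i /\ (UV n).2 `<=` C' k j.
  have [n [m]] := CD s k; rewrite /prod_cell; have [_ _ Vnp] := hUV n.
  have [[t0 z0] /(_ n (leqnn n)) Vtz] := ne n; case: (choice.unpickle m) => [[i j]|] sV; last first.
    by have := sV _ Vtz; case.
  exists n, i, j; move: Vtz sV; rewrite Vnp => -[/= At Bz] sV; split=> [t Anp|z Bnp].
    by have [] := sV (t, z0) (conj Anp Bz).
  by have [] := sV (t0, z) (conj At Bnp).
have cellP' k : exists n i j, (UV' n).1 `<=` C k i /\ (UV' n).2 `<=` C' k j.
  have [n [m]] := CD' s' k; rewrite /prod_cell; have [_ _ Vnp] := hUV' n.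
  have [[t0 z0] /(_ n (leqnn n)) Vtz] := ne' n; case: (choice.unpickle m) => [[i j]|] sV; last first.
    by have := sV _ Vtz; case.
  exists n, i, j; move: Vtz sV; rewrite Vnp => -[/= At Bz] sV; split=> [t Anp|z Bnp].
    by have [] := sV (t, z0) (conj Anp Bz).
  by have [] := sV (t0, z) (conj At Bnp).
have [z hz] : \bigcap_n (UV n).2 !=set0.
  apply: (sieve_compact sieveZ) => [n|n|k]; first by have [] := hUV n.
    have [[t z] hp] := ne n; exists z => i /= /ltnW /hp; have [_ _ ->] := hUV i.
    by case.
  by have [n [i [j [hi hj]]]] := cellP k; exists n, j.
have [z' hz'] : \bigcap_n (UV' n).2 !=set0.
  apply: (sieve_compact sieveZ) => [n|n|k]; first by have [] := hUV' n.
    have [[t z'] hp] := ne' n; exists z' => i /= /ltnW /hp; have [_ _ ->] := hUV' i.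
    by case.
  by have [n [i [j [hi hj]]]] := cellP' k; exists n, j.
(* A finite intersection of the first factors of one branch is a measurable set;
   disjoint from those of the other branch, it would separate. *)
have [t ht] : \bigcap_n ((UV n).1 `&` (UV' n).1) !=set0.
  apply: (sieve_compact sieveT) => [n|n|k].
  - by apply: (sieve_setI sieveT); [have [] := hUV n|have [] := hUV' n].
  - apply: contrapT => h; apply: (nsepn n).
    exists (\bigcap_(i in [set i | (i < n)%N]) (UV i).1); split.
    + apply: (sieve_measurable sieveT); apply: (sieve_bigcap sieveT) => i _.
      by have [] := hUV i.
    + move=> t [w /below_prefix hw] i /= /ltnW /hw.
      by have [_ _ ->] := hUV i; case.
    + rewrite -subset0 => t [ht [w /below_prefix hw]]; apply: h; exists t => i /= ilt.
      split; first exact: ht.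
      by have := hw i (ltnW ilt); have [_ _ ->] := hUV' i; case.
  - have [n [i [j [hi hj]]]] := cellP k; exists n, i.
    by move=> t [] /hi.
have : (proj1 A `&` proj1 B) t.
  split.
    exists z; rewrite AD; exists s => n; have [_ _ ->] := hUV n.
    by split; [have [] := ht n I|exact: hz].
  exists z'; rewrite BD'; exists s' => n; have [_ _ ->] := hUV' n.
  by split; [have [] := ht n I|exact: hz'].
by rewrite AB0.
Qed.

End separation.

Lemma measurable_preimageT d d' (T : measurableType d) (U : measurableType d')
    (f : T -> U) A :
  measurable_fun setT f -> measurable A -> measurable [set t | A (f t)].
Proof. by move=> mf mA; rewrite -[X in measurable X]setTI; exact: mf. Qed.

Section single_valued.
Context d d' (T : measurableType d) (Z : measurableType d').
Variables (F : set (set T)) (C : nat -> nat -> set T).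
Variables (F' : set (set Z)) (C' : nat -> nat -> set Z).
Hypotheses (sieveT : complete_sieve F C) (sieveZ : complete_sieve F' C').

(** Separating, for each cell of Z, the projections of the parts of A inside and
    outside of it yields measurable sets H that decide in which cells the point
    over t lies; the sieve then recovers that point measurably from t. *)
Lemma measurable_proj1_single (A : set (T * Z)) : measurable A ->
  (forall t z z', A (t, z) -> A (t, z') -> z = z') -> measurable (proj1 A).
Proof.
move=> mA A1.
have [[p0 Ap0]|A0] := pselect (A !=set0); last first.
  by rewrite (_ : proj1 A = set0) // -subset0 => t [z Atz]; apply: A0; exists (t, z).
have mC k j : measurable (C' k j).
  by apply: (sieve_measurable sieveZ); exact: (sieve_cell sieveZ).
have /choice[H hH] : forall kj : nat * nat, exists H, measurable H /\
    forall t z, A (t, z) -> (H t <-> C' kj.1 kj.2 z).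
  move=> [k j] /=.
  have [|||H [mH PH]] := @souslin_separation _ _ _ _ _ _ _ _ sieveT sieveZ
      (A `&` (setT `*` C' k j)) (A `&` (setT `*` ~` C' k j)).
  - apply: measurable_souslin; first exact: prod_sieve.
    by apply: measurableI => //; exact: measurableX.
  - apply: measurable_souslin; first exact: prod_sieve.
    by apply: measurableI => //; apply: measurableX => //; exact: measurableC.
  - rewrite -subset0 => t [[z [Az [_ Cz]]] [z' [Az' [_ Cz']]]].
    by apply: Cz'; rewrite (A1 _ _ _ Az' Az).
  rewrite -subset0 => HQ; exists H; split=> // t z Atz; split=> [Ht|Cz].
    apply: contrapT => nC; apply: (HQ t); split=> //; exists z; split=> //.
  by apply: PH; exists z.
(* J k j t: the cell number j is the first cell of scale k that contains the
   point over t. *)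
pose J k j := H (k, j) `&` \bigcap_(i in [set i | (i < j)%N]) ~` H (k, i).
have mJ k j : measurable (J k j).
  apply: measurableI; first by case: (hH (k, j)).
  by apply: bigcap_measurableType => i _; (apply: measurableC; case: (hH (k, i))).
have Juniq k j j' t : J k j t -> J k j' t -> j = j'.
  move=> [Hj nj] [Hj' nj']; case: (ltngtP j j') => // jj'.
    by have := nj' j jj'.
  by have := nj j' jj'.
have Jex t z k : A (t, z) -> exists j, J k j t /\ C' k j z.
  move=> Atz; have CH j : C' k j z <-> H (k, j) t by case: (hH (k, j)) => _ /(_ _ _ Atz) ->.
  have ex : exists j, `[< H (k, j) t >].
    by have [j /CH] := sieve_cover sieveZ k z; exists j; exact/asboolP.
  case: (ex_minnP ex) => j /asboolP Hj jmin; exists j; split; last exact/CH.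
  split=> // i /= ij Hi; have /asboolP/jmin := Hi.
  by rewrite leqNgt ij.
pose code t z := exists s, forall k, J k (s k) t /\ C' k (s k) z.
have code_uniq t z z' : code t z -> code t z' -> z = z'.
  move=> [s hs] [s' hs']; apply: (sieve_separated sieveZ (s := s)) => k.
    by case: (hs k).
  have [h1 _] := hs k; have [h2 +] := hs' k.
  by rewrite (Juniq _ _ _ _ h1 h2).
have codeA t z : A (t, z) -> code t z.
  by move=> Atz; have /choice[s hs] := fun k => Jex t z k Atz; exists s.
(* Dom V is the set of the t such that every finite list of cells selected over t
   meets V; by compactness they all meet in one point of V. *)
pose Dom (V : set Z) := \bigcap_n \bigcup_(u in [set u : seq nat | size u = n /\
     (V `&` \bigcap_(k in [set k | (k < n)%N]) C' k (nth 0%N u k)) !=set0])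
  \bigcap_(k in [set k | (k < n)%N]) J k (nth 0%N u k).
have mDom V : measurable (Dom V).
  apply: bigcapT_measurable => n; rewrite bigcup_mkcond.
  apply: countable_bigcupT_measurable => // u; case: ifP => _ //.
  by apply: bigcap_measurableType => k _; exact: mJ.
have DomP V t : F' V -> (Dom V t <-> exists z, V z /\ code t z).
  move=> FV; split=> [ht|[z [Vz [s hs]]] n _]; last first.
    exists (mkseq s n); last by move=> k /= kn; rewrite nth_mkseq//; case: (hs k).
    rewrite /= size_mkseq; split=> //; exists z; split=> // k /= kn.
    by rewrite nth_mkseq//; case: (hs k).
  have /choice[u hu] : forall n, exists u : seq nat, [/\ size u = n,
      (V `&` \bigcap_(k in [set k | (k < n)%N]) C' k (nth 0%N u k)) !=set0 &
      forall k, (k < n)%N -> J k (nth 0%N u k) t].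
    by move=> n; have [u [su nu] hu] := ht n I; exists u.
  pose s k := nth 0%N (u k.+1) k.
  have us n k : (k < n)%N -> nth 0%N (u n) k = s k.
    move=> kn; apply: (Juniq k _ _ t); first by have [_ _] := hu n; exact.
    by have [_ _] := hu k.+1; exact.
  pose W n := if n is k.+1 then C' k (s k) else V.
  have [z hz] : \bigcap_n W n !=set0.
    apply: (sieve_compact sieveZ) => [[|n]|n|k]; [by []|exact: (sieve_cell sieveZ)| |].
      have [_ [z [Vz hz]] _] := hu n; exists z => -[//|i] /= /ltnW ilt.
      by have := hz i ilt; rewrite us.
    by exists k.+1, (s k).
  exists z; split; first exact: (hz 0%N).
  exists s => k; split; last exact: (hz k.+1).
  by have [_ _] := hu k.+1; exact.
pose phi t := xget p0.2 [set z | code t z].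
have phiE t z : code t z -> phi t = z.
  move=> h; rewrite /phi; case: xgetP => [z' _ h'|/(_ z)//].
  exact: (code_uniq t).
have mphi : measurable `<=` [set B : set (T * Z) | measurable (Dom setT `&` [set t | B (t, phi t)])].
  apply: measurable_rectangles_ind => [U V mU mV|B hB|B hB] /=.
  - rewrite (_ : _ `&` _ = U `&` (Dom setT `&` [set t | V (phi t)])); last first.
      by apply/seteqP; split=> t /=; tauto.
    apply: measurableI => //.
    have : measurable `<=` [set V | measurable (Dom setT `&` [set t | V (phi t)])]; last exact.
    apply: (sieve_ind sieveZ) => [W FW|B hB|B hB] /=.
    + rewrite (_ : _ `&` _ = Dom W)//; apply/seteqP; split=> t.
        move=> [/(DomP _ _ (sieve_setT sieveZ))[z [_ cz]] /= Wz]; apply/DomP => //.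
        by exists z; split=> //; rewrite -(phiE _ _ cz).
      move=> /(DomP _ _ FW)[z [Wz cz]]; split; last by rewrite /= (phiE _ _ cz).
      by apply/DomP; [exact: (sieve_setT sieveZ)|exists z].
    + rewrite (_ : _ `&` _ = \bigcup_n (Dom setT `&` [set t | B n (phi t)])).
        by apply: bigcupT_measurable => n; exact: hB.
      apply/seteqP; split=> t /=; first by move=> [ht [n _ hn]]; exists n.
      by move=> [n _ [ht hn]]; split=> //; exists n.
    + rewrite (_ : _ `&` _ = \bigcap_n (Dom setT `&` [set t | B n (phi t)])).
        by apply: bigcapT_measurable => n; exact: hB.
      apply/seteqP; split=> t /=; first by move=> [ht hn] n _; split=> //; exact: hn.
      by move=> h; split=> [|n _]; [case: (h 0%N I)|case: (h n I)].
  - rewrite (_ : _ `&` _ = \bigcup_n (Dom setT `&` [set t | B n (t, phi t)])).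
      by apply: bigcupT_measurable => n; exact: hB.
    apply/seteqP; split=> t /=; first by move=> [ht [n _ hn]]; exists n.
    by move=> [n _ [ht hn]]; split=> //; exists n.
  - rewrite (_ : _ `&` _ = \bigcap_n (Dom setT `&` [set t | B n (t, phi t)])).
      by apply: bigcapT_measurable => n; exact: hB.
    apply/seteqP; split=> t /=; first by move=> [ht hn] n _; split=> //; exact: hn.
    by move=> h; split=> [|n _]; [case: (h 0%N I)|case: (h n I)].
rewrite (_ : proj1 A = Dom setT `&` [set t | A (t, phi t)]); first exact: mphi.
apply/seteqP; split=> t [].
  move=> z Atz; split; last by rewrite /= (phiE _ _ (codeA _ _ Atz)).
  by apply/DomP; [exact: (sieve_setT sieveZ)|exists z; split=> //; exact: codeA].
by move=> _ ?; exists (phi t).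
Qed.

End single_valued.

(** ** A measurable linear order *)

Section order.
Context d (Z : measurableType d) (C : nat -> nat -> set Z).

Let bit n (z : Z) := if choice.unpickle n is Some kj then C kj.1 kj.2 z else False.

(** The lexicographic order on the sequences that record membership in the
    countably many cells. *)
Definition sieve_lt (y z : Z) : Prop := exists n,
  [/\ forall i, (i < n)%N -> bit i y <-> bit i z, ~ bit n y & bit n z].

Lemma sieve_lt_irr z : ~ sieve_lt z z.
Proof. by move=> [n [_]]. Qed.

Lemma sieve_lt_trans x y z : sieve_lt x y -> sieve_lt y z -> sieve_lt x z.
Proof.
move=> [m [hm mx my]] [n [hn ny nz]]; case: (ltngtP m n) => mn.
- exists m; split=> [i im||]; [|by []|by apply/(hn m mn)].
  by rewrite hm// hn//; exact: ltn_trans mn.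
- exists n; split=> [i im||]; [|by move=> /(hm n mn)|by []].
  by rewrite hm// ?hn//; exact: ltn_trans mn.
- by move: ny; rewrite -mn.
Qed.

Variable F : set (set Z).
Hypothesis sieveZ : complete_sieve F C.

Lemma sieve_lt_total y z : y <> z -> sieve_lt y z \/ sieve_lt z y.
Proof.
move=> yz; have ex : exists n, `[< ~ (bit n y <-> bit n z) >].
  apply: contrapT => h; apply: yz.
  have hb n : bit n y <-> bit n z.
    by apply: contrapT => hn; apply: h; exists n; exact/asboolP.
  have /choice[s hs] := fun k => sieve_cover sieveZ k y.
  apply: (sieve_separated sieveZ hs) => k.
  by have := hb (pickle (k, s k)); rewrite /bit pickleK /= => -[+ _]; apply.
case: (ex_minnP ex) => n /asboolP nyz nmin.
have low i : (i < n)%N -> bit i y <-> bit i z.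
  move=> ilt; apply: contrapT => /asboolP/nmin; by rewrite leqNgt ilt.
have [by_|by_] := pselect (bit n y); have [bz|bz] := pselect (bit n z).
- by exfalso; apply: nyz.
- by right; exists n; split=> // i ilt; rewrite low.
- by left; exists n; split.
- by exfalso; apply: nyz.
Qed.

Lemma measurable_sieve_lt : measurable [set p : Z * Z | sieve_lt p.1 p.2].
Proof.
have mb n : measurable [set z | bit n z].
  rewrite /bit; case: choice.unpickle => [kj|]; last first.
    by rewrite (_ : [set _ | _] = set0)//; apply/seteqP; split.
  by apply: (sieve_measurable sieveZ); exact: (sieve_cell sieveZ).
have m1 n : measurable [set p : Z * Z | bit n p.1].
  exact: (measurable_preimageT measurable_fst (mb n)).
have m2 n : measurable [set p : Z * Z | bit n p.2].
  exact: (measurable_preimageT measurable_snd (mb n)).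
rewrite (_ : [set _ | _] = \bigcup_n ((\bigcap_(i in [set i | (i < n)%N])
    ([set p | bit i p.1] `&` [set p | bit i p.2] `|`
     ~` [set p | bit i p.1] `&` ~` [set p | bit i p.2])) `&`
  (~` [set p | bit n p.1] `&` [set p | bit n p.2]))).
  apply: bigcupT_measurable => n; apply: measurableI.
    apply: bigcap_measurableType => i _; by apply: measurableU; apply: measurableI => //; exact: measurableC.
  by apply: measurableI => //; exact: measurableC.
apply/seteqP; split=> -[y z] /=.
  move=> [n [hn ny nz]]; exists n => //; split=> // i /= /hn h.
  by have [|] := pselect (bit i y); tauto.
move=> [n _ [hn [ny nz]]]; exists n; split=> // i ilt.
by have := hn i ilt => /=; tauto.
Qed.

End order.

Definition nonmax T Z (lt : Z -> Z -> Prop) (A : set (T * Z)) : set (T * Z) :=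
  A `&` [set p | exists z, A (p.1, z) /\ lt p.2 z].

Definition sections_le T (Z : eqType) M (A : set (T * Z)) : Prop :=
  forall t, exists2 s : seq Z, (size s <= M)%N & forall z, A (t, z) -> z \in s.

Section finite_sections.
Context d' (Z : measurableType d').
Variables (F' : set (set Z)) (C' : nat -> nat -> set Z).
Hypothesis sieveZ : complete_sieve F' C'.
Let lt := sieve_lt C'.

(** Removing the maximal point shortens the list; without a maximal point there
    would be chains longer than the list. *)
Lemma sections_le_nonmax T M (A : set (T * Z)) :
  sections_le M.+1 A -> sections_le M (nonmax lt A).
Proof.
move=> hA t; have [s sM hs] := hA t.
have [[z [Atz zmax]]|nomax] := pselect (exists z, A (t, z) /\ forall z', A (t, z') -> ~ lt z z').
  exists (rem z s); first by rewrite size_rem ?hs// -ltnS (leq_trans _ sM)// prednK// lt0n size_eq0; apply/eqP => s0; have := hs z Atz; rewrite s0.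
  move=> z' [Az' [w [/= Aw z'w]]]; have := hs _ Az'.
  have zz' : z' != z by apply/eqP => e; move: z'w; rewrite e; exact: zmax.
  by rewrite (perm_mem (perm_to_rem (hs _ Atz))) inE (negbTE zz').
exists [::] => // z [Atz _].
have nx z' : A (t, z') -> exists w, A (t, w) /\ lt z' w.
  move=> Az'; apply: contrapT => h; apply: nomax; exists z'; split=> // w Aw zw.
  by apply: h; exists w.
suff : forall n, exists u : seq Z, [/\ size u = n, uniq u, (forall w, w \in u -> A (t, w)) &
    exists w, A (t, w) /\ forall w', w' \in u -> lt w' w].
  move=> /(_ (size s).+1)[u [su uu uA _]].
  suff : (size u <= size s)%N by rewrite su ltnn.
  by apply: uniq_leq_size => // w /uA /hs.
elim=> [|n [u [su uu uA [w [Aw hw]]]]].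
  by exists [::]; split=> //; exists z.
exists (w :: u); split=> /=; first by rewrite su.
- by rewrite uu andbT; apply/negP => /hw; exact: sieve_lt_irr.
- by move=> w'; rewrite inE => /orP[/eqP ->//|/uA].
have [w' [Aw' ww']] := nx w Aw; exists w'; split=> // w''.
rewrite inE => /orP[/eqP ->//|/hw h]; exact: sieve_lt_trans ww'.
Qed.

Lemma single_max T (A : set (T * Z)) t z z' :
  (A `\` nonmax lt A) (t, z) -> (A `\` nonmax lt A) (t, z') -> z = z'.
Proof.
move=> [Az nz] [Az' nz']; apply: contrapT => /(sieve_lt_total sieveZ)[h|h].
  by apply: nz; split=> //; exists z'.
by apply: nz'; split=> //; exists z.
Qed.

(** Each nonempty section has a largest point: by induction its nonmaximal part
    has one, and anything above that point is largest. *)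
Lemma proj1_max T M (A : set (T * Z)) :
  sections_le M A -> proj1 A = proj1 (A `\` nonmax lt A).
Proof.
elim: M A => [|M IH] A hA.
  have h t z : ~ A (t, z) by move=> Atz; have [[|//] _ /(_ _ Atz)] := hA t.
  by apply/seteqP; split=> t [z]; [move=> /h|move=> [] /h].
apply/seteqP; split=> t; last by move=> [z []]; exists z.
move=> [z Atz]; have [nz|nz] := pselect (nonmax lt A (t, z)); last by exists z.
have [w [[Aw [w' [/= Aw' ww']]] nw]] : proj1 (nonmax lt A `\` nonmax lt (nonmax lt A)) t.
  by rewrite -IH; [exists z|exact: sections_le_nonmax].
exists w'; split=> // nw'; apply: nw; split=> /=.
  by split=> //; exists w'.
by exists w'.
Qed.

(** The elements of a section that are not maximal form a projection of a set
    with smaller sections over the product, so that by induction they can be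
    removed, leaving single points. *)
Lemma measurable_proj1_nonmax M : forall d (T : measurableType d)
    (F : set (set T)) (C : nat -> nat -> set T) (A : set (T * Z)),
  complete_sieve F C -> measurable A -> sections_le M A ->
  measurable (proj1 A) /\ measurable (nonmax lt A).
Proof.
elim: M => [|M IH] d T F C A sieveT mA hA.
  have -> : A = set0 by rewrite -subset0 => -[t z] Atz; have [[|//] _ /(_ _ Atz)] := hA t.
  split; first by rewrite (_ : proj1 _ = set0)//; apply/seteqP; split=> t [].
  by rewrite /nonmax set0I.
have mN : measurable (nonmax lt A).
  pose B : set ((T * Z) * Z) := [set q | A q.1 /\ A (q.1.1, q.2) /\ lt q.1.2 q.2].
  have -> : nonmax lt A = proj1 B.
    by apply/seteqP; split=> -[t z]; [move=> [h1 [w h2]]|move=> [w [h1 h2]]]; [exists w|split=> //; exists w].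
  suff [hm hs] : measurable B /\ sections_le M B.
    by case: (IH _ _ _ _ B (prod_sieve sieveT sieveZ) hm hs).
  split=> [|[t z]].
    apply: measurableI; first exact: (measurable_preimageT measurable_fst mA).
    apply: measurableI.
      have mf : measurable_fun setT (fun q : T * Z * Z => (q.1.1, q.2)).
        apply: measurable_fun_pair; last exact: measurable_snd.
        exact: (measurableT_comp measurable_fst measurable_fst).
      exact: (measurable_preimageT mf mA).
    have mf : measurable_fun setT (fun q : T * Z * Z => (q.1.2, q.2)).
      apply: measurable_fun_pair; last exact: measurable_snd.
      exact: (measurableT_comp measurable_snd measurable_fst).
    exact: (measurable_preimageT mf (measurable_sieve_lt sieveZ)).
  have [s sM hs] := hA t; have [Atz|nA] := pselect (A (t, z)); last by exists [::] => // w [].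
  exists (rem z s); first by rewrite size_rem ?hs// -ltnS (leq_trans _ sM)// prednK// lt0n size_eq0; apply/eqP => s0; have := hs z Atz; rewrite s0.
  move=> w [_ [/= Aw zw]]; have := hs _ Aw.
  have zz' : w != z by apply/eqP => e; move: zw; rewrite e; exact: sieve_lt_irr.
  by rewrite (perm_mem (perm_to_rem (hs _ Atz))) inE (negbTE zz').
split=> //; rewrite (proj1_max hA).
apply: (measurable_proj1_single sieveT sieveZ); first exact: measurableD.
by move=> t z z'; exact: single_max.
Qed.

End finite_sections.

(** * Sums over finite sections and the mass transport principle *)

Definition sec T Z (A : set (T * Z)) (t : T) : set Z := [set z | A (t, z)].

Definition swap T (A : set (T * T)) : set (T * T) := [set p | A (p.2, p.1)].

Definition secsum (R : realType) T (Z : choiceType) (A : set (T * Z))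
    (f : T * Z -> \bar R) (t : T) : \bar R := (\sum_(z \in sec A t) f (t, z))%E.

Lemma finite_sec T (Z : choiceType) M (A : set (T * Z)) t :
  sections_le M A -> finite_set (sec A t).
Proof.
by move=> /(_ t)[s _ hs]; apply: (sub_finite_set (B := [set` s])).
Qed.

Lemma sections_le_sub T (Z : eqType) M (A B : set (T * Z)) :
  B `<=` A -> sections_le M A -> sections_le M B.
Proof. by move=> BA hA t; have [s sM hs] := hA t; exists s => // z /BA/hs. Qed.

Lemma secsum_ge0 (R : realType) T (Z : choiceType) (A : set (T * Z))
    (f : T * Z -> \bar R) t :
  (forall p, 0 <= f p)%E -> (0 <= secsum A f t)%E.
Proof. by move=> f0; apply: fsume_ge0. Qed.

Lemma secsum_split (R : realType) T (Z : choiceType) M (A B : set (T * Z))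
    (f : T * Z -> \bar R) t : B `<=` A -> sections_le M A ->
  (secsum A f t = secsum (A `\` B) f t + secsum B f t)%E.
Proof.
move=> BA hA; rewrite /secsum (_ : sec A t = sec (A `\` B) t `|` sec B t).
  apply: fsbigU0.
  - by apply: finite_sec; apply: sections_le_sub hA => p [].
  - by apply: finite_sec; apply: sections_le_sub hA.
  - by move=> z [[_ nB]].
apply/seteqP; split=> z /=.
  by move=> Az; have [|] := pselect (B (t, z)); [right|left].
by move=> [[]|/BA].
Qed.

Lemma secsum0 (R : realType) T (Z : choiceType) (A : set (T * Z))
    (f : T * Z -> \bar R) t : sec A t = set0 -> secsum A f t = 0%E.
Proof. by rewrite /secsum => ->; rewrite fsbig_set0. Qed.

Lemma secsum1 (R : realType) T (Z : choiceType) (A : set (T * Z))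
    (f : T * Z -> \bar R) t z : sec A t = [set z] -> secsum A f t = f (t, z).
Proof. by rewrite /secsum => ->; rewrite fsbig_set1. Qed.

Section sections.
Context d' (Z : measurableType d').
Variables (F' : set (set Z)) (C' : nat -> nat -> set Z).
Hypothesis sieveZ : complete_sieve F' C'.
Let lt := sieve_lt C'.

Definition single_sections T (A : set (T * Z)) : Prop :=
  forall t z z', A (t, z) -> A (t, z') -> z = z'.

Lemma single_sections_cases T (A : set (T * Z)) t : single_sections A ->
  sec A t = set0 \/ exists2 z, A (t, z) & sec A t = [set z].
Proof.
move=> A1; have [[z Az]|h] := pselect (exists z, A (t, z)); [right|left].
  by exists z => //; apply/seteqP; split=> z' /=; [move=> /(A1 _ _ _ Az) ->|move=> ->].
by rewrite -subset0 => z Az; apply: h; exists z.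
Qed.

(** The sum has at most one term, and is 0 off the projection. *)
Lemma preimage_secsum_single (R : realType) T (A : set (T * Z))
    (f : T * Z -> \bar R) (B : set (\bar R)) : single_sections A ->
  secsum A f @^-1` B = proj1 (A `&` [set p | B (f p)]) `|` (if 0%E \in B then ~` proj1 A else set0).
Proof.
move=> A1; apply/seteqP; split=> t /=.
  have [A0|[z Az Az1]] := single_sections_cases t A1.
    rewrite secsum0// => B0; right; rewrite ifT ?inE//= => -[z Az].
    by have : sec A t z by []; rewrite A0.
  by rewrite (secsum1 _ Az1) => Bz; left; exists z.
move=> [[z [Az Bz]]|].
  have [A0|[z' Az' Az1]] := single_sections_cases t A1.
    by have : sec A t z by []; rewrite A0.
  by rewrite (secsum1 _ Az1) (A1 _ _ _ Az' Az).
case: ifPn => // /set_mem B0 nA.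
rewrite secsum0// -subset0 => z Az; apply: nA; by exists z.
Qed.

Context d (T : measurableType d).
Variables (F : set (set T)) (C : nat -> nat -> set T).
Hypothesis sieveT : complete_sieve F C.

Lemma measurable_preimage_secsum_single (R : realType) (A : set (T * Z))
    (f : T * Z -> \bar R) (B : set (\bar R)) : measurable A -> single_sections A ->
  measurable_fun setT f -> measurable B -> measurable (proj1 (A `&` [set p | B (f p)])).
Proof.
move=> mA A1 mf mB; apply: (measurable_proj1_single sieveT sieveZ).
  by apply: measurableI => //; exact: (measurable_preimageT mf mB).
by move=> t z z' [+ _] [+ _]; exact: A1.
Qed.

(** By induction on the bound of the sections, the largest point of each section
    being split off. *)
Lemma measurable_secsum (R : realType) M (A : set (T * Z)) (f : T * Z -> \bar R) :
  measurable A -> sections_le M A -> measurable_fun setT f ->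
  measurable_fun setT (secsum A f).
Proof.
elim: M A => [|M IH] A mA hA mf.
  rewrite (_ : secsum A f = cst 0%E); first exact: measurable_cst.
  apply/funext => t; apply: secsum0; rewrite -subset0 => z Az.
  by have [[|//] _ /(_ _ Az)] := hA t.
rewrite (_ : secsum A f = (secsum (A `\` nonmax lt A) f \+ secsum (nonmax lt A) f)%E); last first.
  by apply/funext => t; apply: secsum_split hA => p [].
have [_ mN] := measurable_proj1_nonmax sieveZ sieveT mA hA.
apply: emeasurable_funD; last first.
  by apply: IH => //; exact: sections_le_nonmax.
have mD : measurable (A `\` nonmax lt A) by exact: measurableD.
have D1 : single_sections (A `\` nonmax lt A) by move=> t z z'; exact: (single_max sieveZ).
move=> _ B mB; rewrite setTI preimage_secsum_single//; apply: measurableU.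
  exact: measurable_preimage_secsum_single.
case: ifP => // _; apply: measurableC.
exact: (measurable_proj1_single sieveT sieveZ).
Qed.

End sections.

Section mass_transport.
Context (R : realType) d (Y : measurableType d) (nu : probability Y R).
Variables (F : set (set Y)) (C : nat -> nat -> set Y).
Hypothesis sieveY : complete_sieve F C.
Variable E : set (Y * Y).
Hypothesis E_inv : invariant_measure nu E.
Let lt := sieve_lt C.

Lemma measurable_swap (A : set (Y * Y)) : measurable A -> measurable (swap A).
Proof. by move=> mA; apply: (measurable_preimageT _ mA); exact: measurable_swap. Qed.

Let measurable_section_fun (A : set (Y * Y)) f : measurable A -> single_sections A ->
  (forall y, proj1 A y -> A (y, f y)) -> measurable_fun (proj1 A) f.
Proof.
move=> mA A1 Af _ B mB.
rewrite (_ : _ `&` _ = proj1 (A `&` (setT `*` B))).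
  apply: (measurable_proj1_single sieveY sieveY); last by move=> ? ? ? [+ _] [+ _]; exact: A1.
  by apply: measurableI => //; exact: measurableX.
apply/seteqP; split=> y; first by move=> [/Af Ay By]; exists (f y).
move=> [z [Ayz [_ Bz]]]; have py : proj1 A y by exists z.
by split=> //=; rewrite (A1 _ _ _ (Af _ py) Ayz).
Qed.

(** A partial injection inside E with measurable graph is a partial isomorphism,
    its maps being measurable because preimages are projections. *)
Lemma measure_proj1_partial_injection (A : set (Y * Y)) : measurable A -> A `<=` E ->
  single_sections A -> single_sections (swap A) -> nu (proj1 A) = nu (proj1 (swap A)).
Proof.
move=> mA AE A1 A1'; have mA' := measurable_swap mA.
have pick (B : set (Y * Y)) : exists f : Y -> Y, forall y, proj1 B y -> B (y, f y).
  have /choice[f hf] : forall y, exists z, proj1 B y -> B (y, z).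
    move=> y; have [[z Bz]|nB] := pselect (proj1 B y); first by exists z.
    by exists y => /nB.
  by exists f.
have [f hf] := pick A; have [g hg] := pick (swap A).
apply: (E_inv (f := f) (g := g)); split.
- by split; exact: (measurable_proj1_single sieveY sieveY).
- by split; exact: measurable_section_fun.
- by split=> y; [move=> /hf Ay; exists y|move=> /hg Ay; exists y].
- split=> y.
    move=> /hf Ay; apply: (A1' (f y)) => //; apply: hg; by exists y.
  move=> /hg Ay; apply: (A1 (g y)) => //; apply: hf; by exists y.
- by move=> y /hf /AE.
Qed.

(** Both sums have the same distribution, because their level sets are
    projections of one and the same partial injection. *)
Let mass_transport_single (A : set (Y * Y)) (f : Y * Y -> \bar R) :
  measurable A -> A `<=` E -> single_sections A -> single_sections (swap A) ->
  measurable_fun setT f -> (forall p, 0 <= f p)%E ->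
  (\int[nu]_y secsum A f y = \int[nu]_y secsum (swap A) (fun p => f (p.2, p.1)) y)%E.
Proof.
move=> mA AE A1 A1' mf f0; pose f' p := f (p.2, p.1).
have mf' : measurable_fun setT f'.
  by apply: (measurableT_comp mf); exact: measurable_fun_pair.
have mA' := measurable_swap mA.
have le1 (B : set (Y * Y)) : single_sections B -> sections_le 1 B.
  move=> B1 y; have [B0|[z Bz Bz1]] := single_sections_cases y B1.
    by exists [::] => // z Bz; have : sec B y z by []; rewrite B0.
  by exists [:: z] => // z' Bz'; rewrite inE (B1 _ _ _ Bz Bz').
have mS : measurable_fun setT (secsum A f).
  exact: (measurable_secsum sieveY sieveY mA (le1 _ A1) mf).
have mS' : measurable_fun setT (secsum (swap A) f').
  exact: (measurable_secsum sieveY sieveY mA' (le1 _ A1') mf').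
(* Truncated at 0, in order to integrate a nonnegative function against the
   distributions of the two sums on the whole extended line. *)
pose m0 (x : \bar R) := maxe x 0%E.
have mm0 : measurable_fun setT m0 by exact: measurable_maxe.
have intE S : measurable_fun setT S -> (forall y, 0 <= S y)%E ->
    (\int[nu]_y S y = \int[pushforward nu S]_x m0 x)%E.
  move=> mS0 S0; rewrite ge0_integral_pushforward//; last first.
    by move=> x _; rewrite /m0 le_max lexx orbT.
  by apply: eq_integral => y _; rewrite /m0 /= max_l.
rewrite !intE//; [|by move=> y; apply: secsum_ge0 => p; exact: f0|by move=> y; exact: secsum_ge0].
apply: eq_measure_integral => B mB _ /=; rewrite /pushforward.
rewrite !preimage_secsum_single//.
have eqp (D : set (Y * Y)) : measurable D -> nu (proj1 (A `&` D)) = nu (proj1 (swap A `&` swap D)).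
  move=> mD; apply: measure_proj1_partial_injection.
  - exact: measurableI.
  - by move=> p [/AE].
  - by move=> ? ? ? [+ _] [+ _]; exact: A1.
  - by move=> ? ? ? [+ _] [+ _]; exact: A1'.
have mpB : measurable [set p | B (f p)] by exact: (measurable_preimageT mf mB).
have mp := measurable_preimage_secsum_single sieveY sieveY mA A1 mf mB.
have mp' := measurable_preimage_secsum_single sieveY sieveY mA' A1' mf' mB.
case: ifP => _; last by rewrite !setU0 eqp.
have mpA := measurable_proj1_single sieveY sieveY mA A1.
have mpA' := measurable_proj1_single sieveY sieveY mA' A1'.
rewrite !measureU ?eqp//.
- congr (_ + _)%E; first exact: eqp.
  transitivity (1 - nu (proj1 A))%E; first exact: probability_setC.
  by rewrite measure_proj1_partial_injection//; apply/esym; exact: probability_setC.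
- exact: measurableC.
- by rewrite -subset0 => y [[z [Az _]]]; apply; exists z.
- exact: measurableC.
- by rewrite -subset0 => y [[z [Az _]]]; apply; exists z.
Qed.

(** Peeling off the largest points, first of the sections over the first factor
    and then of those over the second, decomposes A into finitely many partial
    injections inside E. *)
Lemma mass_transport M M' (A : set (Y * Y)) (f : Y * Y -> \bar R) :
  measurable A -> A `<=` E -> sections_le M A -> sections_le M' (swap A) ->
  measurable_fun setT f -> (forall p, 0 <= f p)%E ->
  (\int[nu]_y secsum A f y = \int[nu]_y secsum (swap A) (fun p => f (p.2, p.1)) y)%E.
Proof.
move=> + + + + mf f0.
have mf' : measurable_fun setT (fun p : Y * Y => f (p.2, p.1)).
  by apply: (measurableT_comp mf); exact: measurable_fun_pair.
have swapD (B D : set (Y * Y)) : swap (B `\` D) = swap B `\` swap D by [].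
have int_split (B D : set (Y * Y)) N g : measurable B -> measurable D -> D `<=` B ->
    sections_le N B -> measurable_fun setT g -> (forall p, 0 <= g p)%E ->
    (\int[nu]_y secsum B g y =
     \int[nu]_y secsum (B `\` D) g y + \int[nu]_y secsum D g y)%E.
  move=> mB mD DB hB mg g0; rewrite -ge0_integralD//; first last.
  - by apply: (measurable_secsum sieveY sieveY mD _ mg); exact: sections_le_sub hB.
  - by move=> y _; exact: secsum_ge0.
  - apply: (measurable_secsum sieveY sieveY (M := N)) => //; first exact: measurableD.
    by apply: sections_le_sub hB => p [].
  - by move=> y _; exact: secsum_ge0.
  by apply: eq_integral => y _; exact: secsum_split.
have empty0 (B : set (Y * Y)) g : B = set0 -> (\int[nu]_y secsum B g y = 0)%E.
  by move=> ->; apply: integral0_eq => y _; exact: secsum0.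
have sec0 (B : set (Y * Y)) : sections_le 0 B -> B = set0.
  by move=> hB; rewrite -subset0 => -[t z] Btz; have [[|//] _ /(_ _ Btz)] := hB t.
elim: M A => [|M IH] A mA AE hA hA'.
  have A0 := sec0 _ hA; rewrite (empty0 A)// (empty0 (swap A))//.
  by rewrite A0; apply/seteqP; split.
have [_ mN] := measurable_proj1_nonmax sieveY sieveY mA hA.
have NA : nonmax lt A `<=` A by move=> p [].
rewrite (int_split A (nonmax lt A) M.+1)//.
rewrite (int_split (swap A) (swap (nonmax lt A)) M')//; first last.
- by move=> p; exact: NA.
- exact: measurable_swap.
- exact: measurable_swap.
congr (_ + _)%E; last first.
  apply: IH => //; [by move=> p /NA/AE|exact: sections_le_nonmax|].
  by apply: sections_le_sub hA' => p; exact: NA.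
rewrite -swapD.
have : sections_le M' (swap (A `\` nonmax lt A)) by apply: sections_le_sub hA' => p [].
have : single_sections (A `\` nonmax lt A) by move=> t z z'; exact: (single_max sieveY).
have : A `\` nonmax lt A `<=` E by move=> p [/AE].
have : measurable (A `\` nonmax lt A) by exact: measurableD.
move: (A `\` _) => {hA hA' mN NA mA AE}A.
elim: M' A {IH} => [|M' IH'] A mA AE A1 hA'.
  have A0 := sec0 _ hA'; rewrite (empty0 (swap A))// (empty0 A)//.
  by rewrite -subset0 => -[y z] Ayz; have : swap A (z, y) by []; rewrite A0.
have mA' := measurable_swap mA.
have [_ mN] := measurable_proj1_nonmax sieveY sieveY mA' hA'.
pose N := swap (nonmax lt (swap A)).
have mNs : measurable N by exact: measurable_swap.
have NA : N `<=` A by move=> [y z] [].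
have hA : sections_le 1 A.
  move=> y; have [A0|[z Az Az1]] := single_sections_cases y A1.
    by exists [::] => // z Az; have : sec A y z by []; rewrite A0.
  by exists [:: z] => // z' Az'; rewrite inE (A1 _ _ _ Az Az').
rewrite (int_split A N 1%N)//.
rewrite (int_split (swap A) (nonmax lt (swap A)) M'.+1)//; last by move=> p [].
congr (_ + _)%E; last first.
  apply: IH' => //; [by move=> p /NA/AE|by move=> t z z' /NA ? /NA; exact: A1|].
  by apply: sections_le_nonmax.
apply: mass_transport_single => //.
- exact: measurableD.
- by move=> p [/AE].
- by move=> t z z' [? _] [? _]; exact: (A1 t).
- by move=> t z z'; exact: (single_max sieveY (A := swap A)).
Qed.

(** The transport principle for the constant function 1 bounds the measure of
    the projection by an integral over the null set. *)
Lemma null_saturation M M' (A : set (Y * Y)) (N : set Y) :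
  measurable A -> A `<=` E -> sections_le M A -> sections_le M' (swap A) ->
  measurable N -> nu N = 0%E -> (forall y z, A (y, z) -> N z) ->
  nu (proj1 A) = 0%E.
Proof.
move=> mA AE hA hA' mN N0 AN.
have m1 : measurable_fun setT (fun _ : Y * Y => 1%E : \bar R) by exact: measurable_cst.
have [mp _] := measurable_proj1_nonmax sieveY sieveY mA hA.
suff h : (nu (proj1 A) <= 0)%E by apply/eqP; rewrite eq_le h measure_ge0.
have -> : nu (proj1 A) = (\int[nu]_y (\1_(proj1 A) y)%:E)%E.
  by rewrite integral_indic// setIT.
apply: (@le_trans _ _ (\int[nu]_y secsum A (fun=> 1%E) y)%E).
  apply: ge0_le_integral => //.
  - exact/measurable_EFinP/measurable_indic.
  - exact: (measurable_secsum sieveY sieveY mA hA).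
  move=> y _; rewrite indicE; case: (boolP (y \in _)) => [|_]; rewrite /=; last exact: secsum_ge0.
  move=> /set_mem[z Az]; rewrite /secsum (fsbigD1 z)//=; last exact: (finite_sec _ hA).
  by rewrite leeDl//; exact: fsume_ge0.
rewrite (mass_transport mA AE hA hA')// (ge0_ae_eq_integral (g := cst 0%E))//.
- by rewrite integral_cst// mul0e.
- exact: (measurable_secsum sieveY sieveY (measurable_swap mA) hA').
- by move=> y _; exact: secsum_ge0.
- exists N; split=> // z /= /not_implyP[_ h]; apply: contrapT => nN; apply: h.
  by apply: secsum0; rewrite -subset0 => y /AN.
Qed.

End mass_transport.

(** * Conditional probabilities along filtrations of finite partitions *)

(** A refining sequence of finite measurable partitions, given by the cell C n x
    of the n-th partition that contains x. *)
Record filtration d (T : measurableType d) (C : nat -> T -> set T) : Prop :=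
  Filtration {
  cell_refl : forall n x, C n x x ;
  cell_eq : forall n x x', C n x x' -> C n x' = C n x ;
  cell_le : forall n m x, (n <= m)%N -> C m x `<=` C n x ;
  cell_measurable : forall n x, measurable (C n x) ;
  cell_finite : forall n, finite_set (range (C n)) }.

Definition saturated T (C : T -> set T) (Q : set T) : Prop :=
  forall x, Q x -> C x `<=` Q.

Definition cofinal T (C C' : nat -> T -> set T) : Prop :=
  forall n, exists m, forall x, C' m x `<=` C n x.

(** Being open for the topology generated by the cells. *)
Definition cell_open T (C : nat -> T -> set T) (D : set T) : Prop :=
  forall x, D x -> exists n, C n x `<=` D.

Section filtration.
Context (R : realType) d (T : measurableType d) (C : nat -> T -> set T).
Hypothesis filC : filtration C.

Lemma saturated_bigcup n (Q : set T) : saturated (C n) Q ->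
  Q = \bigcup_(D in C n @` Q) D.
Proof.
move=> sQ; apply/seteqP; split => [x Qx|x [_ [x' Qx' <-] /(sQ _ Qx')//]].
by exists (C n x); [exists x|exact: (cell_refl filC)].
Qed.

Let finite_image n (Q : set T) : finite_set (C n @` Q).
Proof. by apply: sub_finite_set (cell_finite filC n) => _ [x _ <-]; exists x. Qed.

Lemma saturated_measurable n (Q : set T) : saturated (C n) Q -> measurable Q.
Proof.
move=> sQ; rewrite (saturated_bigcup sQ); apply: fin_bigcup_measurable.
  exact: finite_image.
by move=> _ [x _ <-]; exact: (cell_measurable filC).
Qed.

Lemma measure_saturated_le (m1 m2 : {measure set T -> \bar R}) (c : R) n (Q : set T) :
  0 <= c -> saturated (C n) Q ->
  (forall x, Q x -> (m1 (C n x) <= c%:E * m2 (C n x))%E) ->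
  (m1 Q <= c%:E * m2 Q)%E.
Proof.
move=> c0 sQ h; have fQ := finite_image n Q.
have mQ : forall D, (C n @` Q) D -> measurable D.
  by move=> _ [x _ <-]; exact: (cell_measurable filC).
have tQ : trivIset (C n @` Q) id.
  move=> _ _ [x _ <-] [x' _ <-] [z [zx zx']].
  by rewrite -(cell_eq filC zx) -(cell_eq filC zx').
rewrite {1 2}(saturated_bigcup sQ) !measure_fin_bigcup//.
rewrite ge0_mule_fsumr; last by move=> D.
by apply: lee_fsum => // _ [x Qx <-]; exact: h.
Qed.

(** The cells at which the inequality holds for the first time are disjoint. *)
Lemma measure_bigcup_saturated_le (m1 m2 : {measure set T -> \bar R}) (c : R)
    (Q : (set T)^nat) :
  0 <= c -> (forall n, saturated (C n) (Q n)) ->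
  (forall n x, Q n x -> (m1 (C n x) <= c%:E * m2 (C n x))%E) ->
  (m1 (\bigcup_n Q n) <= c%:E * m2 (\bigcup_n Q n))%E.
Proof.
move=> c0 sQ h; rewrite seqDU_bigcup_eq.
have sD n : saturated (C n) (seqDU Q n).
  move=> x [Qx nQ] x' xx'; split; first exact: (sQ n x).
  move=> Qx'; apply: nQ; move: Qx'; rewrite -!bigcup_mkord => -[i /= ilt Qix']; exists i => //.
  apply: (sQ i x') => //; apply: (cell_le filC (ltnW ilt)).
  by rewrite (cell_eq filC xx'); exact: (cell_refl filC).
have mD n : measurable (seqDU Q n) := saturated_measurable (sD n).
rewrite !measure_bigcup//; try exact: trivIset_seqDU.
rewrite -nneseriesZl//; apply: lee_nneseries => // n _.
apply: (measure_saturated_le (n := n)) => // x [Qx _]; exact: h.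
Qed.

End filtration.

Section crossing.
Context (R : realType) d (T : measurableType d) (lam : probability T R).
Variables (C C' : nat -> T -> set T) (A : set T).
Hypotheses (filC : filtration C) (filC' : filtration C').
Hypotheses (CC' : cofinal C C') (C'C : cofinal C' C) (mA : measurable A).

Let rho : {measure set T -> \bar R} := mrestr lam mA.

Let lower (a : R) (D : set T) n : set T :=
  [set x | C n x `<=` D /\ (rho (C n x) <= a%:E * lam (C n x))%E].
Let upper (b : R) (D : set T) n : set T :=
  [set x | C' n x `<=` D /\ (lam (C' n x) <= b^-1%:E * rho (C' n x))%E].

Let saturated_lower a D n : saturated (C n) (lower a D n).
Proof. by move=> x [h1 h2] x' xx'; rewrite /lower /= (cell_eq filC xx'). Qed.

Let saturated_upper b D n : saturated (C' n) (upper b D n).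
Proof. by move=> x [h1 h2] x' xx'; rewrite /upper /= (cell_eq filC' xx'). Qed.

Let next a b D := \bigcup_n upper b (\bigcup_m lower a D m) n.

Let measure_next (a b : R) D : 0 <= a -> 0 < b -> measurable D ->
  measurable (next a b D) /\ (lam (next a b D) <= (a / b)%:E * lam D)%E.
Proof.
move=> a0 b0 mD.
have mU : measurable (next a b D).
  apply: bigcupT_measurable => n; exact: (saturated_measurable filC' (@saturated_upper b _ n)).
have mL : measurable (\bigcup_m lower a D m).
  apply: bigcupT_measurable => n; exact: (saturated_measurable filC (@saturated_lower a D n)).
split=> //.
have h1 : (lam (next a b D) <= b^-1%:E * rho (next a b D))%E.
  apply: (measure_bigcup_saturated_le filC').
  - by rewrite invr_ge0 ltW.
  - exact: saturated_upper.
  - by move=> n x [].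
have h2 : (rho (\bigcup_m lower a D m) <= a%:E * lam (\bigcup_m lower a D m))%E.
  by apply: (measure_bigcup_saturated_le filC) => // n x [].
apply: (le_trans h1); rewrite mulrC EFinM -muleA lee_pmul2l ?lte_fin ?invr_gt0//.
apply: (@le_trans _ _ (rho (\bigcup_m lower a D m))).
  apply: le_measure; rewrite ?inE//.
  by move=> x [n _ [h _]]; apply: h; exact: (cell_refl filC').
apply: (le_trans h2); apply: lee_pmul => //.
apply: le_measure; rewrite ?inE//.
by move=> x [n _ [h _]]; apply: h; exact: (cell_refl filC).
Qed.

(** Cover the set by cells where the conditional probability is at most a, then
    inside those by cells where it is at least b; each round divides the measure
    of the cover by b/a. *)
Lemma crossing_negligible (a b : R) : 0 <= a -> a < b ->
  lam.-negligible [set x |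
    (forall m, exists2 n, (m <= n)%N & (rho (C n x) <= a%:E * lam (C n x))%E) /\
    (forall m, exists2 n, (m <= n)%N & (b%:E * lam (C' n x) <= rho (C' n x))%E)].
Proof.
move=> a0 ab; have b0 : 0 < b by exact: le_lt_trans ab.
(* A point that crosses k times lies in D k. *)
pose D k := iter k (next a b) setT.
have hD k : measurable (D k) /\ (lam (D k) <= ((a / b) ^+ k)%:E)%E.
  elim: k => [|k [mDk IHk]]; first by rewrite /D /= expr0 probability_setT.
  have [mN hN] := measure_next a0 b0 mDk.
  split => //; apply: (le_trans hN).
  by rewrite exprS [leRHS]EFinM; apply: lee_pmul => //; rewrite lee_fin divr_ge0// ltW.
exists (\bigcap_k D k); split.
- by apply: bigcapT_measurable => k; case: (hD k).
- have mB : measurable (\bigcap_k D k) by apply: bigcapT_measurable => k; case: (hD k).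
  have hB k : (lam (\bigcap_k D k) <= ((a / b) ^+ k)%:E)%E.
    have [mDk hDk] := hD k; apply: le_trans hDk; apply: le_measure; rewrite ?inE//.
    exact: bigcap_inf.
  have q0 : 0 <= a / b by rewrite divr_ge0// ltW.
  have q1 : `|a / b| < 1 by rewrite ger0_norm// ltr_pdivrMr// mul1r.
  apply/eqP; rewrite eq_le measure_ge0 andbT.
  have cq : ((a / b) ^+ k)%:E @[k --> \oo] --> 0%:E by apply: cvg_EFin; [near=> k|exact: cvg_expr].
  rewrite -[leRHS](cvg_lim _ cq)//; apply: lime_ge; first by apply/cvg_ex; exists 0%:E.
  by near=> k; exact: hB.
- move=> x [hC hC'] k _; suff [] : D k x /\ cell_open C (D k) by [].
  elim: k => [|k [Dx oD]]; first by split=> // z _; exists 0%N.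
  have oL : cell_open C' (\bigcup_m lower a (D k) m).
    move=> z [m _ Lz]; have [n hn] := CC' m; exists n => z' /hn zz'.
    by exists m => //; exact: (saturated_lower Lz).
  split.
    have [n0 hn0] := oD x Dx.
    have [n n0n hn] := hC n0.
    have Lx : (\bigcup_m lower a (D k) m) x.
      by exists n => //; split=> //; apply: subset_trans hn0; exact: (cell_le filC).
    have [n1 hn1] := oL x Lx; have [m n1m hm] := hC' n1.
    exists m => //; split; first by apply: subset_trans hn1; exact: (cell_le filC').
    by rewrite muleC lee_pdivlMr// muleC.
  move=> z [m _ Uz]; have [n hn] := C'C m; exists n => z' /hn zz'.
  by exists m => //; exact: (saturated_upper Uz).
Unshelve. all: by end_near.
Qed.

End crossing.

Lemma ae_forall_countable d (T : measurableType d) (R : realType)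
    (mu : {measure set T -> \bar R}) I (D : set I) (P : I -> T -> Prop) :
  countable D -> (forall i, D i -> {ae mu, forall x, P i x}) ->
  {ae mu, forall x, forall i, D i -> P i x}.
Proof.
move=> /countable_injP[e einj] h.
suff : {ae mu, forall x, forall n i, D i -> e i = n -> P i x}.
  by apply: filterS => x hx i Di; exact: (hx (e i)).
apply: ae_foralln => n.
have [[i [Di ein]]|no] := pselect (exists i, D i /\ e i = n).
  apply: filterS (h i Di) => x Px j Dj ejn.
  by rewrite (_ : j = i)//; apply: einj; rewrite ?inE// ejn.
by apply: aeW => x i Di ein; exfalso; apply: no; exists i.
Qed.

(** ** Sequences without crossings *)

(** Rational levels suffice to detect divergence and leave countably many cases. *)
Definition no_crossing (R : realType) (u v : R^nat) : Prop :=
  forall a b : rat, 0 <= ratr a :> R -> (ratr a : R) < ratr b ->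
  ~ ((forall m, exists2 n, (m <= n)%N & u n <= ratr a) /\
     (forall m, exists2 n, (m <= n)%N & ratr b <= v n)).

(** The common limit is the lower limit of u. *)
Lemma no_crossing_cvg (R : realType) (u v : R^nat) :
  (forall n, 0 <= u n <= 1) -> (forall n, 0 <= v n) ->
  no_crossing u u -> no_crossing u v -> no_crossing v u ->
  exists l : R, u n @[n --> \oo] --> l /\ v n @[n --> \oo] --> l.
Proof.
move=> u01 v0 uu uv vu.
pose S := [set r | exists N, forall n, (N <= n)%N -> r <= u n].
have hS : has_sup S.
  split; first by exists 0, 0%N => n _; have /andP[] := u01 n.
  exists 1 => r [N /(_ N (leqnn N)) rN]; apply: (le_trans rN).
  by have /andP[] := u01 N.
pose l := sup S.
have l0 : 0 <= l by apply: ub_le_sup; [case: hS|exists 0%N => n _; have /andP[] := u01 n].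
have low e : 0 < e -> exists N, forall n, (N <= n)%N -> l - e < u n.
  move=> e0; have [r [N hN] lr] := sup_adherent e0 hS; exists N => n /hN.
  exact: lt_le_trans.
have io r : l < r -> forall m, exists2 n, (m <= n)%N & u n <= r.
  move=> lr m; apply: contrapT => h.
  suff Sr : S r by move: (ub_le_sup (proj2 hS) Sr); rewrite leNgt lr.
  exists m => n mn; rewrite leNgt; apply/negP => unr; apply: h.
  by exists n => //; exact: ltW.
have up w : no_crossing u w -> forall e, 0 < e -> exists N, forall n, (N <= n)%N -> w n < l + e.
  move=> uw e e0.
  have [a] : exists a : rat, ratr a \in `]l, (l + e)[ by apply: rat_in_itvoo; rewrite ltrDl.
  rewrite in_itv /= => /andP[la ae].
  have [b] := rat_in_itvoo ae; rewrite in_itv /= => /andP[ab be].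
  apply: contrapT => h; apply: (uw a b _ ab); first by rewrite (le_trans l0)// ltW.
  split; first exact: io.
  move=> m; apply: contrapT => h'; apply: h; exists m => n mn.
  rewrite ltNge; apply/negP => len; apply: h'; exists n => //.
  by apply: le_trans len; exact: ltW.
have lowv e : 0 < e -> exists N, forall n, (N <= n)%N -> l - e < v n.
  move=> e0; have [le0|le0] := ltP (l - e) 0.
    by exists 0%N => n _; exact: lt_le_trans (v0 n).
  have [a] : exists a : rat, ratr a \in `](l - e), l[ by apply: rat_in_itvoo; rewrite ltrBlDr ltrDl.
  rewrite in_itv /= => /andP[la al].
  have [b] := rat_in_itvoo al; rewrite in_itv /= => /andP[ab bl].
  have [N hN] := low (l - ratr b) ltac:(by rewrite subr_gt0).
  apply: contrapT => h; apply: (vu a b _ ab); first by rewrite (le_trans le0)// ltW.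
  split=> m.
    apply: contrapT => h'; apply: h; exists m => n mn.
    rewrite ltNge; apply/negP => len; apply: h'; exists n => //.
    by apply: (le_trans len); exact: ltW.
  exists (maxn m N); first exact: leq_maxl.
  by have := hN _ (leq_maxr m N); rewrite subKr => /ltW.
exists l; split.
  apply/cvgrPdist_lt => e e0; have [N1 h1] := low e e0; have [N2 h2] := up u uu e e0.
  exists (maxn N1 N2) => // n /=; rewrite geq_max => /andP[/h1 a1 /h2 a2].
  by rewrite ltr_distlC; apply/andP.
apply/cvgrPdist_lt => e e0; have [N1 h1] := lowv e e0; have [N2 h2] := up v uv e e0.
exists (maxn N1 N2) => // n /=; rewrite geq_max => /andP[/h1 a1 /h2 a2].
by rewrite ltr_distlC; apply/andP.
Qed.

(** ** Information functions *)

Definition condprob (R : realType) d (T : measurableType d) (lam : probability T R)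
  (D A : set T) : R := fine (lam (D `&` A)) / fine (lam D).

(** A partition into finitely many measurable sets, given by its block map. *)
Definition finite_block_map d (T : measurableType d) (blk : T -> set T) : Prop :=
  [/\ forall x, blk x x, forall x x', blk x x' -> blk x' = blk x,
      forall x, measurable (blk x) & finite_set (range blk)].

Section conditional_information.
Context (R : realType) d (T : measurableType d) (lam : probability T R).

Lemma condprob_ge0 (D A : set T) : 0 <= condprob lam D A.
Proof. by rewrite divr_ge0// fine_ge0. Qed.

Lemma condprob_le1 (D A : set T) : measurable D -> measurable A -> condprob lam D A <= 1.
Proof.
move=> mD mA; have [D0|D0] := eqVneq (fine (lam D)) 0.
  by rewrite /condprob D0 invr0 mulr0.
have fD : lam D \is a fin_num by exact: fin_num_measure.
have fDA : lam (D `&` A) \is a fin_num by apply: fin_num_measure; exact: measurableI.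
rewrite /condprob ler_pdivrMr ?mul1r; last by rewrite lt0r D0 fine_ge0.
by apply: fine_le => //; apply: le_measure; rewrite ?inE//; exact: measurableI.
Qed.

Lemma condprob_le (D A : set T) (a : R) : measurable D -> measurable A ->
  condprob lam D A <= a -> (lam (D `&` A) <= a%:E * lam D)%E.
Proof.
move=> mD mA; have fD : lam D \is a fin_num by exact: fin_num_measure.
have fDA : lam (D `&` A) \is a fin_num by apply: fin_num_measure; exact: measurableI.
have [D0|D0] := eqVneq (lam D) 0%E => [_|].
  rewrite D0 mule0 -D0; apply: le_measure; rewrite ?inE//; exact: measurableI.
rewrite /condprob ler_pdivrMr; last by rewrite fine_gt0// lt0e D0 measure_ge0 ltey_eq fD.
by rewrite -{2}(fineK fD) -(fineK fDA) -EFinM lee_fin.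
Qed.

Lemma condprob_ge (D A : set T) (b : R) : measurable D -> measurable A -> 0 < b ->
  b <= condprob lam D A -> (b%:E * lam D <= lam (D `&` A))%E.
Proof.
move=> mD mA b0; have fD : lam D \is a fin_num by exact: fin_num_measure.
have fDA : lam (D `&` A) \is a fin_num by apply: fin_num_measure; exact: measurableI.
have [D0|D0] := eqVneq (lam D) 0%E => [_|].
  by rewrite D0 mule0.
rewrite /condprob ler_pdivlMr; last by rewrite fine_gt0// lt0e D0 measure_ge0 ltey_eq fD.
by rewrite -{2}(fineK fD) -(fineK fDA) -EFinM lee_fin.
Qed.

Lemma ae_no_crossing (C C' : nat -> T -> set T) A :
  filtration C -> filtration C' -> cofinal C C' -> cofinal C' C -> measurable A ->
  {ae lam, forall x, no_crossing (fun n => condprob lam (C n x) A)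
                                 (fun n => condprob lam (C' n x) A)}.
Proof.
move=> filC filC' CC' C'C mA.
suff : {ae lam, forall x, forall ab : rat * rat, setT ab ->
    (0 <= ratr ab.1 :> R) -> (ratr ab.1 : R) < ratr ab.2 ->
  ~ ((forall m, exists2 n, (m <= n)%N & condprob lam (C n x) A <= ratr ab.1) /\
     (forall m, exists2 n, (m <= n)%N & ratr ab.2 <= condprob lam (C' n x) A))}.
  by apply: filterS => x hx a b; exact: (hx (a, b)).
apply: ae_forall_countable => // -[a b] _ /=.
have [a0|] := leP 0 (ratr a : R); last by move=> a0; apply: aeW => x.
have [ab|] := ltP (ratr a : R) (ratr b); last by move=> ba; apply: aeW => x _.
have := crossing_negligible lam filC filC' CC' C'C mA a0 ab.
apply: negligibleS => x /= h.
have {h}[hC hC'] := contrapT (fun nh => h (fun _ _ => nh)); split=> m.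
  have [n mn h] := hC m; exists n => //; apply: condprob_le h => //; exact: (cell_measurable filC).
have [n mn h] := hC' m; exists n => //; apply: condprob_ge h => //.
  exact: (cell_measurable filC').
exact: le_lt_trans ab.
Qed.

(** Cofinal filtrations have the same limits of conditional probabilities,
    because crossings between them are as rare as within one filtration. *)
Lemma ae_cvg_condprob (C C' : nat -> T -> set T) blk :
  filtration C -> filtration C' -> cofinal C C' -> cofinal C' C ->
  finite_block_map blk ->
  {ae lam, forall x, exists l : R,
     condprob lam (C n x) (blk x) @[n --> \oo] --> l /\
     condprob lam (C' n x) (blk x) @[n --> \oo] --> l}.
Proof.
move=> filC filC' CC' C'C [bxx beq bm bfin].
suff : {ae lam, forall x, forall A, range blk A -> exists l : R,
     condprob lam (C n x) A @[n --> \oo] --> l /\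
     condprob lam (C' n x) A @[n --> \oo] --> l}.
  by apply: filterS => x; apply; exists x.
apply: ae_forall_countable; first exact: finite_set_countable.
move=> _ [x0 _ <-]; move: (bm x0); move: (blk x0) => A mA.
have CC : cofinal C C by move=> n; exists n => x y.
have h1 := ae_no_crossing filC filC CC CC mA.
have h2 := ae_no_crossing filC filC' CC' C'C mA.
have h3 := ae_no_crossing filC' filC C'C CC' mA.
apply: filterS (filterI h1 (filterI h2 h3)) => x [{}h1 [{}h2 {}h3]].
apply: no_crossing_cvg => // n; last exact: condprob_ge0.
by rewrite condprob_ge0 condprob_le1//; exact: (cell_measurable filC).
Qed.

(** The set where some conditional probability of the block is at most exp(-k)
    has measure at most (number of blocks) * exp(-k), by the first passage
    estimate; the maximal information is at most the number of such k. *)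
Lemma integral_sup_information (C : nat -> T -> set T) blk (g : T -> \bar R) :
  filtration C -> finite_block_map blk -> measurable_fun setT g ->
  (forall x, 0 <= g x)%E ->
  (forall x, (g x <= ereal_sup (range (fun n => (- ln (condprob lam (C n x) (blk x)))%:E)))%E) ->
  (\int[lam]_x g x <= (2 * (#|` fset_set (range blk)|)%:R)%:E)%E.
Proof.
move=> filC [bxx beq bm bfin] mg g0 gsup.
(* S k contains the points where the information of the block is at least k at
   some time. *)
pose Q (k : nat) (A : set T) n := [set x |
  (lam (C n x `&` A) <= (expR (- k%:R))%:E * lam (C n x))%E].
pose S k := \bigcup_(A in range blk) (A `&` \bigcup_n Q k A n).
have mA A : range blk A -> measurable A by move=> [x _ <-].
have sQ k A n : saturated (C n) (Q k A n).
  by move=> x h1 x' xx'; rewrite /Q /= (cell_eq filC xx').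
have mQ k A n : measurable (Q k A n) := saturated_measurable filC (@sQ k A n).
have mS k : measurable (S k).
  apply: fin_bigcup_measurable => // A hA; apply: measurableI; first exact: mA.
  exact: bigcupT_measurable.
have lamS k : (lam (S k) <= ((#|` fset_set (range blk)|)%:R * 2 / (2 ^ k.+1)%:R)%:E)%E.
  rewrite measure_fin_bigcup//; first last.
  - move=> A hA; apply: measurableI; first exact: mA.
    exact: bigcupT_measurable.
  - move=> _ _ [x _ <-] [x' _ <-] [z [[zx _] [zx' _]]].
    by rewrite -(beq _ _ zx) -(beq _ _ zx').
  apply: (@le_trans _ _ (\sum_(A \in range blk) (expR (- k%:R))%:E)%E).
    apply: lee_fsum => // A hA.
    have le1 : (mrestr lam (mA A hA) (\bigcup_n Q k A n) <= (expR (- k%:R))%:E * lam (\bigcup_n Q k A n))%E.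
      by apply: (measure_bigcup_saturated_le filC) => //; exact: expR_ge0.
    rewrite setIC; apply: (le_trans le1); rewrite -[leRHS]mule1 lee_pmul2l ?lte_fin ?expR_gt0//.
    by apply: probability_le1; exact: bigcupT_measurable.
  rewrite fsbig_finite//= sumEFin lee_fin big_const_seq count_predT iter_addr_0.
  (* The series of exp(-k) is bounded by the one of 2^-k. *)
  have pow2 : (2 ^ k)%:R <= expR k%:R :> R.
    rewrite natrX -[k%:R]mulr1 expRM_natl; apply: lerXn2r; rewrite ?nnegrE ?expR_ge0//.
    exact: le_trans (expR_ge1Dx 1).
  rewrite expRN -[leLHS]mulr_natl -mulrA ler_wpM2l//.
  rewrite expnS natrM invfM mulrA divff// mul1r.
  by rewrite lef_pV2// posrE ?expR_gt0// ltr0n expn_gt0.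
have hg x : (g x <= \sum_(0 <= k <oo) (\1_(S k) x)%:E)%E.
  apply: (le_trans (gsup x)); apply: ge_ereal_sup => _ [n _ <-].
  set q := condprob _ _ _.
  have [q0|q0] := leP q 0.
    rewrite (_ : ln q = 0) ?oppr0; last exact: ln0.
    by apply: nneseries_ge0 => k _ _; rewrite lee_fin.
  have q1 : q <= 1 by apply: condprob_le1 => //; exact: (cell_measurable filC).
  have v0 : 0 <= - ln q by rewrite oppr_ge0 ln_le0.
  have /andP[_ vlt] := truncn_itv v0; set m := (Num.Def.trunc _) in vlt.
  apply: (@le_trans _ _ (\sum_(0 <= k < m.+1) (\1_(S k) x)%:E)%E); last first.
    by apply: nneseries_lim_ge => k _ _; rewrite lee_fin.
  rewrite (eq_big_nat _ _ (F2 := fun=> 1%E)); last first.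
    move=> k /andP[_ km]; rewrite indicE mem_set//.
    exists (blk x); [by exists x|split=> //; exists n => //].
    apply: condprob_le => //; first exact: (cell_measurable filC).
    rewrite -/q -[leLHS]lnK// ler_expR lerNr; apply: (@le_trans _ _ m%:R); first by rewrite ler_nat.
    have /andP[] := truncn_itv v0; exact.
  rewrite sumEFin lee_fin big_const_nat subn0 iter_addr addr0; exact: ltW.
apply: (@le_trans _ _ (\int[lam]_x \sum_(0 <= k <oo) (\1_(S k) x)%:E)%E).
  apply: ge0_le_integral => //; apply: ge0_emeasurable_sum.
    by move=> k x _ _; rewrite lee_fin.
  by move=> k _; exact/measurable_EFinP/measurable_indic.
rewrite integral_nneseries//; first last.
- by move=> k; exact/measurable_EFinP/measurable_indic.
apply: (@le_trans _ _ (\sum_(0 <= k <oo) ((#|` fset_set (range blk)|)%:R * 2 / (2 ^ k.+1)%:R)%:E)%E).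
  apply: lee_nneseries => [k *|k *]; first by apply: integral_ge0 => x _; rewrite lee_fin.
  by rewrite integral_indic// setIT; exact: lamS.
rewrite mulrC; apply: epsilon_trick0; by rewrite mulr_ge0.
Qed.

End conditional_information.

(** * Averages over the classes of a finite extended relation *)

(** The conditions hold everywhere, not only almost everywhere, so that class sums
    are finite sums and depend measurably on the point. *)
Record tame (G : groupType) d (Y : measurableType d) (E : set (Y * Y))
    (En : nat -> set (Y * Y)) (alpha : Y -> Y -> G) : Prop := Tame {
  tame_measurable : forall n, measurable (En n) ;
  tame_equiv : forall n, is_equivalence (En n) ;
  tame_le : forall n m, (n <= m)%N -> En n `<=` En m ;
  tame_bounded : forall n, exists M, sections_le M (En n) ;
  tame_sub : forall n, En n `<=` E ;
  tame_alpha : forall g, measurable [set p : Y * Y | alpha p.1 p.2 = g] ;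
  tame_cocycle : forall n y w u z, En n (y, w) -> En n (y, u) -> En n (y, z) ->
    alpha z u = (alpha z w * alpha w u)%g }.

(** For q = ((x, y), z), the point over z of the extended class of (x, y). *)
Definition move (G : groupType) X Y (act : G -> X -> X) (alpha : Y -> Y -> G)
  (q : (X * Y) * Y) : X * Y := (act (alpha q.2 q.1.2) q.1.1, q.2).

(** The classes of E as sections over X * Y, for sums over extended classes. *)
Definition lift X Y (E : set (Y * Y)) : set ((X * Y) * Y) := [set q | E (q.1.2, q.2)].

Definition avg (R : realType) (G : groupType) X (Y : choiceType)
    (act : G -> X -> X) (alpha : Y -> Y -> G) (E : set (Y * Y))
    (f : X * Y -> \bar R) (p : X * Y) : \bar R :=
  (secsum (@lift X Y E) (f \o move act alpha) p * ((class_card E p.2)%:R^-1)%:E)%E.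

Lemma fsum_cst (R : realType) (I : choiceType) (D : set I) (c : \bar R) :
  finite_set D -> (\sum_(i \in D) c)%E = ((#|` fset_set D|)%:R%:E * c)%E.
Proof.
move=> fD; rewrite fsbig_finite//= big_const_seq count_predT; elim: (size _) => [|n IH].
  by rewrite mul0e.
by rewrite /= IH -[n.+1]addn1 natrD EFinD ge0_muleDl ?lee_fin// mul1e addeC.
Qed.

Section averages.
Context (R : realType) (G : groupType) dX (X : measurableType dX)
  dY (Y : measurableType dY).
Hypothesis countG : countable [set: G].
Variables (FX : set (set X)) (CX : nat -> nat -> set X).
Variables (FY : set (set Y)) (CY : nat -> nat -> set Y).
Hypotheses (sieveX : complete_sieve FX CX) (sieveY : complete_sieve FY CY).
Variables (lam : probability X R) (nu : probability Y R) (act : G -> X -> X).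
Hypothesis act_pmp : pmp_action lam act.
Variable E : set (Y * Y).
Hypothesis E_inv : invariant_measure nu E.
Variables (En : nat -> set (Y * Y)) (alpha : Y -> Y -> G).
Hypothesis tameE : tame E En alpha.

Local Notation mu := (lam \x nu)%E.
Local Notation mv := (move act alpha).
Let cls n (y : Y) : set Y := rel_class (En n) y.
Let kn n (y : Y) : R := (class_card (En n) y)%:R.

Lemma measurable_act g : measurable_fun setT (act g).
Proof. by have [_ _ + _] := act_pmp; exact. Qed.

Lemma measurable_move : measurable_fun setT mv.
Proof.
move=> _ B mB; rewrite setTI (_ : _ @^-1` _ = \bigcup_g
    ([set q : (X * Y) * Y | alpha q.2 q.1.2 = g] `&`
     [set q : (X * Y) * Y | B (act g q.1.1, q.2)])); last first.
  apply/seteqP; split=> q /=; last by move=> [g _ [<-]].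
  by exists (alpha q.2 q.1.2).
apply: countable_bigcupT_measurable => // g; apply: measurableI.
  have m1 : measurable_fun setT (fun q : (X * Y) * Y => (q.2, q.1.2)).
    apply: measurable_fun_pair; first exact: measurable_snd.
    exact: (measurableT_comp measurable_snd measurable_fst).
  exact: (measurable_preimageT m1 (tame_alpha tameE g)).
have m1 : measurable_fun setT (fun q : (X * Y) * Y => (act g q.1.1, q.2)).
  apply: measurable_fun_pair; last exact: measurable_snd.
  apply: (measurableT_comp (measurable_act g)).
  exact: (measurableT_comp measurable_fst measurable_fst).
exact: (measurable_preimageT m1 mB).
Qed.

Lemma measurable_lift n : measurable (@lift X Y (En n)).
Proof.
have m1 : measurable_fun setT (fun q : (X * Y) * Y => (q.1.2, q.2)).
  apply: measurable_fun_pair; last exact: measurable_snd.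
  exact: (measurableT_comp measurable_snd measurable_fst).
exact: (measurable_preimageT m1 (tame_measurable tameE n)).
Qed.

Lemma lift_bounded n : exists M, sections_le M (@lift X Y (En n)).
Proof.
have [M hM] := tame_bounded tameE n; exists M => -[x y].
by have [s sM hs] := hM y; exists s.
Qed.

Lemma finite_class n y : finite_set (cls n y).
Proof. by have [M hM] := tame_bounded tameE n; exact: (finite_sec y hM). Qed.

Lemma class_eq n y z : En n (y, z) -> cls n z = cls n y.
Proof.
have [_ sym tr] := tame_equiv tameE n.
by move=> yz; apply/seteqP; split=> w /=; [exact: tr|apply: tr; exact: sym].
Qed.

Lemma class_card_eq n y z : En n (y, z) -> class_card (En n) z = class_card (En n) y.
Proof. by move=> yz; rewrite /class_card -[rel_class _ z]/(cls n z) (class_eq yz). Qed.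

Lemma class_card_gt0 n y : (0 < class_card (En n) y)%N.
Proof.
rewrite /class_card cardfs_gt0; apply/fset0Pn; exists y.
have fin : finite_set (rel_class (En n) y) := finite_class n y.
rewrite in_fset_set// inE /rel_class /=.
by have [+ _ _] := tame_equiv tameE n; exact.
Qed.

Lemma cocycle1 n y z : En n (y, z) -> alpha z z = 1%g.
Proof.
move=> yz; have h := tame_cocycle tameE yz yz yz.
by apply: (mulgI (alpha z z)); rewrite mulg1 -h.
Qed.

Lemma move_move n x y z w : En n (y, z) -> En n (y, w) ->
  mv (mv ((x, y), z), w) = mv ((x, y), w).
Proof.
move=> yz yw; have [_ actM _ _] := act_pmp; rewrite /move /=; congr (_, _).
rewrite -actM -(tame_cocycle tameE (n := n) (y := y))//.
by have [+ _ _] := tame_equiv tameE n; exact.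
Qed.

Lemma measurable_lift_secsum n (f : (X * Y) * Y -> \bar R) :
  measurable_fun setT f -> measurable_fun setT (secsum (@lift X Y (En n)) f).
Proof.
move=> mf; have [M hM] := lift_bounded n.
exact: (measurable_secsum sieveY (prod_sieve sieveX sieveY) (measurable_lift n) hM).
Qed.

Lemma class_cardE n y : (kn n y)%:E = secsum (En n) (fun=> 1%E) y.
Proof.
by rewrite /secsum fsum_cst ?mule1//; have [M hM] := tame_bounded tameE n; exact: (finite_sec y hM).
Qed.

Lemma measurable_kn n : measurable_fun setT (kn n).
Proof.
apply/measurable_EFinP; rewrite (_ : EFin \o kn n = secsum (En n) (fun=> 1%E)); last first.
  by apply/funext => y; rewrite /= class_cardE.
have [M hM] := tame_bounded tameE n.
by apply: (measurable_secsum sieveY sieveY (tame_measurable tameE n) hM); exact: measurable_cst.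
Qed.

Lemma kn_gt0 n y : 0 < kn n y.
Proof. by rewrite ltr0n class_card_gt0. Qed.

Lemma measurable_class_card n j : measurable [set y | class_card (En n) y = j].
Proof.
rewrite (_ : [set _ | _] = [set y | [set j%:R] (kn n y)]).
  exact: (measurable_preimageT (measurable_kn n) (measurable_set1 _)).
by apply/seteqP; split=> y /=; [move=> <-|move=> /eqP; rewrite eqr_nat => /eqP].
Qed.

Lemma measurable_kn_inv n : measurable_fun setT (fun p : X * Y => ((kn n p.2)^-1)%:E).
Proof.
apply/measurable_EFinP; apply: (measurableT_comp (f := fun y => (kn n y)^-1)); last exact: measurable_snd.
move=> _ B mB; rewrite setTI (_ : _ @^-1` _ =
    \bigcup_(j in [set j | B (j%:R^-1)]) [set y | class_card (En n) y = j]).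
  by apply: bigcup_measurable => j _; exact: measurable_class_card.
apply/seteqP; split=> y; first by move=> By; exists (class_card (En n) y).
by move=> [j Bj /= yj]; rewrite /kn yj.
Qed.

Lemma avg_ge0 n (f : X * Y -> \bar R) p : (forall p, 0 <= f p)%E -> (0 <= avg act alpha (En n) f p)%E.
Proof.
move=> f0; apply: mule_ge0; first by apply: secsum_ge0 => q; exact: f0.
by rewrite lee_fin invr_ge0 ltW// kn_gt0.
Qed.

Lemma measurable_avg n (f : X * Y -> \bar R) : measurable_fun setT f ->
  measurable_fun setT (avg act alpha (En n) f).
Proof.
move=> mf; apply: emeasurable_funM; last exact: measurable_kn_inv.
apply: measurable_lift_secsum; apply: (measurableT_comp mf); exact: measurable_move.
Qed.

Lemma avg_invariant n m (f : X * Y -> \bar R) x y z : (n <= m)%N -> En n (y, z) ->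
  avg act alpha (En m) f (mv ((x, y), z)) = avg act alpha (En m) f (x, y).
Proof.
move=> nm yz; have yz' := tame_le tameE nm yz.
rewrite /avg /= (class_card_eq yz'); congr (_ * _)%E; rewrite /secsum.
rewrite (_ : sec _ (mv (x, y, z)) = sec (@lift X Y (En m)) (x, y)); last exact: class_eq yz'.
by apply: eq_fsbigr => w /set_mem yw; rewrite /comp -(move_move x yz' yw).
Qed.

(** Mass transport on Y, the action being measure preserving on X. *)
Lemma integral_secsum_move n (f : X * Y -> \bar R) :
  measurable_fun setT f -> (forall p, 0 <= f p)%E ->
  (\int[mu]_p secsum (@lift X Y (En n)) (f \o mv) p =
   \int[mu]_p ((kn n p.2)%:E * f p))%E.
Proof.
move=> mf f0.
have mfv : measurable_fun setT (f \o mv) by exact: (measurableT_comp mf measurable_move).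
have [M hM] := tame_bounded tameE n.
have [refl sym tr] := tame_equiv tameE n.
pose phi z := (\int[lam]_x f (x, z))%E.
have mphi : measurable_fun setT phi by exact: (measurable_fun_fubini_tonelli_G _ mf f0).
have phi0 z : (0 <= phi z)%E by exact: integral_ge0.
rewrite fubini_tonelli2//; first last.
- by move=> p; apply: secsum_ge0 => q; exact: f0.
- exact: measurable_lift_secsum.
rewrite fubini_tonelli2//; first last.
- by move=> p; apply: mule_ge0 => //; rewrite lee_fin ltW// kn_gt0.
- apply: emeasurable_funM => //; apply/measurable_EFinP.
  by apply: (measurableT_comp (measurable_kn n)); exact: measurable_snd.
transitivity (\int[nu]_y secsum (En n) (fun q => phi q.2) y)%E.
  apply: eq_integral => y _; rewrite /fubini_G /secsum.
  have mfz z : measurable_fun setT (fun x => (f \o mv) ((x, y), z)).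
    apply: (measurableT_comp mfv); apply: measurable_fun_pair; last exact: measurable_cst.
    exact: pair2_measurable.
  have f0z z x : setT x -> (0 <= (f \o mv) ((x, y), z))%E by move=> _; exact: f0.
  apply: (eq_trans (ge0_integral_fsum lam measurableT mfz f0z (finite_class n y))).
  apply: eq_fsbigr => z _ /=; rewrite /phi /move /=.
  have mfx : measurable_fun setT (fun x => f (x, z)).
    by apply: (measurableT_comp mf); exact: pair2_measurable.
  have mact : measurable_fun setT (act (alpha z y)) by exact: measurable_act.
  transitivity (\int[pushforward lam (act (alpha z y))]_x f (x, z))%E.
    by rewrite ge0_integral_pushforward.
  apply: eq_measure_integral => A mA _ /=; rewrite /pushforward.
  by have [_ _ _] := act_pmp; exact.
rewrite (mass_transport sieveY E_inv (tame_measurable tameE n) (@tame_sub _ _ _ _ _ _ tameE n) hM (M' := M))//.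
- apply: eq_integral => z _; transitivity ((kn n z)%:E * phi z)%E.
    rewrite /secsum (_ : sec (swap (En n)) z = cls n z); last first.
      by apply/seteqP; split=> w; exact: sym.
    by rewrite /= fsum_cst//; exact: finite_class.
  have mfx : measurable_fun setT (fun x => f (x, z)).
    by apply: (measurableT_comp mf); exact: pair2_measurable.
  rewrite /fubini_G /phi /=; apply/esym; apply: (ge0_integralZl_EFin lam measurableT _ mfx) => //.
- by move=> y; have [s sM hs] := hM y; exists s => // z /sym/hs.
- by apply: (measurableT_comp mphi); exact: measurable_snd.
Qed.

(** A class sum of f times the indicator of an invariant set divided by the class
    size is the average of f, cut down to that set. *)
Lemma integral_avg_setI n (f : X * Y -> \bar R) (B : set (X * Y)) :
  measurable_fun setT f -> (forall p, 0 <= f p)%E -> measurable B ->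
  (forall x y z, En n (y, z) -> B (x, y) <-> B (mv ((x, y), z))) ->
  (\int[mu]_(p in B) avg act alpha (En n) f p = \int[mu]_(p in B) f p)%E.
Proof.
move=> mf f0 mB Binv.
pose g p := (f p * ((\1_B p / kn n p.2)%:E))%E.
have kV0 y : 0 <= (kn n y)^-1 by rewrite invr_ge0 ltW// kn_gt0.
have mB1 : measurable_fun setT (fun p : X * Y => (\1_B p)%:E : \bar R).
  exact/measurable_EFinP/measurable_indic.
have mg : measurable_fun setT g.
  apply: emeasurable_funM => //.
  rewrite (_ : (fun _ => _) = (fun p => (\1_B p)%:E * ((kn n p.2)^-1)%:E)%E)//.
  by apply: emeasurable_funM => //; exact: measurable_kn_inv.
have g0 p : (0 <= g p)%E by rewrite /g mule_ge0// lee_fin mulr_ge0.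
have := integral_secsum_move n mg g0.
rewrite !(integral_mkcond B).
have -> : (avg act alpha (En n) f \_ B) = secsum (@lift X Y (En n)) (g \o mv).
  apply/funext => -[x y]; rewrite /patch.
  have gE z : En n (y, z) -> (g \o mv) ((x, y), z) =
      ((f \o mv) ((x, y), z) * (\1_B (x, y) / kn n y)%:E)%E.
    move=> yz; have eB : (mv ((x, y), z) \in B) = ((x, y) \in B).
      by apply/idP/idP => /set_mem h; apply/mem_set; apply/(Binv x y z yz).
    by rewrite /g /= /kn (class_card_eq yz) !indicE eB.
  rewrite /secsum; transitivity
      (\sum_(z \in cls n y) (f \o mv) ((x, y), z) * (\1_B (x, y) / kn n y)%:E)%E; last first.
    by apply: eq_fsbigr => z /set_mem yz; rewrite gE.
  rewrite -ge0_mule_fsuml; last by move=> z; exact: f0.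
  rewrite indicE; case: ifPn => Bxy; first by rewrite mul1r.
  by rewrite mul0r mule0.
move=> ->; apply: eq_integral => p _; rewrite /g /patch indicE.
case: ifPn => Bp; last by rewrite mul0r !mule0.
by rewrite mul1r muleCA -EFinM divff ?mule1// gt_eqF// kn_gt0.
Qed.

(** ** The maximal inequality and the ergodic theorem *)

Let late (f : X * Y -> \bar R) (c : R) j i : set (X * Y) :=
  \bigcup_(n in [set n | (j <= n < j + i)%N]) [set p | c%:E < avg act alpha (En n) f p]%E.

Let measurable_late f c j i : measurable_fun setT f -> measurable (late f c j i).
Proof.
move=> mf; apply: bigcup_measurable => n _.
rewrite -[X in measurable X]setTI; apply: emeasurable_fun_lt => //.
exact: measurable_avg.
Qed.

(** Split according to the last time the average exceeds c: that event is
    invariant under the relation of that time. *)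
Let maximal_inequality f (c : R) j i :
  measurable_fun setT f -> (forall p, 0 <= f p)%E -> 0 <= c ->
  (c%:E * mu (late f c j i) <= \int[mu]_(p in late f c j i) f p)%E.
Proof.
move=> mf f0 c0; elim: i j => [|i IH] j.
  rewrite (_ : late f c j 0 = set0) ?measure0 ?mule0 ?integral_set0//.
  by rewrite -subset0 => p [n /=]; rewrite addn0 => /andP[jn nj] _; have := leq_ltn_trans jn nj; rewrite ltnn.
pose B := [set p | c%:E < avg act alpha (En j) f p]%E `\` late f c j.+1 i.
have lateS : late f c j i.+1 = B `|` late f c j.+1 i.
  apply/seteqP; split=> p.
    move=> [n /= /andP[jn nji] hn]; have [h|h] := pselect (late f c j.+1 i p); [by right|left].
    split=> //; move: jn; rewrite leq_eqVlt => /predU1P[->//|jn].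
    by exfalso; apply: h; exists n => //=; rewrite jn addSnnS.
  move=> [[hp _]|[n /= /andP[jn nji] hn]]; first by exists j => //=; rewrite leqnn -addSnnS leq_addr.
  by exists n => //=; rewrite (ltnW jn) -addSnnS.
have mlate k l : measurable (late f c k l) by exact: measurable_late.
have mB : measurable B.
  apply: measurableD => //; rewrite -[X in measurable X]setTI.
  by apply: emeasurable_fun_lt => //; exact: measurable_avg.
have BL : B `&` late f c j.+1 i = set0 by rewrite -subset0 => p [[_ h]].
rewrite lateS ge0_integral_setU//; first last.
- by apply/disj_setPS; rewrite BL.
- exact: measurable_funTS.
rewrite measureU// ge0_muleDr//.
apply: leeD; last exact: IH.
have Binv x y z : En j (y, z) -> B (x, y) <-> B (mv ((x, y), z)).
  move=> yz; have avE n : (j <= n)%N ->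
      avg act alpha (En n) f (mv ((x, y), z)) = avg act alpha (En n) f (x, y).
    by move=> jn; exact: avg_invariant yz.
  have lE : late f c j.+1 i (mv ((x, y), z)) <-> late f c j.+1 i (x, y).
    by split=> -[n /= jn h]; have := avE n; case/andP: (jn) => /ltnW -> _ /(_ isT) e;
      exists n => //=; [rewrite -e|rewrite e].
  have e := avE j (leqnn j).
  split=> -[h1 h2]; split.
  - by rewrite /= e.
  - by move=> h; apply: h2; exact/lE.
  - by rewrite /= -e.
  - by move=> h; apply: h2; exact/lE.
rewrite -(integral_avg_setI (n := j) mf f0 mB Binv).
apply: (@le_trans _ _ (\int[mu]_(p in B) c%:E)%E); first by rewrite integral_cst.
apply: ge0_le_integral => //.
  by apply: measurable_funTS; exact: measurable_avg.
by move=> p [/ltW].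
Qed.

(** Ergodicity of the union of the extended relations of the En n. *)
Definition invariant_dichotomy : Prop := forall A : set (X * Y), measurable A ->
  (forall n x y z, En n (y, z) -> A (x, y) <-> A (mv ((x, y), z))) ->
  mu A = 0%E \/ mu A = 1%E.

Hypothesis ergodicE : invariant_dichotomy.

(** The set where the averages exceed c infinitely often is invariant; if it had
    measure 1, the maximal inequality would give an integral of at least c. *)
Lemma ergodic_upper f (c : R) :
  measurable_fun setT f -> (forall p, 0 <= f p)%E -> (\int[mu]_p f p < c%:E)%E ->
  {ae mu, forall p, exists N, forall n, (N <= n)%N -> (avg act alpha (En n) f p <= c%:E)%E}.
Proof.
move=> mf f0 fc.
have c0 : 0 < c by rewrite -lte_fin (le_lt_trans _ fc)//; exact: integral_ge0.
pose B := \bigcap_N \bigcup_(n in [set n | (N <= n)%N]) [set p | c%:E < avg act alpha (En n) f p]%E.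
have mgt n : measurable [set p | c%:E < avg act alpha (En n) f p]%E.
  rewrite -[X in measurable X]setTI; apply: emeasurable_fun_lt => //; exact: measurable_avg.
have mB : measurable B.
  by apply: bigcapT_measurable => N; apply: bigcup_measurable => n _; exact: mgt.
have muB0 : mu B = 0%E.
  have [|//|B1] := ergodicE mB.
    move=> m x y z yz.
    have avE n : (m <= n)%N ->
        avg act alpha (En n) f (mv ((x, y), z)) = avg act alpha (En n) f (x, y).
      by move=> jn; exact: avg_invariant yz.
    split=> h N _; have [n /= Nn hn] := h (maxn N m) I; exists n => /=;
      move: Nn; rewrite geq_max => /andP[Nn mn] //; move: hn; by rewrite avE.
  exfalso; move: fc; apply/negP; rewrite -leNgt.
  have hL i : (c%:E * mu (late f c 0 i) <= \int[mu]_p f p)%E.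
    apply: (le_trans (maximal_inequality 0%N i mf f0 (ltW c0))).
    by apply: ge0_subset_integral => //; exact: measurable_late.
  have ndL : nondecreasing_seq (late f c 0).
    move=> i i' ii'; apply/subsetPset => p [n /= ni hn]; exists n => //=.
    by move: ni; rewrite !add0n => /leq_trans; apply.
  have cvL : mu (late f c 0 i) @[i --> \oo] --> mu (\bigcup_i late f c 0 i).
    apply: nondecreasing_cvg_mu => //; first by move=> i; exact: measurable_late.
    by apply: bigcupT_measurable => i; exact: measurable_late.
  have le1 : (1 <= mu (\bigcup_i late f c 0 i))%E.
    rewrite -B1; apply: le_measure; rewrite ?inE//.
      by apply: bigcupT_measurable => i; exact: measurable_late.
    by move=> p /(_ 0%N I)[n _ hn]; exists n.+1 => //; exists n => //=.
  apply: (@le_trans _ _ (c%:E * mu (\bigcup_i late f c 0 i))%E).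
    by rewrite -[leLHS]mule1 lee_pmul2l// lte_fin.
  have cvc : (c%:E * mu (late f c 0 i))%E @[i --> \oo] --> (c%:E * mu (\bigcup_i late f c 0 i))%E.
    exact: cvgeZl.
  rewrite -(cvg_lim _ cvc)//; apply: lime_le; first by apply/cvg_ex; eexists; exact: cvc.
  by near=> i; exact: hL.
exists B; split=> // p /= h N _; apply: contrapT => h'; apply: h; exists N => n Nn.
rewrite leNgt; apply/negP => hn; apply: h'; by exists n.
Unshelve. all: by end_near.
Qed.

Lemma avg_add n (f g : X * Y -> \bar R) p :
  (forall p, 0 <= f p)%E -> (forall p, 0 <= g p)%E ->
  (avg act alpha (En n) (fun p => f p + g p) p =
   avg act alpha (En n) f p + avg act alpha (En n) g p)%E.
Proof.
move=> f0 g0; rewrite /avg -ge0_muleDl.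
- by congr (_ * _)%E; apply: fsbig_split; exact: (finite_class n p.2).
- by apply: secsum_ge0 => q; exact: f0.
- by apply: secsum_ge0 => q; exact: g0.
Qed.

Lemma avg_cst n (c : R) p : avg act alpha (En n) (fun=> c%:E) p = c%:E.
Proof.
rewrite /avg /secsum /= fsum_cst; last exact: (finite_class n p.2).
have k0 : kn n p.2 != 0 by rewrite gt_eqF// kn_gt0.
transitivity (kn n p.2 * c * (kn n p.2)^-1)%:E => //.
by rewrite mulrAC divff// mul1r.
Qed.

Lemma avg_le n (f g : X * Y -> \bar R) p : (forall p, f p <= g p)%E ->
  (avg act alpha (En n) f p <= avg act alpha (En n) g p)%E.
Proof.
move=> fg; rewrite /avg; apply: lee_wpmul2r.
  by rewrite lee_fin invr_ge0 ltW// kn_gt0.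
rewrite /secsum; apply: lee_fsum; first exact: (finite_class n p.2).
by move=> z _; exact: fg.
Qed.

Lemma mu_setT : mu setT = 1%E.
Proof.
rewrite -setXTT product_measure1E//.
rewrite -[X in (X * _)%E]/(lam setT) -[X in (_ * X)%E]/(nu setT).
by rewrite !probability_setT mule1.
Qed.

(** Apply the upper bound to M - h for a bounded simple function h below f. *)
Lemma ergodic_lower f (c : R) :
  measurable_fun setT f -> (forall p, 0 <= f p)%E -> (c%:E < \int[mu]_p f p)%E ->
  {ae mu, forall p, exists N, forall n, (N <= n)%N -> (c%:E <= avg act alpha (En n) f p)%E}.
Proof.
move=> mf f0; rewrite ge0_integralTE// => /ereal_sup_gt[_ [h hf <-]].
rewrite -integralT_nnsfun => ch.
have [M [_ hM]] : bounded_fun (h : X * Y -> R) by exact: simple_bounded.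
have {}hM p : h p <= M + 1 by apply: (le_trans (ler_norm _)); apply: hM => //; rewrite ltrDl.
set M1 := M + 1 in hM.
pose g p : \bar R := (M1 - h p)%:E.
have h0 p : (0 <= (h p)%:E)%E by rewrite lee_fin.
have mh : measurable_fun setT (EFin \o h) by exact/measurable_EFinP.
have mg : measurable_fun setT g.
  by apply/measurable_EFinP; apply: measurable_funB => //; exact: measurable_cst.
have g0 p : (0 <= g p)%E by rewrite lee_fin subr_ge0.
have gh : ((\int[mu]_p g p) + \int[mu]_p (h p)%:E = M1%:E)%E.
  rewrite -ge0_integralD//.
  under eq_integral do rewrite -EFinD subrK.
  by rewrite integral_cst// [X in (_ * X)%E]mu_setT mule1.
have fg : (\int[mu]_p g p)%E \is a fin_num.
  by rewrite ge0_fin_numE ?integral_ge0// (le_lt_trans _ (ltry M1))// -gh leeDl// integral_ge0.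
have gc : (\int[mu]_p g p < (M1 - c)%:E)%E.
  by rewrite EFinB lteBrDr// -gh lteD2lE.
apply: filterS (ergodic_upper mg g0 gc) => p [N hN]; exists N => n /hN gn.
apply: (@le_trans _ _ (avg act alpha (En n) (EFin \o h) p)); last exact: avg_le.
have := avg_add n p g0 h0; rewrite (_ : (fun _ => _) = fun=> M1%:E); last first.
  by apply/funext => q; rewrite -EFinD subrK.
rewrite avg_cst => e.
have ha0 : (0 <= avg act alpha (En n) (EFin \o h) p)%E by exact: avg_ge0.
have ga0 : (0 <= avg act alpha (En n) g p)%E by exact: avg_ge0.
move: gn e ga0 ha0; rewrite -/(EFin \o h).
case: (avg _ _ _ g p) => [r| |]//; case: (avg _ _ _ _ p) => [r'| |]//.
by rewrite !lee_fin -EFinD => rc [] e _ _; lra.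
Qed.

End averages.

(** * Names along orbits and their information *)

(** The cell of x in the join, over z in S, of the partitions into blocks pulled
    back by alpha z y. *)
Definition name_cell (G : groupType) X Y (act : G -> X -> X) (blk : X -> set X)
    (alpha : Y -> Y -> G) (S : set Y) (y : Y) (x : X) : set X :=
  [set x' | forall z, S z -> blk (act (alpha z y) x) (act (alpha z y) x')].

(** The orbit points on whose blocks cond_info is conditioned. *)
Definition past Y (lt : Y -> Y -> Prop) (E : set (Y * Y)) (y : Y) : set Y :=
  [set z | E (y, z) /\ lt z y].

Definition cond_info (R : realType) (G : groupType) d (X : measurableType d) Y
    (lam : probability X R) (act : G -> X -> X) blk (lt : Y -> Y -> Prop)
    (alpha : Y -> Y -> G) (E : set (Y * Y)) (p : X * Y) : R :=
  - ln (condprob lam (name_cell act blk alpha (past lt E p.2) p.2 p.1) (blk p.1)).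

Definition orbit_info (R : realType) (G : groupType) d (X : measurableType d) Y
    (lam : probability X R) (act : G -> X -> X) blk
    (alpha : Y -> Y -> G) (E : set (Y * Y)) (p : X * Y) : R :=
  - ln (fine (lam (name_cell act blk alpha (rel_class E p.2) p.2 p.1))).

Lemma ae_block_pos (R : realType) d (T : measurableType d) (lam : probability T R) b :
  finite_block_map b -> {ae lam, forall x, lam (b x) != 0%E}.
Proof.
move=> [bxx beq bm bfin].
have h : {ae lam, forall x, forall A, range b A -> lam A = 0%E -> ~ A x}.
  apply: ae_forall_countable; first exact: finite_set_countable.
  move=> _ [x _ <-]; have [l0|l0] := eqVneq (lam (b x)) 0%E.
    by exists (b x); split=> // z /= /not_implyP[_] /contrapT.
  by apply: aeW => z /eqP; rewrite (negbTE l0).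
apply: filterS h => x h; apply/eqP => l0; apply: (h (b x)) => //; by exists x.
Qed.

Lemma ae_fubini (R : realType) d d' (X : measurableType d) (Y : measurableType d')
    (lam : probability X R) (nu : probability Y R) (A : set (X * Y)) :
  measurable A -> {ae nu, forall y, {ae lam, forall x, A (x, y)}} ->
  {ae (lam \x nu)%E, forall p, A p}.
Proof.
move=> mA hA; exists (~` A); split=> //; first exact: measurableC.
have m1 : measurable_fun setT (fun p : X * Y => (\1_(~` A) p)%:E : \bar R).
  by apply/measurable_EFinP/measurable_indic; exact: measurableC.
transitivity (\int[(lam \x nu)%E]_p (\1_(~` A) p)%:E)%E.
  by rewrite integral_indic ?setIT//; exact: measurableC.
rewrite fubini_tonelli2//.
transitivity (\int[nu]_y (cst 0 y : \bar R))%E; last by rewrite integral_cst// mul0e.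
apply: ge0_ae_eq_integral => //.
- exact: measurable_fun_fubini_tonelli_G.
- by move=> y _; apply: integral_ge0 => x _; rewrite lee_fin.
apply: filterS hA => y [N [mN N0 hN]] _; rewrite /fubini_G.
transitivity (\int[lam]_x (cst 0 x : \bar R))%E; last by rewrite integral_cst// mul0e.
apply: ge0_ae_eq_integral => //.
- by apply: (measurableT_comp m1); exact: pair2_measurable.
exists N; split=> // x /= /not_implyP[_ h]; apply: hN => /= Axy; apply: h.
by rewrite indicE memNset//; exact.
Qed.

Lemma finite_max d (Z : measurableType d) (C : nat -> nat -> set Z) (D : set Z) :
  finite_set D -> D !=set0 ->
  exists2 m, D m & forall z, D z -> ~ sieve_lt C m z.
Proof.
move=> fD [z0 Dz0].
(* D is a section over the one-point space. *)
pose A : set (unit * Z) := [set p | D p.2].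
have hA : sections_le (size (fset_set D : seq Z)) A.
  by move=> t; exists (fset_set D : seq Z) => // z Dz; rewrite in_fset_set// inE.
have [z [Dz nz]] : proj1 (A `\` nonmax (sieve_lt C) A) tt.
  by rewrite -(proj1_max C hA); exists z0.
exists z => // w Dw zw; apply: nz; split=> //; by exists w.
Qed.

Section names.
Context (R : realType) (G : groupType) dX (X : measurableType dX)
  dY (Y : measurableType dY).
Hypothesis countG : countable [set: G].
Variables (FX : set (set X)) (CX : nat -> nat -> set X).
Variables (FY : set (set Y)) (CY : nat -> nat -> set Y).
Hypotheses (sieveX : complete_sieve FX CX) (sieveY : complete_sieve FY CY).
Variables (lam : probability X R) (act : G -> X -> X).
Hypothesis act_pmp : pmp_action lam act.
Variable blk : X -> set X.
Hypothesis blkP : finite_block_map blk.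

Local Notation name := (name_cell act blk).
Implicit Types (alpha : Y -> Y -> G) (S : set Y) (x : X) (y : Y).

Let mact g : measurable_fun setT (act g).
Proof. by have [_ _ + _] := act_pmp; exact. Qed.

Lemma name_refl alpha S y x : name alpha S y x x.
Proof. by move=> z _; have [+ _ _ _] := blkP; exact. Qed.

Lemma name_eq alpha S y x x' : name alpha S y x x' ->
  name alpha S y x' = name alpha S y x.
Proof.
have [_ beq _ _] := blkP.
move=> h; apply/seteqP; split=> w hw z Sz; have := hw z Sz; by rewrite (beq _ _ (h z Sz)).
Qed.

Lemma nameS alpha S S' y x : S `<=` S' -> name alpha S' y x `<=` name alpha S y x.
Proof. by move=> SS' w hw z /SS'; exact: hw. Qed.

Lemma name_setU alpha S S' y x :
  name alpha (S `|` S') y x = name alpha S y x `&` name alpha S' y x.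
Proof.
apply/seteqP; split=> w; first by move=> h; split=> z Sz; apply: h; [left|right].
by move=> [h h'] z [/h|/h'].
Qed.

Lemma name_set1 alpha z y x :
  name alpha [set z] y x = act (alpha z y) @^-1` blk (act (alpha z y) x).
Proof. by apply/seteqP; split=> w; [apply|move=> h _ ->]. Qed.

Lemma name_finite_block alpha S y : finite_set S ->
  finite_block_map (name alpha S y).
Proof.
have [_ beq bm bfin] := blkP.
move=> /finite_seqP[s ->]; split; [exact: name_refl|exact: name_eq| |].
  move=> x; elim: s => [|z s IH].
    by rewrite (_ : name _ _ _ _ = setT)//; apply/seteqP; split=> // w _ z.
  rewrite (_ : [set` z :: s] = [set z] `|` [set` s]); last first.
    by apply/seteqP; split=> w /=; rewrite inE; [move=> /orP[/eqP|]; [left|right]|move=> [->|->]; rewrite ?eqxx ?orbT].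
  rewrite name_setU name_set1; apply: measurableI => //.
  by rewrite -[X in measurable X]setTI; exact: mact.
elim: s => [|z s IH].
  apply: (sub_finite_set (B := [set setT])) => // _ [x _ <-] /=.
  by apply/seteqP; split=> // w _ z.
rewrite (_ : [set` z :: s] = [set z] `|` [set` s]); last first.
  by apply/seteqP; split=> w /=; rewrite inE; [move=> /orP[/eqP|]; [left|right]|move=> [->|->]; rewrite ?eqxx ?orbT].
apply: (sub_finite_set (B := [set A `&` B | A in [set act (alpha z y) @^-1` D | D in range blk]
                                         & B in range (name alpha [set` s] y)])).
  move=> _ [x _ <-]; rewrite name_setU name_set1.
  exists (act (alpha z y) @^-1` blk (act (alpha z y) x)).
    by exists (blk (act (alpha z y) x)) => //; exists (act (alpha z y) x).
  by exists (name alpha [set` s] y x) => //; exists x.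
by apply: finite_image2 => //; exact: finite_image.
Qed.

(** The pairs of points that some z in D tells apart form the projection of a set
    with bounded sections. *)
Lemma measurable_name_measure alpha (D : set ((X * Y) * Y)) M :
  (forall g, measurable [set p : Y * Y | alpha p.1 p.2 = g]) ->
  measurable D -> sections_le M D ->
  measurable_fun setT (fun p : X * Y => lam (name alpha (sec D p) p.2 p.1)).
Proof.
move=> malpha mD hD; have [bxx beq bm bfin] := blkP.
pose B : set (((X * Y) * X) * Y) := [set q | D (q.1.1, q.2) /\
  ~ blk (act (alpha q.2 q.1.1.2) q.1.1.1) (act (alpha q.2 q.1.1.2) q.1.2)].
have mB : measurable B.
  have m1 : measurable_fun setT (fun q : ((X * Y) * X) * Y => (q.1.1, q.2)).
    apply: measurable_fun_pair; last exact: measurable_snd.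
    exact: (measurableT_comp measurable_fst measurable_fst).
  apply: measurableI; first exact: (measurable_preimageT m1 mD).
  pose K : set (((X * Y) * X) * Y) :=
    [set q | blk (act (alpha q.2 q.1.1.2) q.1.1.1) (act (alpha q.2 q.1.1.2) q.1.2)].
  suff mK : measurable K by exact: (measurableC mK).
  have -> : K = \bigcup_g ([set q | alpha q.2 q.1.1.2 = g] `&` \bigcup_(A in range blk)
      ([set q | A (act g q.1.1.1)] `&` [set q | A (act g q.1.2)])).
    apply/seteqP; split=> q /=.
      move=> h; exists (alpha q.2 q.1.1.2) => //; split=> //.
      by exists (blk (act (alpha q.2 q.1.1.2) q.1.1.1)); [exists (act (alpha q.2 q.1.1.2) q.1.1.1)|split].
    move=> [g _ [<- [_ [x _ <-] [h1 h2]]]].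
    by rewrite /K /= (beq _ _ h1).
  apply: countable_bigcupT_measurable => // g; apply: measurableI.
    have m2 : measurable_fun setT (fun q : ((X * Y) * X) * Y => (q.2, q.1.1.2)).
      apply: measurable_fun_pair; first exact: measurable_snd.
      apply: (measurableT_comp measurable_snd).
      exact: (measurableT_comp measurable_fst measurable_fst).
    exact: (measurable_preimageT m2 (malpha g)).
  apply: fin_bigcup_measurable => // _ [x _ <-]; apply: measurableI.
    have m3 : measurable_fun setT (fun q : ((X * Y) * X) * Y => act g q.1.1.1).
      apply: (measurableT_comp (mact g)); apply: (measurableT_comp measurable_fst).
      exact: (measurableT_comp measurable_fst measurable_fst).
    exact: (measurable_preimageT m3 (bm x)).
  have m3 : measurable_fun setT (fun q : ((X * Y) * X) * Y => act g q.1.2).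
    apply: (measurableT_comp (mact g)).
    exact: (measurableT_comp measurable_snd measurable_fst).
  exact: (measurable_preimageT m3 (bm x)).
have hB : sections_le M B.
  by move=> [p x']; have [s sM hs] := hD p; exists s => // z [/hs].
have [mp _] := measurable_proj1_nonmax sieveY (prod_sieve (prod_sieve sieveX sieveY) sieveX) mB hB.
have := @measurable_fun_xsection _ _ _ _ _ lam _ (measurableC mp).
apply: eq_measurable_fun => p _; congr (lam _); apply/seteqP; split=> x'.
  rewrite /xsection /= inE => h z Dz; apply: contrapT => nb; apply: h.
  by exists z; split.
by rewrite /xsection /= inE => h [z [Dz]]; apply; exact: h.
Qed.

End names.

(** * The chain rule and the convergence of conditional information *)

Section information.
Context (R : realType) (G : groupType) dX (X : measurableType dX)
  dY (Y : measurableType dY).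
Hypothesis countG : countable [set: G].
Variables (FX : set (set X)) (CX : nat -> nat -> set X).
Variables (FY : set (set Y)) (CY : nat -> nat -> set Y).
Hypotheses (sieveX : complete_sieve FX CX) (sieveY : complete_sieve FY CY).
Variables (lam : probability X R) (act : G -> X -> X).
Hypothesis act_pmp : pmp_action lam act.
Variable E : set (Y * Y).
Variable blk : X -> set X.
Hypothesis blkP : finite_block_map blk.

Local Notation lt := (sieve_lt CY).
Local Notation name := (name_cell act blk).
Implicit Types (alpha : Y -> Y -> G) (S : set Y) (x : X) (y : Y) (n : nat).
Implicit Types (En : nat -> set (Y * Y)).

Lemma past_finite alpha En n y : tame E En alpha -> finite_set (past lt (En n) y).
Proof. by move=> tE; apply: (sub_finite_set (B := rel_class (En n) y)) => [z []//|]; exact: (finite_class tE). Qed.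

Lemma filtration_past alpha En y : tame E En alpha ->
  filtration (fun n x => name alpha (past lt (En n) y) y x).
Proof.
move=> tE; split.
- by move=> n x; exact: name_refl.
- by move=> n x x'; exact: name_eq.
- by move=> n m x nm; apply: nameS => z [yz zy]; split=> //; exact: (tame_le tE nm).
- by move=> n x; have [_ _ + _] := name_finite_block act_pmp blkP alpha y (past_finite n y tE); exact.
- by move=> n; have [] := name_finite_block act_pmp blkP alpha y (past_finite n y tE).
Qed.

Lemma name_self alpha En n x y : tame E En alpha ->
  name alpha [set y] y x = blk x.
Proof.
move=> tE; have [refl _ _] := tame_equiv tE n; have [act1 _ _ _] := act_pmp.
rewrite name_set1 (cocycle1 tE (refl y)) act1.
by apply/seteqP; split=> w /=; rewrite act1.
Qed.

Lemma name_self_past alpha En n x y : tame E En alpha ->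
  name alpha (past lt (En n) y `|` [set y]) y x = name alpha (past lt (En n) y) y x `&` blk x.
Proof. by move=> tE; rewrite name_setU (name_self n x y tE). Qed.

Lemma measurable_name_past alpha En n : tame E En alpha ->
  measurable_fun setT (fun p : X * Y => lam (name alpha (past lt (En n) p.2) p.2 p.1)) /\
  measurable_fun setT (fun p : X * Y => lam (name alpha (past lt (En n) p.2) p.2 p.1 `&` blk p.1)).
Proof.
move=> tE; have [M hM] := lift_bounded X tE n.
have mzy : measurable [set q : (X * Y) * Y | lt q.2 q.1.2].
  have m1 : measurable_fun setT (fun q : (X * Y) * Y => (q.2, q.1.2)).
    apply: measurable_fun_pair; first exact: measurable_snd.
    exact: (measurableT_comp measurable_snd measurable_fst).
  exact: (measurable_preimageT m1 (measurable_sieve_lt sieveY)).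
have myz : measurable [set q : (X * Y) * Y | lt q.1.2 q.2].
  have m1 : measurable_fun setT (fun q : (X * Y) * Y => (q.1.2, q.2)).
    apply: measurable_fun_pair; last exact: measurable_snd.
    exact: (measurableT_comp measurable_snd measurable_fst).
  exact: (measurable_preimageT m1 (measurable_sieve_lt sieveY)).
have mL := @measurable_lift _ _ X _ _ _ _ _ tE n.
split.
  pose D := @lift X Y (En n) `&` [set q | lt q.2 q.1.2].
  have h := measurable_name_measure countG sieveX sieveY act_pmp blkP (D := D) (M := M) (tame_alpha tE).
  apply: eq_measurable_fun (h _ _) => //; first exact: measurableI.
  by apply: sections_le_sub hM => q [].
pose D := @lift X Y (En n) `\` [set q | lt q.1.2 q.2].
have := measurable_name_measure countG sieveX sieveY act_pmp blkP (D := D) (M := M) (tame_alpha tE).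
move=> h; apply: eq_measurable_fun (h _ _).
- move=> [x y] _ /=; congr (lam _); rewrite -(name_self_past n x y tE); congr name_cell.
  have [refl _ _] := tame_equiv tE n.
  apply/seteqP; split=> z /=.
    move=> [yz nlt]; have [->|zy] := pselect (z = y); [by right|left].
    by split=> //; have [|] := sieve_lt_total sieveY zy.
  move=> [[yz zy]|->]; split=> //.
  - by move=> yz'; exact: (sieve_lt_irr (sieve_lt_trans yz' zy)).
  - exact: sieve_lt_irr.
- exact: measurableD.
- by apply: sections_le_sub hM => q [].
Qed.

Lemma measurable_cond_info alpha En n : tame E En alpha ->
  measurable_fun setT (cond_info lam act blk lt alpha (En n)).
Proof.
move=> tE; have [m1 m2] := measurable_name_past n tE.
have mf1 : measurable_fun setT (fun p : X * Y => fine (lam (name alpha (past lt (En n) p.2) p.2 p.1))).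
  exact: measurableT_comp m1.
have mf2 : measurable_fun setT (fun p : X * Y => fine (lam (name alpha (past lt (En n) p.2) p.2 p.1 `&` blk p.1))).
  exact: measurableT_comp m2.
set f1 := (fun p => _) in mf1; set f2 := (fun p => _) in mf2.
(* The quotient is a product with an exponential of a logarithm, also where the
   denominator vanishes, as the numerator vanishes there too. *)
rewrite (_ : cond_info _ _ _ _ _ _ = (fun p => - ln (f2 p * expR (- ln (f1 p))))).
  apply: measurable_funN; apply: (measurableT_comp (@measurable_ln R)).
  apply: measurable_funM => //; apply: (measurableT_comp (@measurable_expR R)).
  by apply: measurable_funN; exact: (measurableT_comp (@measurable_ln R)).
apply/funext => p; rewrite /cond_info /condprob -/(f1 p) -/(f2 p); congr (- ln _).
have f10 : 0 <= f1 p by exact: fine_ge0.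
have [f1z|f1n0] := eqVneq (f1 p) 0; last by rewrite expRN lnK// posrE lt0r f1n0.
have [_ beq bm _] := blkP.
have mQ : measurable (name alpha (past lt (En n) p.2) p.2 p.1).
  exact: (cell_measurable (filtration_past p.2 tE)).
have f20 : f2 p <= f1 p.
  apply: fine_le; rewrite ?fin_num_measure//; first exact: measurableI.
  by apply: le_measure; rewrite ?inE//; exact: measurableI.
have f2z : f2 p = 0 by apply/eqP; rewrite eq_le -{1}f1z f20 fine_ge0.
by rewrite f2z !mul0r.
Qed.

(** Telescoping along the order of the class: removing its largest point m from
    a set of orbit points that is closed downwards leaves the past of m. *)
Lemma chain_rule alpha En n x y : tame E En alpha ->
  lam (name alpha (rel_class (En n) y) y x) != 0%E ->
  orbit_info lam act blk alpha (En n) (x, y) =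
  \sum_(z \in rel_class (En n) y) cond_info lam act blk lt alpha (En n) (move act alpha ((x, y), z)).
Proof.
move=> tE pos; have [refl sym tr] := tame_equiv tE n.
pose cls := rel_class (En n) y.
have fin D : D `<=` cls -> finite_set D.
  by move=> h; apply: sub_finite_set h _; exact: (finite_class tE).
have mname D : D `<=` cls -> measurable (name alpha D y x).
  by move=> /fin fD; have [_ _ + _] := name_finite_block act_pmp blkP alpha y fD; exact.
have posD D : D `<=` cls -> 0 < fine (lam (name alpha D y x)).
  move=> Dc; apply: fine_gt0; apply/andP; split; last first.
    by rewrite ltey_eq fin_num_measure//; exact: mname.
  rewrite lt0e measure_ge0 andbT; apply: contra pos => /eqP l0.
  rewrite eq_le measure_ge0 andbT -l0; apply: le_measure; rewrite ?inE; try exact: mname.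
  exact: nameS.
suff main k D : #|` fset_set D| = k -> D `<=` cls ->
    (forall z z', D z -> cls z' -> lt z' z -> D z') ->
    - ln (fine (lam (name alpha D y x))) =
    \sum_(z \in D) cond_info lam act blk lt alpha (En n) (move act alpha ((x, y), z)).
  by apply: (main _ cls erefl) => // z z'.
elim: k D => [|k IH] D cardD Dc down.
  have D0 : D = set0.
    rewrite -subset0 => z Dz; have : z \in fset_set D by rewrite in_fset_set ?inE//; exact: fin.
    by rewrite (cardfs0_eq cardD) inE.
  rewrite D0 fsbig_set0 (_ : name _ _ _ _ = setT); last by apply/seteqP; split=> // w _ z.
  by rewrite probability_setT ln1 oppr0.
have [m Dm mmax] : exists2 m, D m & forall z, D z -> ~ lt m z.
  apply: finite_max; first exact: fin.
  apply/set0P/eqP => D0; move: cardD; by rewrite D0 fset_set0 cardfs0.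
have ym : En n (y, m) := Dc _ Dm.
have pastm : past lt (En n) m = D `\ m.
  apply/seteqP; split=> z [].
    move=> mz zm; split; first by apply: (down m) => //; exact: tr mz.
    by move=> zm'; move: zm; rewrite zm'; exact: sieve_lt_irr.
  move=> Dz zm; split; first exact: tr (sym _ _ ym) (Dc _ Dz).
  by have [//|/mmax] := sieve_lt_total sieveY zm.
have D'c : D `\ m `<=` cls by move=> z [/Dc].
rewrite (fsbigD1 m)//=; last exact: fin.
rewrite -(IH (D `\ m))//; first last.
- move=> z z' [Dz zm] cz' z'z; split; first exact: down z'z.
  by move=> z'm; move: z'z; rewrite z'm; exact: mmax.
- have := cardfsD1 m (fset_set D); rewrite in_fset_set ?mem_set//; last exact: fin.
  rewrite cardD => -[->]; congr #|` _ |; apply/fsetP => z.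
  rewrite in_fset_set; last exact: fin.
  rewrite in_fsetD1 in_fset_set; last exact: fin.
  by apply/idP/andP; rewrite !inE; [move=> [? /eqP]|move=> [/eqP ? ?]].
have infoE : cond_info lam act blk lt alpha (En n) (move act alpha ((x, y), m)) =
    ln (fine (lam (name alpha (D `\ m) y x))) - ln (fine (lam (name alpha D y x))).
  have DE : D = (D `\ m) `|` [set m].
    by rewrite setUC setDUK// => z ->.
  have [act1 actM _ inv] := act_pmp.
  have coc z : cls z -> (alpha z m * alpha m y = alpha z y)%g.
    by move=> cz; rewrite -(tame_cocycle tE ym (refl y) cz).
  have e1 : act (alpha m y) @^-1` name alpha (past lt (En n) m) m (act (alpha m y) x) =
      name alpha (D `\ m) y x.
    by rewrite pastm; apply/seteqP; split=> w h z Dz; have := h z Dz;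
      rewrite -!actM !coc//; exact: D'c.
  have e2 : act (alpha m y) @^-1` (name alpha (past lt (En n) m) m (act (alpha m y) x) `&`
      blk (act (alpha m y) x)) = name alpha D y x.
    by rewrite preimage_setI e1 [in RHS]DE name_setU name_set1.
  have mQ : measurable (name alpha (past lt (En n) m) m (act (alpha m y) x)).
    by have [_ _ + _] := name_finite_block act_pmp blkP alpha m (past_finite n m tE); exact.
  have mb : measurable (blk (act (alpha m y) x)) by have [_ _ + _] := blkP; exact.
  rewrite /cond_info /condprob /move /=.
  have l1 := inv (alpha m y) _ mQ; rewrite e1 in l1.
  have l2 := inv (alpha m y) _ (measurableI _ _ mQ mb); rewrite e2 in l2.
  by rewrite -l1 -l2 ln_div ?posrE ?posD// opprB.
rewrite infoE; lra.
Qed.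

End information.

(** An upper limit, which is defined and measurable everywhere; the information
    converges almost everywhere. *)
Definition info_limit (R : realType) (G : groupType) d (X : measurableType d) Y
    (lam : probability X R) (act : G -> X -> X) blk (lt : Y -> Y -> Prop)
    (alpha : Y -> Y -> G) (En : nat -> set (Y * Y)) (p : X * Y) : \bar R :=
  limn_esup (fun n => (cond_info lam act blk lt alpha (En n) p)%:E).

Lemma cvg_EFin_comp (R : realType) (u : R^nat) (v : R) :
  u n @[n --> \oo] --> v -> (u n)%:E @[n --> \oo] --> v%:E.
Proof. by move=> h; apply: cvg_EFin => //; near=> n. Unshelve. all: by end_near. Qed.

Lemma cvge_bounds (R : realType) (a : (\bar R)^nat) (h : R) :
  a n @[n --> \oo] --> h%:E <-> forall e, 0 < e -> exists N, forall n, (N <= n)%N ->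
    ((h - e)%:E < a n < (h + e)%:E)%E.
Proof.
split.
  move=> /fine_cvgP[[N1 _ fin] /cvgrPdist_lt cv] e /cv[N2 _ hN].
  exists (maxn N1 N2) => n; rewrite geq_max => /andP[/fin /= fn /hN /=].
  by rewrite -[in X in _ -> X](fineK fn) !lte_fin ltr_distlC.
move=> hh; apply/fine_cvgP; split.
  have [N hN] := hh 1 ltr01; exists N => // n /= /hN /andP[h1 h2].
  by rewrite fin_numElt (lt_trans (ltNyr _) h1) (lt_trans h2 (ltry _)).
apply/cvgrPdist_lt => e /hh[N hN]; exists N => // n /= /hN /andP[].
case: (a n) => [r| |]//=; by rewrite !lte_fin ltr_distlC => -> ->.
Qed.

Lemma cvg_of_limits (R : realType) (u : R^nat) :
  limn_esup (EFin \o u) = limn_einf (EFin \o u) ->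
  limn_esup (EFin \o u) \is a fin_num ->
  u n @[n --> \oo] --> fine (limn_esup (EFin \o u)).
Proof.
move=> e fin.
suff h : (EFin \o u) n @[n --> \oo] --> (fine (limn_esup (EFin \o u)))%:E.
  exact: (fine_cvg h).
rewrite fineK//.
apply: (@squeeze_cvge _ _ _ _ (einfs (EFin \o u)) _ (esups (EFin \o u))).
- near=> n; apply/andP; split.
    by apply: ereal_inf_lbound; exists n => //=.
  by apply: ereal_sup_ubound; exists n => //=.
- by rewrite e limn_einf_lim; exact: is_cvg_einfs.
- by rewrite limn_esup_lim; exact: is_cvg_esups.
Unshelve. all: by end_near.
Qed.

(** The entropy of a partition is the integral of its information function. *)
Lemma integral_block_info (R : realType) d (T : measurableType d)
    (lam : probability T R) b : finite_block_map b ->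
  (\int[lam]_x (- ln (fine (lam (b x))))%:E =
   (- \sum_(A \in range b) (fine (lam A) * ln (fine (lam A))))%:E)%E.
Proof.
move=> [bxx beq bm bfin].
have mA A : range b A -> measurable A by move=> [x _ <-].
pose g A (x : T) : \bar R := ((- ln (fine (lam A))) * \1_A x)%:E.
transitivity (\int[lam]_x \sum_(A \in range b) (if A \in range b then g A x else 0))%E.
  apply: eq_integral => x _; rewrite (fsbigD1 (b x))//=; last by exists x.
  rewrite mem_set; last by exists x.
  rewrite fsbig1; last first.
    move=> _ [[x' _ <-] ne]; case: ifP => // _; rewrite /g indicE memNset ?mulr0//.
    by move=> h; apply: ne; rewrite (beq _ _ h).
  by rewrite adde0 /g indicE mem_set// mulr1.
have l1 A : range b A -> 0 <= - ln (fine (lam A)).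
  move=> /mA mA'; rewrite oppr_ge0 ln_le0// -lee_fin fineK ?fin_num_measure//.
  exact: probability_le1.
rewrite ge0_integral_fsum//; first last.
- move=> A x _; case: ifP => // /set_mem hA.
  by rewrite lee_fin mulr_ge0// l1.
- move=> A; case: (boolP (A \in range b)) => [/set_mem hA|_]; last exact: measurable_cst.
  apply/measurable_EFinP; apply: measurable_funM; first exact: measurable_cst.
  by apply: measurable_indic; exact: mA.
have -> : - \sum_(A \in range b) (fine (lam A) * ln (fine (lam A))) =
    \sum_(A \in range b) (- (fine (lam A) * ln (fine (lam A)))).
  by rewrite !fsbig_finite//= sumrN.
rewrite -fsumEFin//.
apply: eq_fsbigr => A hA; rewrite hA /g; move: hA => /set_mem hA.
under eq_integral do rewrite EFinM.
rewrite ge0_integralZl_EFin//; last exact: l1.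
  rewrite integral_indic//; last exact: mA.
  by rewrite setIT -[X in (_ * X)%E]fineK ?fin_num_measure//; [rewrite -EFinM mulNr mulrC|exact: mA].
by apply/measurable_EFinP/measurable_indic; exact: mA.
Qed.

Section limits.
Context (R : realType) (G : groupType) dX (X : measurableType dX)
  dY (Y : measurableType dY).
Hypothesis countG : countable [set: G].
Variables (FX : set (set X)) (CX : nat -> nat -> set X).
Variables (FY : set (set Y)) (CY : nat -> nat -> set Y).
Hypotheses (sieveX : complete_sieve FX CX) (sieveY : complete_sieve FY CY).
Variables (lam : probability X R) (nu : probability Y R) (act : G -> X -> X).
Hypothesis act_pmp : pmp_action lam act.
Variable E : set (Y * Y).
Hypothesis E_inv : invariant_measure nu E.
Variable blk : X -> set X.
Hypothesis blkP : finite_block_map blk.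

Local Notation mu := (lam \x nu)%E.
Local Notation lt := (sieve_lt CY).
Local Notation name := (name_cell act blk).
Implicit Types (alpha : Y -> Y -> G) (S : set Y) (x : X) (y : Y) (n : nat).
Implicit Types (En : nat -> set (Y * Y)).

Local Notation info alpha En := (cond_info lam act blk lt alpha En).

Lemma cond_info_ge0 alpha En n p : tame E En alpha -> 0 <= info alpha (En n) p.
Proof.
move=> tE; rewrite oppr_ge0 ln_le0//; apply: condprob_le1.
  exact: (cell_measurable (filtration_past CY act_pmp blkP p.2 tE) n p.1).
by have [_ _ + _] := blkP; exact.
Qed.

Let measurable_info alpha En n : tame E En alpha ->
  measurable_fun setT (EFin \o info alpha (En n)).
Proof.
by move=> tE; apply/measurable_EFinP; exact: (measurable_cond_info countG sieveX sieveY act_pmp blkP n tE).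
Qed.

Lemma ae_past_pos alpha En y : tame E En alpha ->
  {ae lam, forall x, forall n, lam (name alpha (past lt (En n) y) y x `&` blk x) != 0%E}.
Proof.
move=> tE; apply: ae_foralln => n.
have fin : finite_set (past lt (En n) y `|` [set y]).
  by rewrite finite_setU; split; [exact: (past_finite _ n y tE)|].
have := ae_block_pos lam (name_finite_block act_pmp blkP alpha y fin).
by apply: filterS => x; rewrite (name_self_past CY act_pmp blk n x y tE).
Qed.

Definition info_bound : R := 2 * (#|` fset_set (range blk)|)%:R.

Lemma integral_esups_info alpha En y : tame E En alpha ->
  (\int[lam]_x esups (fun n => (info alpha (En n) (x, y))%:E) 0%N <= info_bound%:E)%E.
Proof.
move=> tE; apply: (integral_sup_information (filtration_past CY act_pmp blkP y tE) blkP).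
- apply: measurable_fun_esups => n.
  exact: (measurableT_comp (measurable_info n tE) (@pair2_measurable _ _ X Y y)).
- move=> x; apply: (@le_trans _ _ (info alpha (En 0%N) (x, y))%:E).
    by rewrite lee_fin; exact: cond_info_ge0.
  by apply: ereal_sup_ubound; exists 0%N.
- by move=> x; apply: le_ereal_sup => _ [n _ <-]; exists n.
Qed.

Let integrable_esups alpha En y : tame E En alpha ->
  {ae lam, forall x, exists M : R, forall n, info alpha (En n) (x, y) <= M}.
Proof.
move=> tE; pose g x := esups (fun n => (info alpha (En n) (x, y))%:E) 0%N.
have g0 x : (0 <= g x)%E.
  apply: (@le_trans _ _ (info alpha (En 0%N) (x, y))%:E).
    by rewrite lee_fin; exact: cond_info_ge0.
  by apply: ereal_sup_ubound; exists 0%N.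
have mg : measurable_fun setT g.
  apply: measurable_fun_esups => n.
  exact: (measurableT_comp (measurable_info n tE) (@pair2_measurable _ _ X Y y)).
have ig : lam.-integrable setT g.
  apply/integrableP; split=> //; rewrite (eq_integral g); last first.
    by move=> x _; rewrite gee0_abs.
  exact: le_lt_trans (integral_esups_info y tE) (ltry _).
apply: filterS (integrable_ae measurableT ig) => x /(_ I) fin.
exists (fine (g x)) => n; rewrite -lee_fin fineK//.
by apply: ereal_sup_ubound; exists n.
Qed.

(** On a fixed fibre, two exhaustions of the same past give cofinal
    filtrations. *)
Lemma ae_cvg_info_at alpha1 En1 alpha2 En2 y : tame E En1 alpha1 -> tame E En2 alpha2 ->
  \bigcup_n past lt (En1 n) y = \bigcup_n past lt (En2 n) y ->
  (forall z, (\bigcup_n past lt (En1 n) y) z -> alpha1 z y = alpha2 z y) ->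
  {ae lam, forall x, exists v : R,
     info alpha1 (En1 n) (x, y) @[n --> \oo] --> v /\
     info alpha2 (En2 n) (x, y) @[n --> \oo] --> v}.
Proof.
move=> t1 t2 pastE alphaE.
have inc En alpha (D : set Y) : tame E En alpha -> finite_set D ->
    D `<=` \bigcup_n past lt (En n) y -> exists m, D `<=` past lt (En m) y.
  move=> tE /finite_seqP[s ->]; elim: s => [_|z s IH h]; first by exists 0%N.
  have [|m hm] := IH; first by move=> w ws; apply: h; rewrite /= inE ws orbT.
  have [k _ [yz zy]] : (\bigcup_n past lt (En n) y) z by apply: h; rewrite /= inE eqxx.
  exists (maxn m k) => w; rewrite /= inE => /orP[/eqP ->|/hm[yw wy]].
    by split=> //; exact: (tame_le tE (leq_maxr m k)).
  by split=> //; exact: (tame_le tE (leq_maxl m k)).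
have cof En alpha En' alpha' : tame E En alpha -> tame E En' alpha' ->
    \bigcup_n past lt (En n) y = \bigcup_n past lt (En' n) y ->
    (forall z, (\bigcup_n past lt (En n) y) z -> alpha z y = alpha' z y) ->
    cofinal (fun n x => name alpha (past lt (En n) y) y x)
            (fun n x => name alpha' (past lt (En' n) y) y x).
  move=> tE tE' pE aE n.
  have [||m hm] := inc En' alpha' (past lt (En n) y) tE'.
    exact: (past_finite _ n y tE).
    by rewrite -pE => z hz; exists n.
  exists m => x w hw z hz; rewrite aE; last by exists n.
  by apply: hw; exact: hm.
have f1 := filtration_past CY act_pmp blkP y t1.
have f2 := filtration_past CY act_pmp blkP y t2.
have c12 := cof _ _ _ _ t1 t2 pastE alphaE.
have c21 : cofinal _ _ := cof _ _ _ _ t2 t1 (esym pastE) ltac:(by rewrite -pastE => z /alphaE).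
have h1 := ae_cvg_condprob lam f1 f2 c12 c21 blkP.
have h2 := ae_past_pos y t1.
have h3 := integrable_esups y t1.
apply: filterS (filterI h1 (filterI h2 h3)) => x [[l [l1 l2]] [pos [M hM]]].
(* The information stays bounded along n, so the limit of the probabilities is
   positive and the logarithm is continuous there. *)
have lpos : 0 < l.
  apply: (@lt_le_trans _ _ (expR (- M))); first exact: expR_gt0.
  rewrite -(cvg_lim _ l1)//; apply: limr_ge; first by apply/cvg_ex; exists l.
  near=> n.
  have q0 : 0 < condprob lam (name alpha1 (past lt (En1 n) y) y x) (blk x).
    have mQ : measurable (name alpha1 (past lt (En1 n) y) y x) := cell_measurable f1 n x.
    have mb : measurable (blk x) by have [_ _ + _] := blkP; exact.
    have mQb := measurableI _ _ mQ mb.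
    have p1 : (0 < lam (name alpha1 (past lt (En1 n) y) y x `&` blk x))%E.
      by rewrite lt0e pos measure_ge0.
    have p2 : (0 < lam (name alpha1 (past lt (En1 n) y) y x))%E.
      by apply: (lt_le_trans p1); apply: le_measure; rewrite ?inE.
    by rewrite divr_gt0// fine_gt0// ?p1 ?p2 ltey_eq fin_num_measure.
  by rewrite -[leRHS]lnK// ler_expR lerNl; exact: hM.
have cln := continuous_ln lpos.
exists (- ln l); rewrite /cond_info; split; apply: cvgN.
  exact: (continuous_cvg _ cln l1).
exact: (continuous_cvg _ cln l2).
Unshelve. all: by end_near.
Qed.

Local Notation ulim := (info_limit lam act blk lt).

Let measurable_ulim alpha En : tame E En alpha -> measurable_fun setT (ulim alpha En).
Proof. by move=> tE; apply: measurable_fun_limn_esup => n; exact: measurable_info. Qed.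

Let measurable_llim alpha En : tame E En alpha ->
  measurable_fun setT (fun p : X * Y => limn_einf (fun n => (info alpha (En n) p)%:E)).
Proof.
move=> tE; rewrite (_ : (fun p => _) =
    (fun p => - limn_esup (fun n => - (info alpha (En n) p)%:E))%E).
  apply: measurableT_comp => //; apply: measurable_fun_limn_esup => n.
  by apply: measurableT_comp => //; exact: measurable_info.
apply/funext => p; have := limn_esupN (fun n => (info alpha (En n) p)%:E).
by rewrite /comp => ->; rewrite oppeK.
Qed.

Lemma ae_cvg_info alpha1 En1 alpha2 En2 : tame E En1 alpha1 -> tame E En2 alpha2 ->
  {ae nu, forall y, \bigcup_n past lt (En1 n) y = \bigcup_n past lt (En2 n) y /\
    forall z, (\bigcup_n past lt (En1 n) y) z -> alpha1 z y = alpha2 z y} ->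
  {ae mu, forall p, exists v : R,
     info alpha1 (En1 n) p @[n --> \oo] --> v /\
     info alpha2 (En2 n) p @[n --> \oo] --> v}.
Proof.
move=> t1 t2 h12.
pose low alpha En p := limn_einf (fun n => (info alpha (En n) p)%:E).
pose A : set (X * Y) := [set p | ulim alpha1 En1 p = low alpha1 En1 p] `&`
  [set p | ulim alpha2 En2 p = low alpha2 En2 p] `&`
  [set p | ulim alpha1 En1 p = ulim alpha2 En2 p] `&`
  [set p | `|ulim alpha1 En1 p| < +oo]%E.
have m1 := measurable_ulim t1; have m2 := measurable_ulim t2.
have m3 := measurable_llim t1; have m4 := measurable_llim t2.
have mA : measurable A.
  apply: measurableI; last first.
    rewrite -[X in measurable X]setTI; apply: emeasurable_fun_lt => //.
    by apply: measurableT_comp => //; exact: measurable_ulim.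
  apply: measurableI; last first.
    by rewrite -[X in measurable X]setTI; exact: measurable_eqe.
  by apply: measurableI; rewrite -[X in measurable X]setTI; exact: measurable_eqe.
suff : {ae mu, forall p, A p}.
  apply: filterS => p [[[e1 e2] e12] fin].
  have f1 : ulim alpha1 En1 p \is a fin_num by rewrite fin_num_abs.
  exists (fine (ulim alpha1 En1 p)); split; first exact: cvg_of_limits.
  by rewrite e12; apply: cvg_of_limits => //; rewrite -/(ulim _ _ _) -e12.
apply: ae_fubini => //; apply: filterS h12 => y [py ay].
apply: filterS (ae_cvg_info_at t1 t2 py ay) => x [v [v1 v2]].
have [l1 L1] := cvg_limn_einf_sup (cvg_EFin_comp v1).
have [l2 L2] := cvg_limn_einf_sup (cvg_EFin_comp v2).
by rewrite /A /= /info_limit /low L1 l1 L2 l2; do !split => //=; rewrite ltry.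
Qed.

Lemma integral_info_limit_eq alpha1 En1 alpha2 En2 : tame E En1 alpha1 -> tame E En2 alpha2 ->
  {ae nu, forall y, \bigcup_n past lt (En1 n) y = \bigcup_n past lt (En2 n) y /\
    forall z, (\bigcup_n past lt (En1 n) y) z -> alpha1 z y = alpha2 z y} ->
  (\int[mu]_p ulim alpha1 En1 p = \int[mu]_p ulim alpha2 En2 p)%E.
Proof.
move=> t1 t2 h12; apply: ae_eq_integral => //; [exact: measurable_ulim|exact: measurable_ulim|].
apply: filterS (ae_cvg_info t1 t2 h12) => p [v [v1 v2]] _.
have c1 := cvg_EFin_comp v1.
have c2 := cvg_EFin_comp v2.
by rewrite /info_limit (cvg_limn_einf_sup c1) (cvg_limn_einf_sup c2).
Qed.

Section tame_limit.
Variables (En : nat -> set (Y * Y)) (alpha : Y -> Y -> G).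
Hypothesis tE : tame E En alpha.

Let u n (p : X * Y) : \bar R := (info alpha (En n) p)%:E.

Let u0 n p : (0 <= u n p)%E.
Proof. by rewrite lee_fin; exact: cond_info_ge0. Qed.

Let mu_ n : measurable_fun setT (u n).
Proof. exact: measurable_info. Qed.

Let S N p := esups (u ^~ p) N.
Let s N p := einfs (u ^~ p) N.

Let mS N : measurable_fun setT (S N).
Proof. exact: measurable_fun_esups. Qed.

Let ms N : measurable_fun setT (s N).
Proof. exact: measurable_fun_einfs. Qed.

Let leS N n p : (N <= n)%N -> (u n p <= S N p)%E.
Proof. by move=> Nn; apply: ereal_sup_ubound; exists n. Qed.

Let les N n p : (N <= n)%N -> (s N p <= u n p)%E.
Proof. by move=> Nn; apply: ereal_inf_lbound; exists n. Qed.

Let S0 N p : (0 <= S N p)%E.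
Proof. exact: le_trans (u0 N p) (leS p (leqnn N)). Qed.

Let s0 N p : (0 <= s N p)%E.
Proof. by apply: le_ereal_inf_tmp => _ [n _ <-]; exact: u0. Qed.

Let SS N p : (S N p <= S 0%N p)%E.
Proof. by apply: ge_ereal_sup => _ [n _ <-]; exact: leS. Qed.

Let integrable_S : mu.-integrable setT (S 0%N).
Proof.
apply/integrableP; split; first exact: mS.
rewrite (eq_integral (S 0%N)); last by move=> p _; rewrite gee0_abs.
rewrite (fubini_tonelli2 _ (mS 0%N) (S0 0%N)).
apply: (@le_lt_trans _ _ (\int[nu]_y cst info_bound%:E y)%E).
  apply: ge0_le_integral => //.
  - by move=> y _; apply: integral_ge0 => x _; exact: S0.
  - exact: (measurable_fun_fubini_tonelli_G _ (mS 0%N) (S0 0%N)).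
  - by move=> y _; exact: integral_esups_info.
by rewrite integral_cst// -[X in (_ * X)%E]/(nu setT) probability_setT mule1 ltry.
Qed.

Let ae_cvg_u : {ae mu, forall p, exists v : R, u n p @[n --> \oo] --> v%:E}.
Proof.
have h : {ae nu, forall y, \bigcup_n past lt (En n) y = \bigcup_n past lt (En n) y /\
    forall z, (\bigcup_n past lt (En n) y) z -> alpha z y = alpha z y} by apply: aeW.
apply: filterS (ae_cvg_info tE tE h) => p [v [v1 _]]; exists v.
exact: cvg_EFin_comp.
Qed.

Definition info_mean : R := fine (\int[mu]_p ulim alpha En p)%E.

Let info_mean_cvg : [/\ (\int[mu]_p S N p)%E @[N --> \oo] --> info_mean%:E &
  (\int[mu]_p s N p)%E @[N --> \oo] --> info_mean%:E ].
Proof.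
have [iL _ cS] : [/\ mu.-integrable setT (ulim alpha En),
    (\int[mu]_p `|S N p - ulim alpha En p|)%E @[N --> \oo] --> 0%E &
    (\int[mu]_p S N p)%E @[N --> \oo] --> (\int[mu]_p ulim alpha En p)%E].
  apply: (dominated_convergence measurableT _ _ _ integrable_S) => //.
  - exact: measurable_ulim.
  - apply: filterS ae_cvg_u => p [v hv] _.
    by rewrite /info_limit (cvg_limn_einf_sup hv); exact: cvg_esups.
  - by apply: aeW => p N _; rewrite gee0_abs// SS.
have [_ _ cs] : [/\ mu.-integrable setT (ulim alpha En),
    (\int[mu]_p `|s N p - ulim alpha En p|)%E @[N --> \oo] --> 0%E &
    (\int[mu]_p s N p)%E @[N --> \oo] --> (\int[mu]_p ulim alpha En p)%E].
  apply: (dominated_convergence measurableT _ _ _ integrable_S) => //.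
  - exact: measurable_ulim.
  - apply: filterS ae_cvg_u => p [v hv] _.
    by rewrite /info_limit (cvg_limn_einf_sup hv); exact: cvg_einfs.
  - apply: aeW => p N _; rewrite gee0_abs//.
    exact: le_trans (les p (leqnn N)) (leS p (leq0n N)).
by rewrite /info_mean fineK//; exact: integrable_fin_num.
Qed.

Let cvg_integral_u : (\int[mu]_p u n p)%E @[n --> \oo] --> info_mean%:E.
Proof.
have [cS cs] := info_mean_cvg.
apply: (squeeze_cvge _ cs cS); near=> n; apply/andP; split.
  by apply: ge0_le_integral => // p _; exact: les.
by apply: ge0_le_integral => // p _; exact: leS.
Unshelve. all: by end_near.
Qed.

Hypothesis ergodicE : invariant_dichotomy lam nu act En alpha.

Local Notation av := (avg act alpha).

(** The averages of the information at time n are squeezed between those of its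
    later infimum and supremum, to which the ergodic theorem applies. *)
Lemma ae_cvg_avg_info : {ae mu, forall p, av (En n) (u n) p @[n --> \oo] --> info_mean%:E}.
Proof.
have [cS cs] := info_mean_cvg.
have up (e : R) : 0 < e -> {ae mu, forall p, exists N, forall n, (N <= n)%N ->
    (av (En n) (u n) p <= (info_mean + e)%:E)%E}.
  move=> e0; have [N hN] : exists N, (\int[mu]_p S N p < (info_mean + e)%:E)%E.
    have /cvge_bounds/(_ e e0)[N /(_ N (leqnn N))/andP[_ h]] := cS.
    by exists N.
  have := ergodic_upper countG sieveX sieveY act_pmp E_inv tE ergodicE (mS N) (S0 N) hN.
  apply: filterS => p [M hM]; exists (maxn N M) => n; rewrite geq_max => /andP[Nn /hM].
  by apply: le_trans; apply: (avg_le act tE) => q; exact: leS.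
have lo (e : R) : 0 < e -> {ae mu, forall p, exists N, forall n, (N <= n)%N ->
    ((info_mean - e)%:E <= av (En n) (u n) p)%E}.
  move=> e0; have [N hN] : exists N, ((info_mean - e)%:E < \int[mu]_p s N p)%E.
    have /cvge_bounds/(_ e e0)[N /(_ N (leqnn N))/andP[h _]] := cs.
    by exists N.
  have := ergodic_lower countG sieveX sieveY act_pmp E_inv tE ergodicE (ms N) (s0 N) hN.
  apply: filterS => p [M hM]; exists (maxn N M) => n; rewrite geq_max => /andP[Nn /hM].
  by move=> /le_trans; apply; apply: (avg_le act tE) => q; exact: les.
have e0 k : 0 < k.+1%:R^-1 :> R by rewrite invr_gt0.
have h1 := ae_foralln (fun k => up _ (e0 k)).
have h2 := ae_foralln (fun k => lo _ (e0 k)).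
apply: filterS (filterI h1 h2) => p [{}h1 {}h2].
apply/cvge_bounds => e e_gt0; have [k] := ltr_add_invr e_gt0; rewrite add0r => ke.
have [N1 hN1] := h1 k; have [N2 hN2] := h2 k; exists (maxn N1 N2) => n.
rewrite geq_max => /andP[/hN1 a1 /hN2 a2]; apply/andP; split.
  by apply: lt_le_trans a2; rewrite lte_fin ltrD2l ltrN2.
by apply: (le_lt_trans a1); rewrite lte_fin ltrD2l.
Qed.

Local Notation k n p := ((class_card (En n) p.2)%:R : R).

Lemma measurable_class_name n :
  measurable_fun setT (fun p : X * Y => lam (name alpha (rel_class (En n) p.2) p.2 p.1)).
Proof.
have [M hM] := lift_bounded X tE n.
have h := measurable_name_measure countG sieveX sieveY act_pmp blkP (tame_alpha tE)
  (@measurable_lift _ _ X _ _ _ _ _ tE n) hM.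
exact: eq_measurable_fun h.
Qed.

Lemma ae_class_name_pos : {ae mu, forall p, forall n,
  lam (name alpha (rel_class (En n) p.2) p.2 p.1) != 0%E}.
Proof.
apply: ae_foralln => n.
pose A : set (X * Y) := ~` [set p | [set 0%E] (lam (name alpha (rel_class (En n) p.2) p.2 p.1))].
have mA : measurable A.
  by apply: measurableC; apply: (measurable_preimageT (measurable_class_name n) (emeasurable_set1 0%E)).
suff : {ae mu, forall p : X * Y, A p} by apply: filterS => p /eqP.
apply: (ae_fubini (A := A)) => //.
apply: aeW => y; have := ae_block_pos lam (name_finite_block act_pmp blkP alpha y (finite_class tE n y)).
by apply: filterS => x pos; apply/eqP.
Qed.

Lemma orbit_info_avg : {ae mu, forall p, forall n,
  av (En n) (u n) p = (orbit_info lam act blk alpha (En n) p / k n p)%:E}.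
Proof.
apply: filterS ae_class_name_pos => -[x y] pos n.
rewrite (chain_rule sieveY act_pmp blkP tE (pos n)) EFinM /avg; congr (_ * _)%E.
by rewrite /secsum fsumEFin//; exact: (finite_class tE).
Qed.

Lemma ae_cvg_orbit_info :
  {ae mu, forall p, (orbit_info lam act blk alpha (En n) p / k n p)%:E @[n --> \oo] --> info_mean%:E}.
Proof.
apply: filterS (filterI ae_cvg_avg_info orbit_info_avg) => p [h e].
by move: h; under eq_cvg do rewrite e.
Qed.

Lemma orbit_info_ge0 n p : 0 <= orbit_info lam act blk alpha (En n) p.
Proof.
have [_ _ mn _] := name_finite_block act_pmp blkP alpha p.2 (finite_class tE n p.2).
have mQ : measurable (name alpha (rel_class (En n) p.2) p.2 p.1) by exact: mn.
rewrite oppr_ge0 ln_le0// -lee_fin fineK ?fin_num_measure//.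
exact: probability_le1.
Qed.

Lemma measurable_orbit_mean n : measurable_fun setT
  (fun p : X * Y => (orbit_info lam act blk alpha (En n) p / k n p)%:E).
Proof.
under eq_fun do rewrite EFinM.
apply: emeasurable_funM; last exact: (@measurable_kn_inv R _ _ X _ _ _ _ sieveY _ _ _ tE n).
apply/measurable_EFinP; apply: measurable_funN; apply: (measurableT_comp (@measurable_ln R)).
exact: measurableT_comp (measurable_class_name n).
Qed.

(** Averaging over classes preserves integrals, so the mean information of the
    names is the integral of the conditional information. *)
Lemma cvg_integral_orbit_info :
  (\int[nu]_y \int[lam]_x (orbit_info lam act blk alpha (En n) (x, y) / k n (x, y))%:E)%E
    @[n --> \oo] --> info_mean%:E.
Proof.
have := cvg_integral_u; rewrite (_ : (fun n => _) = fun n =>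
  (\int[nu]_y \int[lam]_x (orbit_info lam act blk alpha (En n) (x, y) / k n (x, y))%:E)%E)//.
apply/funext => n; rewrite -(fubini_tonelli2 _ (measurable_orbit_mean n)); last first.
  by move=> p; rewrite lee_fin divr_ge0// orbit_info_ge0.
rewrite -(integral_avg_setI countG sieveX sieveY act_pmp E_inv tE (n := n) (mu_ n) (u0 n) measurableT)//.
apply: ae_eq_integral => //.
- exact: (measurable_avg countG sieveX sieveY act_pmp tE n (mu_ n)).
- exact: measurable_orbit_mean.
- by apply: filterS orbit_info_avg => p h _; exact: h.
Qed.

End tame_limit.

End limits.

(** * Discarding an invariant null set *)

(** Off Y1 the classes are single points. *)
Definition restrict_rel Y (Y1 : set Y) (F : set (Y * Y)) : set (Y * Y) :=
  (F `&` Y1 `*` Y1) `|` [set p | p.1 = p.2].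

Definition restrict_cocycle (G : groupType) Y (Y1 : set Y) (E : set (Y * Y))
    (alpha : Y -> Y -> G) (z y : Y) : G :=
  if `[< E (z, y) /\ (Y1 z /\ Y1 y) >] then alpha z y else 1%g.

Section restriction.
Context (R : realType) (G : groupType) dX (X : measurableType dX)
  dY (Y : measurableType dY).
Variables (FY : set (set Y)) (CY : nat -> nat -> set Y).
Hypothesis sieveY : complete_sieve FY CY.
Variables (lam : probability X R) (nu : probability Y R) (act : G -> X -> X).
Hypothesis act_pmp : pmp_action lam act.
Variable E : set (Y * Y).
Hypothesis E_pmp : pmp_rel nu E.
Variable alpha : Y -> Y -> G.
Hypothesis alpha_cocycle : measurable_cocycle nu E alpha.
Implicit Types (En : nat -> set (Y * Y)) (y z : Y) (n : nat).

Local Notation mu := (lam \x nu)%E.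

(** A conull set, invariant under all En n, on which the conditions imposed almost
    everywhere hold without exception. *)
Record good_part En (Y1 : set Y) : Prop := GoodPart {
  good_measurable : measurable Y1 ;
  good_null : nu (~` Y1) = 0%E ;
  good_invariant : forall n y z, En n (y, z) -> Y1 y -> Y1 z ;
  good_exhausts : forall y, Y1 y -> rel_class E y = \bigcup_n rel_class (En n) y ;
  good_cocycle : forall y, Y1 y -> forall w u z,
    rel_class E y w -> rel_class E y u -> rel_class E y z ->
    alpha z u = (alpha z w * alpha w u)%g ;
  good_bounded : forall n, exists M, forall y, Y1 y -> (class_card (En n) y <= M)%N }.

Lemma finite_class_sections En n y M : finite_set (rel_class (En n) y) ->
  (class_card (En n) y <= M)%N ->
  exists2 s : seq Y, (size s <= M)%N & forall z, En n (y, z) -> z \in s.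
Proof.
move=> fin le; exists (fset_set (rel_class (En n) y) : seq Y) => // z yz.
by rewrite in_fset_set// inE.
Qed.

(** A null set of bad points is enlarged to its saturation, which stays null by
    mass transport. *)
Lemma exists_good_part En : bounded_exhaustion nu E En -> exists Y1, good_part En Y1.
Proof.
move=> [[mEn fin inc sub exh] /choice[M hM]].
have [[mE _ _] E_inv] := E_pmp; have [_ coc] := alpha_cocycle.
have incr n m : (n <= m)%N -> En n `<=` En m.
  move=> /subnK <-; elim: (m - n)%N => [|i IH]//; rewrite addSn.
  exact: (subset_trans IH (inc _)).
have [N0 [mN0 N00 hN0]] := filterI (ae_foralln hM) (filterI exh coc).
have good y : ~ N0 y -> [/\ (forall n, (class_card (En n) y <= M n)%N),
    rel_class E y = \bigcup_n rel_class (En n) y &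
    forall w u z, rel_class E y w -> rel_class E y u -> rel_class E y z ->
    alpha z u = (alpha z w * alpha w u)%g].
  by move=> ny; apply: contrapT => h; apply: ny; apply: hN0 => -[h1 [h2 h3]]; exact: h.
(* Off N0 the classes are bounded, so that mass transport applies to the pairs
   leading from outside N0 into N0. *)
pose A n := En n `&` (~` N0 `*` N0).
have mA n : measurable (A n).
  apply: measurableI; first by case: (mEn n).
  by apply: measurableX => //; exact: measurableC.
have sA n : sections_le (M n) (A n).
  move=> y; have [Ny|/good[/(_ n) le _ _]] := pselect (N0 y); first by exists [::] => // z [_ []].
  have [s sM hs] := finite_class_sections (fin n y) le.
  by exists s => // z [/hs].
have sA' n : sections_le (M n) (swap (A n)).
  move=> z; have [[y [yz [ny Nz]]]|no] := pselect (exists y, A n (y, z)); last first.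
    by exists [::] => // y h; exfalso; apply: no; exists y.
  have [/(_ n) le _ _] := good y ny.
  have [s sM hs] := finite_class_sections (fin n y) le.
  exists s => // w [/= wz _]; apply: hs.
  have [_ [_ sym tr]] := mEn n.
  by apply: tr yz _; exact: sym.
have mS n : measurable (proj1 (A n)).
  by have [+ _] := measurable_proj1_nonmax sieveY sieveY (mA n) (sA n).
have S0 n : nu (proj1 (A n)) = 0%E.
  apply: (null_saturation sieveY E_inv (mA n) _ (sA n) (sA' n) mN0 N00) => [p [/sub]//|y z].
  by move=> [_ []].
pose N1 := N0 `|` \bigcup_n proj1 (A n).
have mN1 : measurable N1 by apply: measurableU => //; exact: bigcupT_measurable.
have N10 : nu N1 = 0%E.
  apply: measure_negligible => //; apply: negligibleU; first by exists N0; split=> //.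
  apply: negligible_bigcup => n; exists (proj1 (A n)); split; [exact: mS|exact: S0|exact: subset_refl].
have nN1 y : (~` N1) y -> ~ N0 y by move=> h Ny; apply: h; left.
exists (~` N1); split.
- exact: measurableC.
- by rewrite setCK.
- move=> n y z yz hy; have ny := nN1 _ hy.
  move=> [Nz|[m _ [w [zw [nz Nw]]]]]; apply: hy; right; first by exists n => //; exists z; split.
  exists (maxn n m) => //; exists w; split; last by split.
  have [_ [_ _ tr]] := mEn (maxn n m).
  by apply: tr (incr _ _ (leq_maxl n m) _ yz) (incr _ _ (leq_maxr n m) _ zw).
- by move=> y /nN1/good[].
- by move=> y /nN1/good[].
- by move=> n; exists (M n) => y /nN1/good[].
Qed.

Section good.
Variables (En : nat -> set (Y * Y)) (Y1 : set Y).
Hypotheses (En_exh : bounded_exhaustion nu E En) (good : good_part En Y1).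

Local Notation En' := (fun n => restrict_rel Y1 (En n)).
Local Notation alpha' := (restrict_cocycle Y1 E alpha).

Lemma good_sub n : En n `<=` E.
Proof. by case: En_exh => -[_ _ _ + _] _; exact. Qed.

Lemma rel_class_restrict n y : Y1 y -> rel_class (En' n) y = rel_class (En n) y.
Proof.
move=> Yy; have [[mEn _ _ _ _] _] := En_exh; have [_ [refl _ _]] := mEn n.
apply/seteqP; split=> z; first by move=> [[]//|/= <-]; exact: refl.
move=> yz; left; split=> //; split=> //; exact: (good_invariant good yz).
Qed.

Lemma class_card_restrict n y : Y1 y -> class_card (En' n) y = class_card (En n) y.
Proof. by move=> Yy; rewrite /class_card rel_class_restrict. Qed.

Lemma restrict_cocycleE y z : E (z, y) -> Y1 z -> Y1 y -> alpha' z y = alpha z y.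
Proof. by move=> zy Yz Yy; rewrite /restrict_cocycle asboolT. Qed.

Lemma measurable_diagonal : measurable [set p : Y * Y | p.1 = p.2].
Proof.
have mlt := measurable_sieve_lt sieveY.
have mgt : measurable [set p : Y * Y | sieve_lt CY p.2 p.1].
  exact: (measurable_preimageT (measurable_fun_pair measurable_snd measurable_fst) mlt).
rewrite (_ : [set p | _] = ~` ([set p | sieve_lt CY p.1 p.2] `|` [set p | sieve_lt CY p.2 p.1])).
  by apply: measurableC; exact: measurableU.
apply/seteqP; split=> -[y z] /=; first by move=> -> [] /sieve_lt_irr.
by move=> h; apply: contrapT => /(sieve_lt_total sieveY)/h.
Qed.

Lemma tame_restrict : tame E En' alpha'.
Proof.
have [[mEn fin inc sub exh] _] := En_exh.
have [[mE [Erefl Esym Etr] _] _] := E_pmp.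
have mY1 := good_measurable good.
have mYY : measurable (Y1 `*` Y1) by exact: measurableX.
split.
- move=> n; apply: measurableU; last exact: measurable_diagonal.
  by apply: measurableI => //; case: (mEn n).
- move=> n; have [_ [refl sym tr]] := mEn n; split.
  + by move=> y; right.
  + move=> y z [[yz [Yy Yz]]|/= ->]; last by right.
    by left; split; [exact: sym|split].
  + move=> x y z [[xy [Yx Yy]]|/= ->//] [[yz [_ Yz]]|/= <-]; last by left; split.
    by left; split; [exact: tr xy yz|split].
- move=> n m /subnK <-; elim: (m - n)%N => [//|i IH]; rewrite addSn.
  apply: (subset_trans IH) => p [[ep Yp]|dp]; last by right.
  by left; split=> //; exact: inc.
- move=> n; have [M hM] := good_bounded good n; exists M.+1 => y.
  have [Yy|nY] := pselect (Y1 y); last first.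
    by exists [:: y] => // z [[_ []]//|/= ->]; rewrite inE.
  have [s sM hs] := finite_class_sections (fin n y) (hM y Yy).
  exists s; first exact: leqW.
  move=> z h; apply: hs; have : rel_class (En' n) y z by [].
  by rewrite rel_class_restrict.
- by move=> n [y z] [[/sub]//|/= ->]; exact: Erefl.
- move=> g; have [mE_alpha _] := alpha_cocycle.
  pose D := E `&` Y1 `*` Y1.
  have mD : measurable D by exact: measurableI.
  have h : measurable (D `&` [set p | alpha p.1 p.2 = g]).
    rewrite (_ : _ `&` _ = (E `&` [set p | alpha p.1 p.2 = g]) `&` Y1 `*` Y1).
      exact: measurableI.
    by rewrite /D setIAC.
  have [g1|g1] := eqVneq g 1%g.
    rewrite (_ : [set _ | _] = (D `&` [set p | alpha p.1 p.2 = g]) `|` ~` D).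
      by apply: measurableU => //; exact: measurableC.
    apply/seteqP; split=> -[z y] /=; rewrite /restrict_cocycle /=.
      by case: asboolP => [Dp e|nD _]; [left|right].
    by move=> [[Dp e]|nD]; [rewrite asboolT|rewrite asboolF].
  rewrite (_ : [set _ | _] = D `&` [set p | alpha p.1 p.2 = g])//.
  apply/seteqP; split=> -[z y] /=; rewrite /restrict_cocycle /=.
    case: asboolP => [//|_ e]; by rewrite -e eqxx in g1.
  by move=> [Dp e]; rewrite asboolT.
- move=> n y w u z; have [Yy|nY] := pselect (Y1 y); last first.
    have triv v : En' n (y, v) -> y = v by move=> [[_ []]|].
    move=> /triv <- /triv <- /triv <-.
    by rewrite /restrict_cocycle asboolF ?mulg1// => -[_ []].
  rewrite -![restrict_rel _ _ (_, _)]/(rel_class (En' n) y _) rel_class_restrict//.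
  move=> yw yu yz.
  have Yw := good_invariant good yw Yy; have Yu := good_invariant good yu Yy.
  have Yz := good_invariant good yz Yy.
  have Ew := sub _ _ yw; have Eu := sub _ _ yu; have Ez := sub _ _ yz.
  rewrite !restrict_cocycleE//; first exact: (good_cocycle good Yy).
  + exact: Etr (Esym _ _ Ew) Eu.
  + exact: Etr (Esym _ _ Ez) Ew.
  + exact: Etr (Esym _ _ Ez) Eu.
Qed.

Lemma ae_good : {ae mu, forall p, Y1 p.2}.
Proof.
apply: (ae_fubini (A := [set p : X * Y | Y1 p.2])).
  exact: (measurable_preimageT measurable_snd (good_measurable good)).
exists (~` Y1); split; [exact: measurableC (good_measurable good)|exact: (good_null good)|].
by move=> y /= h Yy; apply: h; exact: aeW.
Qed.

(** A set invariant under the restricted relations is invariant, almost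
    everywhere, under the extended relation of E, as the relations exhaust E on
    Y1. *)
Lemma invariant_dichotomy_restrict :
  ergodic_rel mu (extended_rel E act alpha) -> invariant_dichotomy lam nu act En' alpha'.
Proof.
move=> erg A mA Ainv; apply: erg => //.
apply: filterS ae_good => -[x y] /= Yy [x' y'] [/= Eyy' xE].
have [n _ yy'] : (\bigcup_n rel_class (En n) y) y' by rewrite -(good_exhausts good Yy).
have yy'' : En' n (y, y').
  by have : rel_class (En' n) y y' by rewrite rel_class_restrict.
suff <- : move act alpha' ((x, y), y') = (x', y') by exact: (Ainv n).
have [[_ [Erefl Esym Etr] _] _] := E_pmp; have [act1 actM _ _] := act_pmp.
have Yy' := good_invariant good yy' Yy.
have [refl _ _] := tame_equiv tame_restrict n.
rewrite /move /=; congr (_, _); rewrite xE -actM.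
rewrite -(restrict_cocycleE Eyy' Yy Yy').
rewrite -(tame_cocycle tame_restrict (refl y) yy'' yy'').
by rewrite (cocycle1 tame_restrict yy'') act1.
Qed.

End good.

(** Any two exhaustions reach the same points before y in the end. *)
Lemma ae_restrict_past En1 Y1 En2 Y2 (lt : Y -> Y -> Prop) :
  bounded_exhaustion nu E En1 -> bounded_exhaustion nu E En2 ->
  good_part En1 Y1 -> good_part En2 Y2 ->
  {ae nu, forall y, \bigcup_n past lt (restrict_rel Y1 (En1 n)) y =
      \bigcup_n past lt (restrict_rel Y2 (En2 n)) y /\
    forall z, (\bigcup_n past lt (restrict_rel Y1 (En1 n)) y) z ->
      restrict_cocycle Y1 E alpha z y = restrict_cocycle Y2 E alpha z y}.
Proof.
move=> e1 e2 g1 g2.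
have conull Y0 En : good_part En Y0 -> {ae nu, forall y, Y0 y}.
  by move=> g; exists (~` Y0); split; [exact: measurableC (good_measurable g)|exact: (good_null g)|].
apply: filterS (filterI (conull _ _ g1) (conull _ _ g2)) => y [y1 y2].
have [[_ [_ Esym _] _] _] := E_pmp.
have pastE En Y0 : bounded_exhaustion nu E En -> good_part En Y0 -> Y0 y ->
    \bigcup_n past lt (restrict_rel Y0 (En n)) y = [set z | E (y, z) /\ lt z y].
  move=> e g Yy; apply/seteqP; split=> z.
    move=> [n _ [yz zy]]; split=> //; apply: (good_sub e (n := n)).
    by have : rel_class (restrict_rel Y0 (En n)) y z := yz; rewrite (rel_class_restrict e g).
  move=> [yz zy]; have [n _ h] : (\bigcup_n rel_class (En n) y) z by rewrite -(good_exhausts g Yy).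
  exists n => //; split=> //.
  by have : rel_class (restrict_rel Y0 (En n)) y z by rewrite (rel_class_restrict e g).
have inY En Y0 z : good_part En Y0 -> Y0 y -> E (y, z) -> Y0 z.
  move=> g Yy yz; have [n _ h] : (\bigcup_n rel_class (En n) y) z by rewrite -(good_exhausts g Yy).
  exact: (good_invariant g h).
rewrite (pastE _ _ e1 g1 y1) (pastE _ _ e2 g2 y2); split=> // z [yz _].
have zy := Esym _ _ yz.
rewrite !restrict_cocycleE//; [exact: (inY _ _ z g2)|exact: (inY _ _ z g1)].
Qed.

End restriction.

(** * Partitions, names and orbital entropy *)

Definition block T (P : set (set T)) (x : T) : set T :=
  [set x' | forall A, P A -> A x <-> A x'].

Section blocks.
Context (R : realType) (G : groupType) d (X : measurableType d)
  dY (Y : measurableType dY).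
Variables (b : R) (lam : probability X R) (P : set (set X)).
Hypothesis P_part : finite_measurable_partition P.

Lemma blockE A x : P A -> A x -> block P x = A.
Proof.
have [[_ triv _] _ _] := P_part; move=> PA Ax; apply/seteqP; split=> x'; first by move=> /(_ A PA)[+ _]; exact.
move=> Ax' B PB; split=> Bx.
  by rewrite (triv B A PB PA)//; exists x.
by rewrite (triv B A PB PA)//; exists x'.
Qed.

Lemma exists_block x : exists2 A, P A & A x.
Proof.
have [[cov _ _] _ _] := P_part.
have [A PA Ax] : cover P id x by rewrite cov.
by exists A.
Qed.

Lemma finite_block_map_block : finite_block_map (block P).
Proof.
have [_ fin mP] := P_part; split.
- by move=> x A _.
- move=> x x'; have [A PA Ax] := exists_block x; rewrite (blockE PA Ax) => Ax'.
  exact: blockE.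
- by move=> x; have [A PA Ax] := exists_block x; rewrite (blockE PA Ax); exact: mP.
- apply: sub_finite_set fin => _ [x _ <-].
  by have [A PA Ax] := exists_block x; rewrite (blockE PA Ax).
Qed.

Variables (act : G -> X -> X) (alpha : Y -> Y -> G).
Local Notation name := (name_cell act (block P) alpha).

Lemma orbit_partition_cell (F : set (Y * Y)) y B x :
  orbit_partition act alpha P F y B -> B x -> B = name (rel_class F y) y x.
Proof.
move=> [_ [A QA ->]] Bx; apply/seteqP; split=> w h z yz; have := QA z yz;
  move=> [D PD DE]; have := Bx z yz; have := h z yz; rewrite -DE /=.
  by move=> Dw Dx; rewrite (blockE PD Dx).
by move=> hw Dx; move: hw; rewrite (blockE PD Dx).
Qed.

Lemma orbit_partition_name (F : set (Y * Y)) y x :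
  orbit_partition act alpha P F y (name (rel_class F y) y x).
Proof.
split; first by exists x => z _ A _.
exists (fun z => act (alpha z y) @^-1` block P (act (alpha z y) x)) => //.
move=> z _; have [A PA Ax] := exists_block (act (alpha z y) x).
by exists A => //; rewrite (blockE PA Ax).
Qed.

Lemma orbit_partitionE (F : set (Y * Y)) y :
  orbit_partition act alpha P F y = range (name (rel_class F y) y).
Proof.
apply/seteqP; split=> [B QB|_ [x _ <-]]; last exact: orbit_partition_name.
have [[x Bx] _] := QB; exists x => //.
by rewrite -(orbit_partition_cell QB Bx).
Qed.

Lemma pblock_orbit_partition (F : set (Y * Y)) y x :
  pblock (orbit_partition act alpha P F y) id x = name (rel_class F y) y x.
Proof.
rewrite /pblock /pblock_index; apply: get_unique.
  by split; [exact: orbit_partition_name|move=> z _ A _].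
by move=> B [QB Bx]; exact: orbit_partition_cell.
Qed.

Lemma partition_entropyE (B : X -> set X) : finite_block_map B ->
  (partition_entropy b lam (range B))%:E =
  (\int[lam]_x (- ln (fine (lam (B x))))%:E * ((ln b)^-1)%:E)%E.
Proof.
move=> hB; rewrite (integral_block_info lam hB) -EFinM; congr (_%:E).
have fin : finite_set (range B) by have [] := hB.
rewrite /partition_entropy !fsbig_finite//= mulNr mulr_suml.
by congr (- _); apply: eq_bigr => A _; rewrite mulrA.
Qed.

End blocks.

(** The integral of a nonnegative function is the supremum over the simple
    functions below it, and cutting these down to A keeps their integrals. *)
Lemma ge0_integral_eq_on (R : realType) d (T : measurableType d)
    (mu : probability T R) (f g : T -> \bar R) (A : set T) :
  measurable A -> mu (~` A) = 0%E ->
  (forall x, 0 <= f x)%E -> (forall x, 0 <= g x)%E ->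
  (forall x, A x -> f x = g x) -> (\int[mu]_x f x = \int[mu]_x g x)%E.
Proof.
move=> mA A0.
suff le (f' g' : T -> \bar R) : (forall x, 0 <= f' x)%E -> (forall x, 0 <= g' x)%E ->
    (forall x, A x -> f' x = g' x) -> (\int[mu]_x f' x <= \int[mu]_x g' x)%E.
  by move=> f0 g0 fg; apply/eqP; rewrite eq_le !le// => x /fg.
move=> f0 g0 fg; rewrite !ge0_integralTE//.
apply: ge_ereal_sup => _ [h hf <-].
apply: ereal_sup_ubound; exists (proj_nnsfun h mA).
  move=> x; rewrite -mrestrict /patch; case: ifPn => [/set_mem Ax|_]; last exact: g0.
  by rewrite -fg.
rewrite -!integralT_nnsfun; apply: ae_eq_integral => //.
- by apply/measurable_EFinP; exact: measurable_funP.
- by apply/measurable_EFinP; exact: measurable_funP.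
exists (~` A); split=> //; first exact: measurableC.
move=> x nx Ax; apply: nx => _; rewrite -mrestrict /patch mem_set//.
Qed.

Section orbit_entropy.
Context (R : realType) (b : R) (G : groupType) dX (X : measurableType dX)
  dY (Y : measurableType dY).
Hypothesis b_gt1 : 1 < b.
Hypothesis countG : countable [set: G].
Variables (FX : set (set X)) (CX : nat -> nat -> set X).
Variables (FY : set (set Y)) (CY : nat -> nat -> set Y).
Hypotheses (sieveX : complete_sieve FX CX) (sieveY : complete_sieve FY CY).
Variables (lam : probability X R) (nu : probability Y R) (act : G -> X -> X).
Hypothesis act_pmp : pmp_action lam act.
Variable E : set (Y * Y).
Hypothesis E_pmp : pmp_rel nu E.
Variable alpha : Y -> Y -> G.
Hypothesis alpha_cocycle : measurable_cocycle nu E alpha.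
Variable P : set (set X).
Hypothesis P_part : finite_measurable_partition P.
Implicit Types (En : nat -> set (Y * Y)) (x : X) (y z : Y) (n : nat).

Local Notation mu := (lam \x nu)%E.
Let blkP := finite_block_map_block P_part.
Let E_inv : invariant_measure nu E := proj2 E_pmp.

Section exhaustion.
Variables (En : nat -> set (Y * Y)) (Y1 : set Y).
Hypotheses (En_exh : bounded_exhaustion nu E En) (good : good_part nu E alpha En Y1).

Local Notation En' := (fun n => restrict_rel Y1 (En n)).
Local Notation alpha' := (restrict_cocycle Y1 E alpha).
Local Notation mean := (info_mean CY lam nu act (block P) En' alpha').
Let tE : tame E En' alpha' := tame_restrict sieveY E_pmp alpha_cocycle En_exh good.

Lemma restrict_name n y : Y1 y ->
  name_cell act (block P) alpha' (rel_class (En' n) y) y =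
  name_cell act (block P) alpha (rel_class (En n) y) y.
Proof.
move=> Yy; rewrite (rel_class_restrict En_exh good n Yy).
have [[_ [_ Esym _] _] _] := E_pmp.
apply/funext => x; apply/seteqP; split=> w h z yz; have := h z yz;
  rewrite restrict_cocycleE//;
  by [exact: (good_invariant good yz Yy)|exact: Esym (good_sub En_exh yz)].
Qed.

Lemma orbit_name_finite_block n y :
  finite_block_map (name_cell act (block P) alpha (rel_class (En n) y) y).
Proof.
have [[_ fin _ _ _] _] := En_exh.
exact: (name_finite_block act_pmp blkP).
Qed.

(** The integrand agrees on Y1 with the integral over X of the information of the
    names for the restricted relations. *)
Lemma cvg_mean_orbit_entropy :
  mean_orbit_entropy b lam nu act alpha P (En n) @[n --> \oo] --> (mean / ln b)%:E.
Proof.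
have lnb : 0 < ln b by rewrite ln_gt0.
pose g n y := (\int[lam]_x (orbit_info lam act (block P) alpha' (En' n) (x, y) /
  (class_card (En' n) y)%:R)%:E)%E.
have h : (\int[nu]_y g n y)%E @[n --> \oo] --> mean%:E.
  exact: (cvg_integral_orbit_info countG sieveX sieveY act_pmp E_inv blkP tE).
rewrite EFinM; have := cvgeZr (y := ((ln b)^-1)%:E) isT h.
rewrite (_ : (fun n => _) = fun n => mean_orbit_entropy b lam nu act alpha P (En n))//.
apply/funext => n.
have mo := measurable_orbit_mean countG sieveX sieveY act_pmp blkP tE n.
have o0 (p : X * Y) : (0 <= (orbit_info lam act (block P) alpha' (En' n) p / (class_card (En' n) p.2)%:R)%:E)%E.
  by rewrite lee_fin divr_ge0//; exact: (orbit_info_ge0 act_pmp blkP tE).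
have g0 y : (0 <= g n y)%E by apply: integral_ge0 => x _; exact: o0.
have mg : measurable_fun setT (g n) by exact: (measurable_fun_fubini_tonelli_G _ mo o0).
rewrite -ge0_integralZr//; last by rewrite lee_fin invr_ge0 ltW.
apply: (ge0_integral_eq_on (good_measurable good) (good_null good)) => [y|y|y Yy].
- by apply: mule_ge0 => //; rewrite lee_fin invr_ge0 ltW.
- rewrite lee_fin divr_ge0// orbit_partitionE//.
  rewrite -lee_fin (partition_entropyE b lam (orbit_name_finite_block n y)).
  apply: mule_ge0; last by rewrite lee_fin invr_ge0 ltW.
  apply: integral_ge0 => x _; rewrite lee_fin oppr_ge0 ln_le0// -lee_fin.
  have [_ _ mB _] := orbit_name_finite_block n y.
  by rewrite fineK ?fin_num_measure//; exact: probability_le1.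
have [_ _ mB _] := orbit_name_finite_block n y.
have fin := orbit_name_finite_block n y.
rewrite orbit_partitionE// EFinM (partition_entropyE b lam fin) muleAC; congr (_ * _)%E.
rewrite /g -(class_card_restrict En_exh good n Yy).
under eq_integral do rewrite EFinM.
rewrite ge0_integralZr ?lee_fin ?invr_ge0//.
- by congr (_ * _)%E; apply: eq_integral => x _; rewrite /orbit_info /= restrict_name.
- apply/measurable_EFinP; apply: measurable_funN; apply: (measurableT_comp (@measurable_ln R)).
  apply: measurableT_comp => //.
  exact: (measurableT_comp (measurable_class_name countG sieveX sieveY act_pmp blkP tE n)
    (@pair2_measurable _ _ X Y y)).
- by move=> x _; rewrite lee_fin; exact: (orbit_info_ge0 act_pmp blkP tE).
Qed.

Hypothesis E_ext_erg : ergodic_rel mu (extended_rel E act alpha).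

Lemma ae_cvg_information : {ae mu, forall p : X * Y,
  (information b lam (pblock (orbit_partition act alpha P (En n) p.2) id p.1)
     * ((class_card (En n) p.2)%:R^-1)%:E)%E
  @[n --> \oo] --> (mean / ln b)%:E}.
Proof.
have dich := invariant_dichotomy_restrict sieveY act_pmp E_pmp alpha_cocycle En_exh good E_ext_erg.
have h1 := ae_cvg_orbit_info countG sieveX sieveY act_pmp E_inv blkP tE dich.
have h2 := ae_class_name_pos countG sieveX sieveY nu act_pmp blkP tE.
apply: filterS (filterI (ae_good lam good) (filterI h1 h2)) => -[x y] /= [Yy [cv pos]].
rewrite EFinM; have := cvgeZr (y := ((ln b)^-1)%:E) isT cv.
apply: cvg_trans; apply: near_eq_cvg; near=> n.
rewrite /= pblock_orbit_partition// /information /orbit_info /= restrict_name//.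
rewrite (class_card_restrict En_exh good n Yy).
have := pos n; rewrite /= restrict_name//.
have [_ _ mB _] := orbit_name_finite_block n y.
have mBx := mB x; set L := lam _.
have -> : L = (fine L)%:E by rewrite fineK// fin_num_measure.
have L0 : 0 <= fine L by apply: fine_ge0; exact: measure_ge0.
rewrite /lne /= eqe => Ln0; rewrite leNgt lt0r Ln0 L0 /=.
by congr (_%:E); rewrite !mulNr mulrAC.
Unshelve. all: by end_near.
Qed.

End exhaustion.

Lemma info_mean_exhaustion_indep En1 Y1 En2 Y2 :
  bounded_exhaustion nu E En1 -> bounded_exhaustion nu E En2 ->
  good_part nu E alpha En1 Y1 -> good_part nu E alpha En2 Y2 ->
  info_mean CY lam nu act (block P) (fun n => restrict_rel Y1 (En1 n)) (restrict_cocycle Y1 E alpha) =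
  info_mean CY lam nu act (block P) (fun n => restrict_rel Y2 (En2 n)) (restrict_cocycle Y2 E alpha).
Proof.
move=> e1 e2 g1 g2.
have t1 := tame_restrict sieveY E_pmp alpha_cocycle e1 g1.
have t2 := tame_restrict sieveY E_pmp alpha_cocycle e2 g2.
have past12 := ae_restrict_past E_pmp (sieve_lt CY) e1 e2 g1 g2.
by rewrite /info_mean (integral_info_limit_eq countG sieveX sieveY act_pmp blkP t1 t2 past12).
Qed.

(** The number info_mean / ln b is a limit along every bounded exhaustion, and
    limits are unique. *)
Lemma orbital_entropyE En Y1 : bounded_exhaustion nu E En -> good_part nu E alpha En Y1 ->
  orbital_entropy b lam nu act alpha P E =
  info_mean CY lam nu act (block P) (fun n => restrict_rel Y1 (En n)) (restrict_cocycle Y1 E alpha)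
    / ln b.
Proof.
move=> e g; apply: get_unique.
  move=> En2 e2; have [Y2 g2] := exists_good_part sieveY E_pmp alpha_cocycle e2.
  rewrite (info_mean_exhaustion_indep e e2 g g2).
  exact: cvg_mean_orbit_entropy.
move=> h /(_ En e) hh; apply: EFin_inj.
rewrite -(cvg_lim _ hh)//; apply/esym.
by rewrite -(cvg_lim _ (cvg_mean_orbit_entropy e g)).
Qed.

End orbit_entropy.

Theorem theorem1p8 (R : realType) (b : R) (hb : 1 < b)
    (G : groupType) (countG : countable [set: G])
    (dX : measure_display) (X : measurableType dX) (stdX : standard_borel R X)
    (lambda : probability X R) (act : G -> X -> X)
    (act_pmp : pmp_action lambda act)
    (act_erg : ergodic_action lambda act)
    (act_free : essentially_free lambda act)
    (dY : measure_display) (Y : measurableType dY) (stdY : standard_borel R Y)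
    (nu : probability Y R) (E : set (Y * Y))
    (E_pmp : pmp_rel nu E) (E_amen : amenable_rel nu E)
    (alpha : Y -> Y -> G)
    (alpha_cocycle : measurable_cocycle nu E alpha)
    (alpha_inj : class_injective nu E alpha)
    (E_ext_erg : ergodic_rel (lambda \x nu)%E (extended_rel E act alpha))
    (En : nat -> set (Y * Y))
    (En_exh : bounded_exhaustion nu E En)
    (En_growth : growth_condition nu En)
    (P : set (set X)) (P_part : finite_measurable_partition P) :
  {ae (lambda \x nu)%E, forall p : X * Y,
     (information b lambda
        (pblock (orbit_partition act alpha P (En n) p.2) id p.1)
      * ((class_card (En n) p.2)%:R^-1)%:E)%E
     @[n --> \oo] --> (orbital_entropy b lambda nu act alpha P E)%:E}.
Proof.
have [FX [CX sieveX]] := standard_borel_sieve stdX.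
have [FY [CY sieveY]] := standard_borel_sieve stdY.
have [Y1 good] := exists_good_part sieveY E_pmp alpha_cocycle En_exh.
rewrite (orbital_entropyE hb countG sieveX sieveY act_pmp E_pmp alpha_cocycle P_part En_exh good).
exact: (ae_cvg_information b countG sieveX sieveY act_pmp E_pmp alpha_cocycle P_part En_exh good E_ext_erg).
Qed.
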